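(* Let $n\geq 1$ and let $T$ be a complete theory of valued fields, possibly with additional structure. Suppose that $T$ satisfies the conditions $(\mathrm{SE})_n$ and $(\mathrm{Im})_n$ (that is, $T$ has $\mathrm{NIP}_n$ CHIPS). Then $T$ is $\mathrm{NIP}_n$ if and only if the theories of the residue field and of the value group are $\mathrm{NIP}_n$.
   Context: $\mathrm{NIP}_n$: let $T$ be a complete theory with monster model $\mathcal M$. A formula $\phi(x;y_1,\dots,y_n)$ (with $x,y_i$ tuples of variables) has $\mathrm{IP}_n$ if there are $(a^k_i)^{1\le k\le n}_{i<\omega}$ and $(b_J)_{J\subset\omega^n}$ in $\mathcal M$ such that $\mathcal M\vDash\phi(b_J;a^1_{i_1},\dots,a^n_{i_n})$ iff $(i_1,\dots,i_n)\in J$. A formula is $\mathrm{NIP}_n$ if it does not have $\mathrm{IP}_n$; a theory is $\mathrm{NIP}_n$ if all its formulas are. A valued field is viewed as a 3-sorted structure with sorts $K$ and the residue field $k$ in the ring language, the value group $\Gamma$ in the ordered group language, and the (partial) maps $v:K\to\Gamma$ and residue $K\to k$; here it may carry additional structure. The residue field and the value group are considered with the (possibly augmented) structure they carry, the same structure being used for $(\mathrm{SE})_n$ and for the conclusion. A $\emptyset$-definable set $D$ is $n$-hanced stably embedded if for all formulas $\phi(x,y_1,\dots,y_n)$ and all sequences $(a_i^k)_{i\in I}^{1\le k\le n}$ in $\mathcal M$, each $a_i^k$ being a tuple matching $y_k$ in length and sorts, there are a formula $\psi(x,z_1,\dots,z_n)$ and a sequence $(b_i^k)_{i\in I}^{1\le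 k\le n}$ of tuples from $D$, each $b_i^k$ matching $z_k$, such that $\phi(D,a^1_{i_1},\dots,a^n_{i_n})=\psi(D,b^1_{i_1},\dots,b^n_{i_n})$ for all $i_1,\dots,i_n\in I$. Here $\phi(D,a)$ denotes the set of realizations of $\phi(x,a)$ in $D$. $(\mathrm{SE})_n$: the residue field and the value group are $n$-hanced stably embedded. $(\mathrm{Im})_n$: for any small models $K_1,\dots,K_n\vDash T$ (inside the monster model), writing $L$ for their compositum, and for any singleton $b\in\mathcal M$, if $L(b)/K_i$ is an immediate extension of valued fields (with the restriction of the valuation of $\mathcal M$) for all $i$, then there is $p\subset\operatorname{tp}(b/K_1,\dots,K_n)$ such that: every formula $\phi(x;y_1,\dots,y_n)\in p$, where $x$ is the variable for $b$ and $y_i$ the variables for parameters from $K_i$, is $\mathrm{NIP}_n$; and for every formula $\psi$, $\psi(b,K_1,\dots,K_n)$ holds iff $p\vdash\psi$ (that is, $p$ implies the whole type $\operatorname{tp}(b/K_1,\dots,K_n)$). *)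

(* Defs.v *)
From Stdlib Require Import List Ring_theory.
From mathcomp Require Import all_boot.

Set Implicit Arguments.
Unset Strict Implicit.
Unset Printing Implicit Defensive.

(** * Many-sorted first-order logic *)

(* A finite list of sorts: the sorts of a finite tuple of variables. *)
Record ctx (S : Type) := Ctx { len : nat; srt : 'I_len -> S }.

Definition ctx0 {S : Type} (s : S) : ctx S := @Ctx S 0 (fun=> s).
Definition ctx1 {S : Type} (s : S) : ctx S := @Ctx S 1 (fun=> s).
Definition ctx2 {S : Type} (s t : S) : ctx S :=
  @Ctx S 2 (fun i => if i == ord0 then s else t).

Definition tup (S : Type) (A : S -> Type) (c : ctx S) : Type :=
  forall i : 'I_(len c), A (srt i).

Definition tup0 (S : Type) (A : S -> Type) (s : S) : tup A (ctx0 s) :=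
  fun i => let: Ordinal _ lt_i0 := i in False_rect _ (notF lt_i0).
Definition tup1 (S : Type) (A : S -> Type) (s : S) (x : A s) :
  tup A (ctx1 s) := fun=> x.
Definition tup2 (S : Type) (A : S -> Type) (s t : S) (x : A s) (y : A t) :
  tup A (ctx2 s t) :=
  fun i => if i == ord0 as e return A (if e then s else t) then x else y.

Record language (S : Type) := Language {
  fsym : Type; fdom : fsym -> ctx S; fcod : fsym -> S;
  rsym : Type; rdom : rsym -> ctx S }.

(* The disjoint union of two languages on the same sorts. *)
Definition lsum (S : Type) (L1 L2 : language S) : language S :=
  @Language S
    (fsym L1 + fsym L2)%type
    (fun f => match f with inl f => fdom f | inr f => fdom f end)
    (fun f => match f with inl f => fcod f | inr f => fcod f end)
    (rsym L1 + rsym L2)%type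
    (fun r => match r with inl r => rdom r | inr r => rdom r end).

(* A copy, on the sort s, of a one-sorted language. *)
Definition lat (S : Type) (s : S) (L : language unit) : language S :=
  @Language S
    (fsym L) (fun f => @Ctx S (len (fdom f)) (fun=> s)) (fun=> s)
    (rsym L) (fun r => @Ctx S (len (rdom r)) (fun=> s)).

Record interp (S : Type) (L : language S) (A : S -> Type) := Interp {
  fint : forall f : fsym L, tup A (fdom f) -> A (fcod f);
  rint : forall r : rsym L, tup A (rdom r) -> Prop }.

Record structure (S : Type) (L : language S) := Structure {
  car :> S -> Type;
  itp : interp L car }.

(* Variables form an arbitrary type V with sorts sv : V -> S; a quantifier
   goes from V to option V, the bound variable being None. *)
Definition osrt (S V : Type) (s : S) (sv : V -> S) (v : option V) : S :=
  if v is Some w then sv w else s.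

Inductive term (S : Type) (L : language S) (V : Type) (sv : V -> S) :
    S -> Type :=
| Var (v : V) : term L sv (sv v)
| App (f : fsym L) :
    (forall i : 'I_(len (fdom f)), term L sv (srt i)) -> term L sv (fcod f).

Inductive formula (S : Type) (L : language S) (V : Type) (sv : V -> S) :
    Type :=
| FEq (s : S) of term L sv s & term L sv s
| FRel (r : rsym L) of (forall i : 'I_(len (rdom r)), term L sv (srt i))
| FNot of formula L sv
| FAnd of formula L sv & formula L sv
| FEx (s : S) of formula L (osrt s sv).

Definition oenv (S : Type) (A : S -> Type) (V : Type) (sv : V -> S) (s : S)
    (x : A s) (e : forall v, A (sv v)) : forall v, A (osrt s sv v) :=
  fun v => match v return A (osrt s sv v) with Some w => e w | None => x end.

Fixpoint eval (S : Type) (L : language S) (M : structure L) (V : Type)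
    (sv : V -> S) (e : forall v, M (sv v)) (s : S) (t : term L sv s) : M s :=
  match t in term _ _ s return M s with
  | Var v => e v
  | App f ts => fint (itp M) (fun i => eval e (ts i))
  end.

Fixpoint sat (S : Type) (L : language S) (M : structure L) (V : Type)
    (sv : V -> S) (e : forall v, M (sv v)) (phi : formula L sv) : Prop :=
  match phi with
  | FEq _ t u => eval e t = eval e u
  | FRel r ts => rint (itp M) (fun i => eval e (ts i))
  | FNot phi => ~ sat e phi
  | FAnd phi psi => sat e phi /\ sat e psi
  | FEx s phi => exists x : M s, sat (oenv x e) phi
  end.

(** ** Theories *)

Definition no_srt (S : Type) (v : void) : S := match v with end.

Definition sentence (S : Type) (L : language S) : Type :=
  formula L (@no_srt S).

Definition holds (S : Type) (L : language S) (M : structure L)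
    (sigma : sentence L) : Prop :=
  sat (fun v : void => match v return M (no_srt S v) with end) sigma.

Definition theory (S : Type) (L : language S) : Type := sentence L -> Prop.

Definition model (S : Type) (L : language S) (T : theory L)
    (M : structure L) : Prop :=
  forall sigma, T sigma -> holds M sigma.

Definition entails (S : Type) (L : language S) (T : theory L)
    (sigma : sentence L) : Prop :=
  forall M : structure L, model T M -> holds M sigma.

Definition complete (S : Type) (L : language S) (T : theory L) : Prop :=
  (exists M : structure L, model T M) /\
  (forall sigma : sentence L, entails T sigma \/ entails T (FNot sigma)).

(** ** Monster models *)

Definition card_lt (A B : Type) : Prop :=
  (exists f : A -> B, injective f) /\ ~ (exists g : B -> A, injective g).

(* The parameters are a family a indexed by a small type A; a 1-type over
   them is a set p of formulas in the variables option A, None standing for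
   the variable of the type. *)
Definition saturated (kappa : Type) (S : Type) (L : language S)
    (M : structure L) : Prop :=
  forall (A : Type) (sa : A -> S) (a : forall i, M (sa i)) (s : S)
         (p : formula L (osrt s sa) -> Prop),
    card_lt A kappa ->
    (forall l : seq (formula L (osrt s sa)),
       (forall phi, List.In phi l -> p phi) ->
       exists x : M s, forall phi, List.In phi l -> sat (oenv x a) phi) ->
    exists x : M s, forall phi, p phi -> sat (oenv x a) phi.

Definition automorphism (S : Type) (L : language S) (M : structure L)
    (h : forall s, M s -> M s) : Prop :=
  [/\ forall s, bijective (h s),
      forall (f : fsym L) (x : tup M (fdom f)),
        h (fcod f) (fint (itp M) x) = fint (itp M) (fun i => h _ (x i))
    & forall (r : rsym L) (x : tup M (rdom r)),
        rint (itp M) x <-> rint (itp M) (fun i => h _ (x i))].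

Definition strongly_homogeneous (kappa : Type) (S : Type) (L : language S)
    (M : structure L) : Prop :=
  forall (A : Type) (sa : A -> S) (a a' : forall i, M (sa i)),
    card_lt A kappa ->
    (forall phi : formula L sa, sat a phi <-> sat a' phi) ->
    exists h : forall s, M s -> M s,
      automorphism h /\ forall i, h _ (a i) = a' i.

(* "Small" means of cardinality < kappa, where kappa > |L| + aleph_0. *)
Definition monster (kappa : Type) (S : Type) (L : language S) (T : theory L)
    (M : structure L) : Prop :=
  [/\ model T M, card_lt (S + fsym L + rsym L + nat)%type kappa,
      saturated kappa M & strongly_homogeneous kappa M].

Definition small_model (kappa : Type) (S : Type) (L : language S)
    (M : structure L) (P : forall s, M s -> Prop) : Prop :=
  card_lt {s : S & {x : M s | P s x}} kappa /\
  exists (N : structure L) (h : forall s, N s -> M s),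
    (forall (V : Type) (sv : V -> S) (e : forall v, N (sv v))
            (phi : formula L sv),
       sat e phi <-> sat (fun v => h _ (e v)) phi) /\
    (forall s (x : M s), P s x <-> exists y : N s, h s y = x).

(** * NIP_n *)

(* The variables of phi(x; y_1, ..., y_n), x and y_k being tuples of
   variables with sorts xs and ys k. *)
Definition psrt (S : Type) (n : nat) (xs : ctx S) (ys : 'I_n -> ctx S)
    (v : 'I_(len xs) + {k : 'I_n & 'I_(len (ys k))}) : S :=
  match v with inl i => srt i | inr kj => srt (tagged kj) end.

Definition pformula (S : Type) (L : language S) (n : nat) (xs : ctx S)
    (ys : 'I_n -> ctx S) : Type := formula L (@psrt S n xs ys).

Definition penv (S : Type) (A : S -> Type) (n : nat) (xs : ctx S)
    (ys : 'I_n -> ctx S) (b : tup A xs) (a : forall k, tup A (ys k)) :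
    forall v, A (@psrt S n xs ys v) :=
  fun v => match v return A (psrt v) with
           | inl i => b i
           | inr kj => a (tag kj) (tagged kj)
           end.

(* M |= phi(b; a_1, ..., a_n) *)
Definition psat (S : Type) (L : language S) (M : structure L) (n : nat)
    (xs : ctx S) (ys : 'I_n -> ctx S) (phi : pformula L xs ys)
    (b : tup M xs) (a : forall k, tup M (ys k)) : Prop :=
  sat (penv b a) phi.

(* Subsets J of omega^n are predicates on {ffun 'I_n -> nat}. *)
Definition has_IP (S : Type) (L : language S) (M : structure L) (n : nat)
    (xs : ctx S) (ys : 'I_n -> ctx S) (phi : pformula L xs ys) : Prop :=
  exists (a : forall k : 'I_n, nat -> tup M (ys k))
         (b : ({ffun 'I_n -> nat} -> Prop) -> tup M xs),
    forall (J : {ffun 'I_n -> nat} -> Prop) (i : {ffun 'I_n -> nat}),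
      psat phi (b J) (fun k => a k (i k)) <-> J i.

Definition formula_NIP (S : Type) (L : language S) (M : structure L)
    (n : nat) (xs : ctx S) (ys : 'I_n -> ctx S) (phi : pformula L xs ys) :
    Prop := ~ has_IP M phi.

(* The complete theory of M is NIP_n, M being its monster model.  This is also
   used for the structures carried by a sort of a monster model: they inherit
   its saturation, and so are monster models of their own theories. *)
Definition theory_NIP (n : nat) (S : Type) (L : language S)
    (M : structure L) : Prop :=
  forall (xs : ctx S) (ys : 'I_n -> ctx S) (phi : pformula L xs ys),
    formula_NIP M phi.

(** * Structure carried by a sort *)

(* A one-sorted structure on the sort s of M, all of whose basic functions
   and relations are definable in M without parameters.  It can be anything
   from a pure field to the full structure induced by M on the sort. *)
Definition definable_structure (S : Type) (L : language S) (M : structure L)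
    (s : S) (L' : language unit) (N : interp L' (fun _ : unit => M s)) :
    Prop :=
  (forall f : fsym L', exists phi : formula L (osrt s (fun _ : 'I_(len (fdom f)) => s)),
     forall (x : 'I_(len (fdom f)) -> M s) (y : M s),
       fint N (f := f) x = y <->
       sat (@oenv S M _ (fun _ : 'I_(len (fdom f)) => s) s y x) phi) /\
  (forall r : rsym L', exists phi : formula L (fun _ : 'I_(len (rdom r)) => s),
     forall x : 'I_(len (rdom r)) -> M s,
       rint N (r := r) x <->
       @sat S L M _ (fun _ : 'I_(len (rdom r)) => s) x phi).

(* The sort s, with the structure N, is n-hanced stably embedded in M.  When
   N is the full induced structure, psi is an arbitrary formula of L with
   variables x, z_1, ..., z_n of sort s. *)
Definition hanced_stably_embedded (kappa : Type) (n : nat) (S : Type)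
    (L : language S) (M : structure L) (s : S) (L' : language unit)
    (N : interp L' (fun _ : unit => M s)) : Prop :=
  forall (ys : 'I_n -> ctx S) (phi : pformula L (ctx1 s) ys)
         (I : Type) (a : forall k : 'I_n, I -> tup M (ys k)),
    card_lt I kappa ->
    exists (zs : 'I_n -> ctx unit) (psi : pformula L' (ctx1 tt) zs)
           (b : forall k : 'I_n, I -> tup (Structure N) (zs k)),
      forall (i : 'I_n -> I) (d : M s),
        psat phi (tup1 d) (fun k => a k (i k)) <->
        @psat _ _ (Structure N) _ _ _ psi
          (@tup1 _ (Structure N) tt d) (fun k => b k (i k)).

(** * Valued fields *)

Inductive ring_fun := R0 | R1 | RAdd | RMul | ROpp.
Inductive ogroup_fun := G0 | GAdd | GOpp.
Inductive ogroup_rel := GLe.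

Definition ring_language : language unit :=
  @Language unit ring_fun
    (fun f => match f with
              | R0 | R1 => ctx0 tt
              | RAdd | RMul => ctx2 tt tt
              | ROpp => ctx1 tt
              end)
    (fun=> tt)
    void (fun r => match r with end).

Definition ogroup_language : language unit :=
  @Language unit ogroup_fun
    (fun f => match f with
              | G0 => ctx0 tt
              | GAdd => ctx2 tt tt
              | GOpp => ctx1 tt
              end)
    (fun=> tt)
    ogroup_rel (fun=> ctx2 tt tt).

Inductive vf_sort := sK | sk | sG.

(* The partial maps v : K -> Gamma and res : K -> k are given by their
   graphs. *)
Inductive vf_rel := RVal | RRes.

Definition maps_language : language vf_sort :=
  @Language vf_sort
    void (fun f => match f with end) (fun f => match f with end)
    vf_rel (fun r => match r with RVal => ctx2 sK sG | RRes => ctx2 sK sk end).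

Definition base_language : language vf_sort :=
  lsum (lsum (lat sK ring_language) (lat sk ring_language))
       (lsum (lat sG ogroup_language) maps_language).

(* X is the additional structure. *)
Definition vf_language (X : language vf_sort) : language vf_sort :=
  lsum base_language X.

Definition field_K (X : language vf_sort) (M : structure (vf_language X)) :
    interp ring_language (fun=> M sK) :=
  @Interp unit ring_language (fun=> M sK)
    (fun f x => @fint _ _ _ (itp M) (inl (inl (inl f))) x)
    (fun r => match r with end).

Definition residue_field (X : language vf_sort)
    (M : structure (vf_language X)) : interp ring_language (fun=> M sk) :=
  @Interp unit ring_language (fun=> M sk)
    (fun f x => @fint _ _ _ (itp M) (inl (inl (inr f))) x)
    (fun r => match r with end).

Definition value_group (X : language vf_sort)
    (M : structure (vf_language X)) : interp ogroup_language (fun=> M sG) :=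
  @Interp unit ogroup_language (fun=> M sG)
    (fun f x => @fint _ _ _ (itp M) (inl (inr (inl f))) x)
    (fun r x => @rint _ _ _ (itp M) (inl (inr (inl r))) x).

(* val x g means v(x) = g, and res x r means that the residue of x is r. *)
Definition val (X : language vf_sort) (M : structure (vf_language X))
    (x : M sK) (g : M sG) : Prop :=
  @rint _ _ _ (itp M) (inl (inr (inr RVal))) (tup2 x g).
Definition res (X : language vf_sort) (M : structure (vf_language X))
    (x : M sK) (r : M sk) : Prop :=
  @rint _ _ _ (itp M) (inl (inr (inr RRes))) (tup2 x r).

Section Operations.
Variable A : Type.
Let C : unit -> Type := fun=> A.

Definition rzero (N : interp ring_language C) : A :=
  @fint _ _ _ N R0 (@tup0 _ C tt).
Definition rone (N : interp ring_language C) : A :=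
  @fint _ _ _ N R1 (@tup0 _ C tt).
Definition radd (N : interp ring_language C) (x y : A) : A :=
  @fint _ _ _ N RAdd (@tup2 _ C tt tt x y).
Definition rmul (N : interp ring_language C) (x y : A) : A :=
  @fint _ _ _ N RMul (@tup2 _ C tt tt x y).
Definition ropp (N : interp ring_language C) (x : A) : A :=
  @fint _ _ _ N ROpp (@tup1 _ C tt x).

Definition gzero (N : interp ogroup_language C) : A :=
  @fint _ _ _ N G0 (@tup0 _ C tt).
Definition gadd (N : interp ogroup_language C) (x y : A) : A :=
  @fint _ _ _ N GAdd (@tup2 _ C tt tt x y).
Definition gopp (N : interp ogroup_language C) (x : A) : A :=
  @fint _ _ _ N GOpp (@tup1 _ C tt x).
Definition gle (N : interp ogroup_language C) (x y : A) : Prop :=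
  @rint _ _ _ N GLe (@tup2 _ C tt tt x y).

Definition is_field (N : interp ring_language C) : Prop :=
  [/\ ring_theory (rzero N) (rone N) (radd N) (rmul N)
        (fun x y => radd N x (ropp N y)) (ropp N) eq,
      rone N <> rzero N
    & forall x, x <> rzero N -> exists y, rmul N x y = rone N].

Record is_ordered_group (N : interp ogroup_language C) : Prop := {
  og_addA : forall x y z, gadd N x (gadd N y z) = gadd N (gadd N x y) z;
  og_addC : forall x y, gadd N x y = gadd N y x;
  og_add0 : forall x, gadd N (gzero N) x = x;
  og_addN : forall x, gadd N (gopp N x) x = gzero N;
  og_le_anti : forall x y, gle N x y -> gle N y x -> x = y;
  og_le_trans : forall x y z, gle N x y -> gle N y z -> gle N x z;
  og_le_total : forall x y, gle N x y \/ gle N y x;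
  og_le_add : forall x y z, gle N x y -> gle N (gadd N z x) (gadd N z y) }.

End Operations.

Record is_valued_field (X : language vf_sort)
    (M : structure (vf_language X)) : Prop := {
  vf_K : is_field (field_K M);
  vf_k : is_field (residue_field M);
  vf_G : is_ordered_group (value_group M);
  vf_val_fun : forall (x : M sK) (g h : M sG), val x g -> val x h -> g = h;
  vf_val_dom : forall x : M sK,
    (exists g : M sG, val x g) <-> x <> rzero (field_K M);
  vf_val_surj : forall g : M sG, exists x : M sK, val x g;
  vf_val_mul : forall (x y : M sK) (g h : M sG), val x g -> val y h ->
    val (rmul (field_K M) x y) (gadd (value_group M) g h);
  vf_val_add : forall (x y : M sK) (g h l : M sG), val x g -> val y h ->
    val (radd (field_K M) x y) l ->
    gle (value_group M) g l \/ gle (value_group M) h l;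
  vf_res_fun : forall (x : M sK) (r s : M sk), res x r -> res x s -> r = s;
  vf_res_dom : forall x : M sK,
    (exists r : M sk, res x r) <->
    x = rzero (field_K M) \/
    exists2 g : M sG, val x g & gle (value_group M) (gzero (value_group M)) g;
  vf_res_surj : forall r : M sk, exists x : M sK, res x r;
  vf_res1 : res (rone (field_K M)) (rone (residue_field M));
  vf_res_add : forall (x y : M sK) (r s : M sk), res x r -> res y s ->
    res (radd (field_K M) x y) (radd (residue_field M) r s);
  vf_res_mul : forall (x y : M sK) (r s : M sk), res x r -> res y s ->
    res (rmul (field_K M) x y) (rmul (residue_field M) r s);
  vf_res_ker : forall x : M sK,
    res x (rzero (residue_field M)) <->
    x = rzero (field_K M) \/
    exists g : M sG, [/\ val x g,
      gle (value_group M) (gzero (value_group M)) g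
      & g <> gzero (value_group M)] }.

(* N is R with additional structure in the language Xk. *)
Definition expands_ring (A : Type) (Xk : language unit)
    (N : interp (lsum ring_language Xk) (fun _ : unit => A))
    (R : interp ring_language (fun _ : unit => A)) : Prop :=
  forall (f : ring_fun) (x : tup (fun _ : unit => A) (@fdom _ ring_language f)),
    @fint _ _ _ N (inl f) x = @fint _ _ _ R f x.

Definition expands_ogroup (A : Type) (XG : language unit)
    (N : interp (lsum ogroup_language XG) (fun _ : unit => A))
    (G : interp ogroup_language (fun _ : unit => A)) : Prop :=
  (forall (f : ogroup_fun)
          (x : tup (fun _ : unit => A) (@fdom _ ogroup_language f)),
     @fint _ _ _ N (inl f) x = @fint _ _ _ G f x) /\
  (forall (r : ogroup_rel)
          (x : tup (fun _ : unit => A) (@rdom _ ogroup_language r)),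
     @rint _ _ _ N (inl r) x <-> @rint _ _ _ G r x).

(** * The conditions (SE)_n and (Im)_n *)

Definition SE (kappa : Type) (n : nat) (X : language vf_sort)
    (M : structure (vf_language X)) (Lk LG : language unit)
    (k : interp Lk (fun _ : unit => M sk))
    (G : interp LG (fun _ : unit => M sG)) : Prop :=
  hanced_stably_embedded kappa n k /\ hanced_stably_embedded kappa n G.

Definition is_subfield (A : Type) (F : interp ring_language (fun _ : unit => A))
    (P : A -> Prop) : Prop :=
  [/\ P (rone F),
      forall x y, P x -> P y -> P (radd F x y),
      forall x, P x -> P (ropp F x),
      forall x y, P x -> P y -> P (rmul F x y)
    & forall x y, P x -> rmul F x y = rone F -> P y].

Definition generated_subfield (A : Type)
    (F : interp ring_language (fun _ : unit => A)) (B : A -> Prop) (x : A) :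
    Prop :=
  forall P, is_subfield F P -> (forall y, B y -> P y) -> P x.

Definition compositum (A : Type) (F : interp ring_language (fun _ : unit => A))
    (n : nat) (K : 'I_n -> A -> Prop) : A -> Prop :=
  generated_subfield F (fun y => exists i, K i y).

Definition adjoin (A : Type) (F : interp ring_language (fun _ : unit => A))
    (L : A -> Prop) (b : A) : A -> Prop :=
  generated_subfield F (fun y => L y \/ y = b).

(* The extension F2/F1 of subfields of K(M) is immediate. *)
Definition immediate (X : language vf_sort) (M : structure (vf_language X))
    (F1 F2 : M sK -> Prop) : Prop :=
  [/\ forall x, F1 x -> F2 x,
      forall (x : M sK) (g : M sG), F2 x -> val x g ->
        exists2 y, F1 y & val y g
    & forall (x : M sK) (r : M sk), F2 x -> res x r ->
        exists2 y, F1 y & res y r].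

(* A set of formulas phi(x; a_1, ..., a_n), with x of sort s, each recorded
   as a formula phi(x; y_1, ..., y_n) and a tuple of parameters. *)
Definition ptype (S : Type) (L : language S) (M : structure L) (n : nat)
    (s : S) : Type :=
  forall ys : 'I_n -> ctx S,
    pformula L (ctx1 s) ys -> (forall k, tup M (ys k)) -> Prop.

(* tp(b/K_1, ..., K_n) *)
Definition tp (S : Type) (L : language S) (M : structure L) (n : nat) (s : S)
    (b : M s) (K : 'I_n -> forall s, M s -> Prop) : ptype M n s :=
  fun ys phi a =>
    (forall k (j : 'I_(len (ys k))), K k _ (a k j)) /\ psat phi (tup1 b) a.

Definition realizes (S : Type) (L : language S) (M : structure L) (n : nat)
    (s : S) (b : M s) (p : ptype M n s) : Prop :=
  forall ys (phi : pformula L (ctx1 s) ys) (a : forall k, tup M (ys k)),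
    p ys phi a -> psat phi (tup1 b) a.

(* p |- psi(x; a_1, ..., a_n), in the monster model *)
Definition implies (S : Type) (L : language S) (M : structure L) (n : nat)
    (s : S) (p : ptype M n s) (ys : 'I_n -> ctx S)
    (psi : pformula L (ctx1 s) ys) (a : forall k, tup M (ys k)) : Prop :=
  forall b : M s, realizes b p -> psat psi (tup1 b) a.

Definition Im (kappa : Type) (n : nat) (X : language vf_sort)
    (M : structure (vf_language X)) : Prop :=
  forall (K : 'I_n -> forall s, M s -> Prop) (b : M sK),
    (forall i, small_model kappa (K i)) ->
    (forall i, immediate (K i sK)
       (adjoin (field_K M)
          (compositum (field_K M) (fun i => K i sK)) b)) ->
    exists p : ptype M n sK,
      [/\ forall ys phi a, p ys phi a -> tp b K phi a,
          forall ys (phi : pformula (vf_language X) (ctx1 sK) ys) a,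
            p ys phi a -> formula_NIP M phi
        & forall ys (psi : pformula (vf_language X) (ctx1 sK) ys)
                 (a : forall k, tup M (ys k)),
            (forall k (j : 'I_(len (ys k))), K k _ (a k j)) ->
            (psat psi (tup1 b) a <-> implies p psi a)].

(* Main.v *)
Require Import Defs.
From Stdlib Require Import Ring_theory.
From mathcomp Require Import all_boot.
From mathcomp Require Import boolp.
From mathcomp Require classical_sets.

Set Implicit Arguments.
Unset Strict Implicit.
Unset Printing Implicit Defensive.

(** Let q = n + 1.  A point is a stream of elements of M, one element in every
    sort at each position, and a predicate on q-tuples of points is random
    against another one ([Rand P1 P0]) when every finite q-partite q-uniform
    hypergraph can be realized by points so that P1 holds on the edges and P0
    on the non-edges.  A definable predicate that is random against its own
    negation has IP_n ([Rand_IP]), and conversely every instance of IP_n gives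
    such a predicate; on the other hand a predicate that ignores one of the q
    points is never random against its negation ([Rand_indep]).  So NIP_n
    follows if the dependence on one of the points can be removed while
    randomness is kept, and the only means of doing so is to fix the values of
    definable functions.

    Fixing values rests on a Ramsey theorem.  Hales-Jewett gives a partite
    Ramsey theorem for hypergraphs ([partite_ramsey]), and hence blocks of
    points whose transversals satisfy a given property according to their
    pattern of edges only ([uniform_blocks]).  If adding one edge to the
    pattern can change the property, some predicate of the block is again
    random ([flip]); if it never does, one point of the block can be replaced
    by a constant without changing the value of a given function ([absorb]).
    By induction on the set of points on which a function depends, its value
    can be fixed on a random pair, provided that no predicate of the value
    which ignores one of these points is random against its negation
    ([fixable_step]).  If functions that ignore one of the q points can be
    fixed, the value of any function can be fixed on the edges ([fix_edges]).

    For a stably embedded sort s this proviso is what NIP_n of the sort gives.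
    On a countable array that realizes all finite patterns, (SE)_n turns a
    predicate of one element of s and of the n other points into a formula of
    the structure on s, so that randomness would be IP_n there
    ([coord_free_embedded]).  The same argument fixes every function into s that
    ignores one of the points ([fixables_embedded]).

    For the field sort, suppose that phi(b; a_1, ..., a_n) with b in K is
    random against its negation.  Henkin witnesses over each a_i, and constants
    for all elements of k and Gamma definable over b and the witnesses, are
    added while phi stays random; the constants exist by [fix_edges].
    Compactness gives b and small models K_1, ..., K_n such that
    phi(b; a_1, ..., a_n) holds, such that L(b)/K_i is immediate, L being the
    compositum of the K_i ([Kpart_immediate]), and such that no finite set of
    NIP_n formulas over the K_i true of b implies phi: in the opposite case
    one of these formulas would be random against its negation
    ([no_witness]).  By (Im)_n some set of NIP_n formulas true of b does imply
    phi, and by compactness a finite part of it suffices ([coord_free_K]).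

    Thus elements of all three sorts can be fixed one at a time; fixing all
    the coordinates of one point on which a formula depends shows that the
    formula is NIP_n ([NIP_of_coord_free]).  The converse translates formulas
    of a definable structure on a sort into formulas of M ([NIP_sort]). *)

(** * The Hales-Jewett theorem *)

Section HalesJewett.

Variable A : finType.

(** [t] is a word with holes: the holes are the positions sent to [None], and
    the points of the line fill them all with the same letter. *)
Definition line (N : finType) (t : N -> option A) (a : A) : {ffun N -> A} :=
  [ffun i => odflt a (t i)].

Definition hj_on (s : seq A) : Prop :=
  forall K : finType, exists N : finType, forall C : {ffun N -> A} -> K,
    exists t : N -> option A, (exists i, t i = None) /\
      {in s &, forall a b, C (line t a) = C (line t b)}.

(** Colour focusing: lines of different colours on the letters of [s], all
    meeting in the same point [f] when their holes are filled with [z]. *)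
Definition focused (s : seq A) (z : A) (K N : finType)
    (C : {ffun N -> A} -> K) (f : {ffun N -> A})
    (L : seq ((N -> option A) * K)) : Prop :=
  uniq [seq p.2 | p <- L] /\
  forall p, List.In p L ->
    [/\ exists i, p.1 i = None, line p.1 z = f
      & {in s, forall a, C (line p.1 a) = p.2}].

Definition join (N N' : finType) (v : {ffun N -> A}) (v' : {ffun N' -> A}) :
  {ffun N + N' -> A} :=
  [ffun i => match i with inl i => v i | inr i => v' i end].

Definition tjoin (N N' : finType) (v : N -> option A) (v' : N' -> option A) :
  N + N' -> option A :=
  fun i => match i with inl i => v i | inr i => v' i end.

Lemma line_tjoin (N N' : finType) (t : N -> option A) (t' : N' -> option A) a :
  line (tjoin t t') a = join (line t a) (line t' a).
Proof. by apply/ffunP => -[i|i]; rewrite !ffunE. Qed.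

Lemma line_const (N : finType) (v : {ffun N -> A}) a :
  line (fun i => Some (v i)) a = v.
Proof. by apply/ffunP => i; rewrite !ffunE. Qed.

Lemma In_map_ex (T U : Type) (f : T -> U) (l : seq T) (y : U) :
  List.In y (map f l) -> exists2 x, List.In x l & f x = y.
Proof.
by elim: l => //= x l IH [<-|/IH [x' x'l <-]]; [exists x; [left|] | exists x'; [right|]].
Qed.

(** Induction on the number of focused lines.  The theorem for [s], applied to
    colourings of a whole cube, makes the colour of one more block of
    positions independent of the letters of [s] in it; extending the old lines
    along that block and adding one line that moves in that block only gives
    one more focused line, unless its colour has already occurred. *)
Lemma hj_focus (s : seq A) (z x0 : A) : x0 \in s -> hj_on s ->
  forall (K : finType) (r : nat), exists N : finType,
    forall C : {ffun N -> A} -> K,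
      (exists f L, focused s z C f L /\ size L = r) \/
      exists t : N -> option A, (exists i, t i = None) /\
        {in z :: s &, forall a b, C (line t a) = C (line t b)}.
Proof.
move=> x0s hs K; elim=> [|r [N HN]].
  exists 'I_0 => C; left.
  by exists [ffun=> z], [::].
have [N' HN'] := hs {ffun {ffun N -> A} -> K}.
exists (N + N')%type => C.
have [t' [[i' i'N] Ht']] := HN' (fun v' => [ffun v => C (join v v')]).
have {}Ht' v a b : a \in s -> b \in s ->
    C (join v (line t' a)) = C (join v (line t' b)).
  by move=> sa sb; move/ffunP/(_ v): (Ht' a b sa sb); rewrite !ffunE.
pose C0 v := C (join v (line t' x0)).
case: (HN C0) => [[f [L [[uL HL] sL]]]|[t [[i iN] Ht]]]; last first.
  right; exists (tjoin t (fun i => Some (line t' x0 i))).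
  split; first by exists (inl i).
  move=> a b az bz; rewrite !line_tjoin !line_const; exact: Ht.
have [|colour] := boolP (C0 f \in [seq p.2 | p <- L]).
  have sub p : p \in [seq p.2 | p <- L] -> exists t, List.In (t, p) L.
    elim: L {uL HL sL} => //= -[t c] L IH; rewrite inE => /orP [/eqP -> | /IH [u uL]].
      by exists t; left.
    by exists u; right.
  case/sub => t /HL [/= [i iN] tf tC].
  right; exists (tjoin t (fun i => Some (line t' x0 i))).
  split; first by exists (inl i).
  have tc a : a \in z :: s -> C0 (line t a) = C0 f.
    by rewrite inE => /orP [/eqP -> | /tC //]; rewrite tf.
  move=> a b az bz; rewrite !line_tjoin !line_const.
  by rewrite -![C (join _ _)]/(C0 _) !tc.
left; exists (join f (line t' z)).
exists ((tjoin (fun i => Some (f i)) t', C0 f) ::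
        [seq (tjoin p.1 t', p.2) | p <- L]).
split; last by rewrite /= size_map sL.
split.
  by rewrite /= -map_comp (eq_map (g := snd)) // colour.
move=> p /= [<-|/(@In_map_ex _ _ _ _ _) [u /HL [[i iN] uf uC] <-]] /=.
  split; first by exists (inr i').
    by rewrite line_tjoin line_const.
  by move=> a sa; rewrite line_tjoin line_const; apply: Ht'.
split; first by exists (inl i).
  by rewrite line_tjoin uf.
move=> a sa; rewrite line_tjoin -(uC a sa); exact: Ht'.
Qed.

Theorem hales_jewett (K : finType) : exists N : finType,
  forall C : {ffun N -> A} -> K,
    exists t : N -> option A, (exists i, t i = None) /\
      forall a b, C (line t a) = C (line t b).
Proof.
suff: forall s, hj_on s.
  move=> /(_ (enum A) K) [N HN]; exists N => C.
  have [t [tN tC]] := HN C; exists t; split=> // a b.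
  by apply: tC; rewrite mem_enum.
elim=> [|z s IH] {}K.
  exists unit => C; exists (fun=> None); split=> //; by exists tt.
case: s IH => [|x0 s] IH.
  exists unit => C; exists (fun=> None); split; first by exists tt.
  by move=> a b; rewrite !inE => /eqP -> /eqP ->.
have [N HN] := hj_focus z (mem_head x0 s) IH K #|K|.+1.
exists N => C; case: (HN C) => // -[f [L [[uL _] sL]]].
(* more colours than there are in K *)
move: (max_card (mem [seq p.2 | p <- L])).
by rewrite (card_uniqP uL) size_map sL ltnn.
Qed.

End HalesJewett.

(** * A partite Ramsey theorem *)

Section PartiteRamsey.

Variables (q : nat) (E : finType).

Notation edge W := {ffun 'I_q -> E * W}.
Notation transversal W := {ffun 'I_q * E -> W}.
Notation pattern := {ffun {ffun 'I_q -> E} -> bool}.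

(** The vertices of class [l] are the pairs in E * W; a transversal [w] picks a
    copy in W for each class and each element of E, and thus one vertex in each
    of the q * E blocks.  Its pattern is the hypergraph that it spans. *)
Definition tedge (W : finType) (w : transversal W) (i : {ffun 'I_q -> E}) :
  edge W := [ffun l => (i l, w (l, i l))].

Definition pat (W : finType) (R : edge W -> bool) (w : transversal W) :
  pattern := [ffun i => R (tedge w i)].

Definition emap (W W' : finType) (h : 'I_q -> E -> W -> W') (v : edge W) :
  edge W' := [ffun l => ((v l).1, h l (v l).1 (v l).2)].

Definition tmap (W W' : finType) (h : 'I_q -> E -> W -> W')
    (w : transversal W) : transversal W' := [ffun p => h p.1 p.2 (w p)].

Lemma emap_tedge (W W' : finType) (h : 'I_q -> E -> W -> W')
    (w : transversal W) i : emap h (tedge w i) = tedge (tmap h w) i.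
Proof. by apply/ffunP => l; rewrite !ffunE /=. Qed.

Lemma pat_tmap (W W' : finType) (h : 'I_q -> E -> W -> W')
    (R : edge W -> bool) (R' : edge W' -> bool) :
  (forall v, R' (emap h v) = R v) -> forall w, pat R' (tmap h w) = pat R w.
Proof.
by move=> hR w; apply/ffunP => i; rewrite !ffunE -emap_tedge hR.
Qed.

(** In [R'] there is a copy of [R] on which the colour of a transversal depends
    only on its pattern, for the patterns selected by [r]. *)
Definition arrows (K : finType) (r : pattern -> bool) (W W' : finType)
    (R : edge W -> bool) (R' : edge W' -> bool) : Prop :=
  forall C : transversal W' -> K, exists h : 'I_q -> E -> W -> W',
    (forall v, R' (emap h v) = R v) /\
    forall w1 w2, pat R w1 = pat R w2 -> r (pat R w1) ->
      C (tmap h w1) = C (tmap h w2).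

(** The alphabet of Hales-Jewett is the set of transversals with pattern [r].
    In the power of W the edges over a cell of [r] are those tuples that are edges
    at all positions, or at some position, according to whether the cell is in [r]
    or not: letters of the alphabet are then neutral, so that the holes of a
    line carry a copy of [R]. *)
Lemma partite_one (K W : finType) (R : edge W -> bool) (r : pattern) :
  exists (W' : finType) (R' : edge W' -> bool), arrows K (pred1 r) R R'.
Proof.
pose A := {w : transversal W | pat R w == r}.
have [N HN] := hales_jewett A K.
pose coord (v : edge {ffun N -> W}) (m : N) : edge W :=
  [ffun l => ((v l).1, (v l).2 m)].
exists {ffun N -> W}.
exists (fun v : edge {ffun N -> W} => if r [ffun l => (v l).1]
  then [forall m, R (coord v m)] else [exists m, R (coord v m)]) => C.
pose D (u : {ffun N -> A}) : K :=
  C [ffun p => [ffun m => val (u m) p]].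
have [t [[m0 m0N] tD]] := HN D.
pose h (l : 'I_q) (e : E) (w : W) : {ffun N -> W} :=
  [ffun m => if t m is Some a then val a (l, e) else w].
have coordh v m : coord (emap h v) m =
    if t m is Some a then tedge (val a) [ffun l => (v l).1] else v.
  case tm: (t m) => [a|].
    by apply/ffunP => l; rewrite !ffunE /= ?ffunE tm.
  by apply/ffunP => l; rewrite !ffunE /= ?ffunE tm -surjective_pairing.
exists h; split=> [v|w1 w2 w12 /= /eqP w1r].
  have -> : [ffun l => (emap h v l).1] = [ffun l => (v l).1].
    by apply/ffunP => l; rewrite !ffunE.
  set e := [ffun l => (v l).1].
  have Rt (a : A) : R (tedge (val a) e) = r e.
    by have /eqP/ffunP/(_ e) := valP a; rewrite ffunE.
  case: ifP => re.
    apply/forallP/idP => [/(_ m0)|Rv m]; rewrite coordh; first by rewrite m0N.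
    by case: (t m) => [a|] //; rewrite Rt.
  apply/existsP/idP => [[m]|Rv]; last by exists m0; rewrite coordh m0N.
  by rewrite coordh; case: (t m) => [a|] //; rewrite Rt re.
have Ch w (wr : pat R w == r) :
    C (tmap h w) = D (line t (Sub w wr : A)).
  congr C; apply/ffunP => p; rewrite !ffunE; apply/ffunP => m.
  by rewrite !ffunE; case: (t m) => //=; case: p.
have w1r' : pat R w1 == r by rewrite w1r.
have w2r' : pat R w2 == r by rewrite -w12 w1r.
by rewrite (Ch _ w1r') (Ch _ w2r'); apply: tD.
Qed.

(** The patterns are treated one after the other. *)
Theorem partite_ramsey (K W : finType) (R : edge W -> bool) :
  exists (W' : finType) (R' : edge W' -> bool), arrows K xpredT R R'.
Proof.
suff [W' [R' HR']] : exists (W' : finType) (R' : edge W' -> bool),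
    arrows K (mem (enum {: pattern})) R R'.
  exists W', R' => C; have [h [hR hC]] := HR' C.
  exists h; split=> // w1 w2 w12 _; apply: hC => //; exact: mem_enum.
elim: (enum _) W R => [|r s IH] W R.
  exists W, R => C; exists (fun _ _ w => w); split=> // v.
  by congr R; apply/ffunP => l; rewrite !ffunE -surjective_pairing.
have [W1 [R1 H1]] := partite_one K R r.
have [W2 [R2 H2]] := IH W1 R1.
exists W2, R2 => C; have [h2 [h2R h2C]] := H2 C.
have [h1 [h1R h1C]] := H1 (fun w => C (tmap h2 w)).
have hh w : tmap (fun l e => h2 l e \o h1 l e) w = tmap h2 (tmap h1 w).
  by apply/ffunP => p; rewrite !ffunE.
exists (fun l e => h2 l e \o h1 l e); split=> [v|w1 w2 w12].
  rewrite -h1R -h2R; congr R2; apply/ffunP => l; by rewrite !ffunE.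
rewrite inE !hh => /orP [rw|sw]; first exact: h1C.
by apply: h2C; rewrite !(pat_tmap h1R).
Qed.

End PartiteRamsey.

(** * Formulas and definable predicates *)

Section Definability.

Variables (S : Type) (L : language S) (M : structure L).

Lemma sat_ext (V : Type) (sv : V -> S) (e e' : forall v, M (sv v))
    (phi : formula L sv) : (forall v, e v = e' v) -> sat e phi <-> sat e' phi.
Proof. by move=> ee'; have -> : e = e' by apply: functional_extensionality_dep. Qed.

Fixpoint tren (V V' : Type) (sv : V -> S) (sv' : V' -> S) (f : V -> V')
    (pf : forall v, sv' (f v) = sv v) (s : S) (t : term L sv s) :
    term L sv' s :=
  match t in term _ _ s return term L sv' s with
  | Var v => eq_rect _ (term L sv') (Var L sv' (f v)) _ (pf v)
  | App g ts => App (fun i => tren pf (ts i))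
  end.

Lemma osrt_omap (V V' : Type) (sv : V -> S) (sv' : V' -> S) (f : V -> V')
    (pf : forall v, sv' (f v) = sv v) (s : S) (v : option V) :
  osrt s sv' (omap f v) = osrt s sv v.
Proof. by case: v => [v|] //=. Defined.

Fixpoint fren (V V' : Type) (sv : V -> S) (sv' : V' -> S) (f : V -> V')
    (pf : forall v, sv' (f v) = sv v) (phi : formula L sv) : formula L sv' :=
  match phi with
  | FEq _ t u => FEq (tren pf t) (tren pf u)
  | FRel r ts => FRel (fun i => tren pf (ts i))
  | FNot phi => FNot (fren pf phi)
  | FAnd phi psi => FAnd (fren pf phi) (fren pf psi)
  | FEx s phi => FEx (fren (f := omap f) (osrt_omap pf s) phi)
  end.

Definition envr (V V' : Type) (sv : V -> S) (sv' : V' -> S) (f : V -> V')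
    (pf : forall v, sv' (f v) = sv v) (e' : forall v, M (sv' v)) :
    forall v, M (sv v) :=
  fun v => eq_rect _ M (e' (f v)) _ (pf v).

Lemma eval_tren (V V' : Type) (sv : V -> S) (sv' : V' -> S) (f : V -> V')
    (pf : forall v, sv' (f v) = sv v) (e' : forall v, M (sv' v)) (s : S)
    (t : term L sv s) : eval e' (tren pf t) = eval (envr pf e') t.
Proof.
elim: t => [v|g ts IH] /=; first by rewrite /envr; case: _ / (pf v).
by congr (fint _); apply: functional_extensionality_dep => i; apply: IH.
Qed.

Lemma envr_oenv (V V' : Type) (sv : V -> S) (sv' : V' -> S) (f : V -> V')
    (pf : forall v, sv' (f v) = sv v) (e' : forall v, M (sv' v)) (s : S)
    (x : M s) :
  envr (f := omap f) (osrt_omap pf s) (oenv x e') = oenv x (envr pf e').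
Proof. by apply: functional_extensionality_dep => -[v|]. Qed.

Lemma sat_fren (V V' : Type) (sv : V -> S) (phi : formula L sv) :
  forall (sv' : V' -> S) (f : V -> V') (pf : forall v, sv' (f v) = sv v)
    (e' : forall v, M (sv' v)),
  sat e' (fren pf phi) <-> sat (envr pf e') phi.
Proof.
elim: phi V' => {V sv} [V sv s t u|V sv r ts|V sv phi IH|V sv phi IH psi IH'|V sv s phi IH]
  V' sv' f pf e' /=.
- by rewrite !eval_tren.
- rewrite (_ : (fun i => eval e' (tren pf (ts i))) =
               (fun i => eval (envr pf e') (ts i))) //.
  by apply: functional_extensionality_dep => i; apply: eval_tren.
- by rewrite IH.
- by rewrite IH IH'.
- by split=> -[x]; rewrite ?IH => H; exists x; move: H; rewrite ?IH envr_oenv.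
Qed.

Fixpoint tvars (V : Type) (sv : V -> S) (s : S) (t : term L sv s) : seq V :=
  match t with
  | Var v => [:: v]
  | App g ts => flatten [seq tvars (ts i) | i <- enum 'I_(len (fdom g))]
  end.

Fixpoint fvars (V : Type) (sv : V -> S) (phi : formula L sv) : seq V :=
  match phi with
  | FEq _ t u => tvars t ++ tvars u
  | FRel r ts => flatten [seq tvars (ts i) | i <- enum 'I_(len (rdom r))]
  | FNot phi => fvars phi
  | FAnd phi psi => fvars phi ++ fvars psi
  | FEx s phi => pmap id (fvars phi)
  end.

Lemma In_cat (T : Type) (l l' : seq T) x :
  List.In x (l ++ l') <-> List.In x l \/ List.In x l'.
Proof. exact: List.in_app_iff. Qed.

Lemma In_flatten (T : Type) (I : eqType) (f : I -> seq T) (l : seq I) i x :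
  i \in l -> List.In x (f i) -> List.In x (flatten [seq f i | i <- l]).
Proof.
elim: l => //= j l IH; rewrite inE In_cat => /orP [/eqP <-|il] xi; first by left.
by right; apply: IH.
Qed.

Lemma In_pmap (T : Type) (l : seq (option T)) x :
  List.In (Some x) l -> List.In x (pmap id l).
Proof.
by elim: l => //= -[y|] l IH /= []; [case=> ->; left | move/IH; right | | ].
Qed.

Lemma eval_supp (V : Type) (sv : V -> S) (e e' : forall v, M (sv v)) (s : S)
    (t : term L sv s) :
  (forall v, List.In v (tvars t) -> e v = e' v) -> eval e t = eval e' t.
Proof.
elim: t => [v|g ts IH] /= H; first by apply: H; left.
congr (fint _); apply: functional_extensionality_dep => i; apply: IH => v vi.
apply: H; exact: In_flatten (mem_enum _ i) vi.
Qed.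

Lemma sat_supp (V : Type) (sv : V -> S) (phi : formula L sv) :
  forall (e e' : forall v, M (sv v)),
  (forall v, List.In v (fvars phi) -> e v = e' v) -> sat e phi <-> sat e' phi.
Proof.
elim: phi => {V sv} [V sv s t u|V sv r ts|V sv phi IH|V sv phi IH psi IH'|V sv s phi IH]
  e e' /= H.
- have -> : eval e t = eval e' t.
    by apply: eval_supp => v vt; apply: H; apply In_cat; left.
  suff -> : eval e u = eval e' u by [].
  by apply: eval_supp => v vt; apply: H; apply In_cat; right.
- rewrite (_ : (fun i => eval e (ts i)) = (fun i => eval e' (ts i))) //.
  apply: functional_extensionality_dep => i; apply: eval_supp => v vi.
  apply: H; exact: In_flatten (mem_enum _ i) vi.
- by rewrite (IH e e' H).
- have -> : sat e phi <-> sat e' phi.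
    by apply: IH => v vt; apply: H; apply In_cat; left.
  suff -> : sat e psi <-> sat e' psi by [].
  by apply: IH' => v vt; apply: H; apply In_cat; right.
- have Hx (x : M s) v : List.In v (fvars phi) -> oenv x e v = oenv x e' v.
    by case: v => [v|] //= vphi; apply: H; apply: In_pmap.
  by split=> -[x xphi]; exists x; move: xphi; apply IH => v vphi; rewrite Hx.
Qed.

(** Quantifies over the variables in [l], which stay variables of the formula. *)
Lemma ex_vars (V : Type) (sv : V -> S) (phi : formula L sv) (l : seq V) :
  exists phi' : formula L sv, forall e : forall v, M (sv v),
    sat e phi' <-> exists2 e' : forall v, M (sv v),
      (forall v, e' v = e v \/ List.In v l) & sat e' phi.
Proof.
elim: l => [|u l [phi1 H1]] /=.
  exists phi => e; split=> [?|[e' ee']]; first by exists e => // v; left.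
  by apply sat_ext => v; case: (ee' v).
pose f v := if pselect (v = u) then None else Some v.
have pf v : osrt (sv u) sv (f v) = sv v.
  by rewrite /f; case: pselect => [vu|] //; rewrite /= vu.
exists (FEx (fren pf phi1)) => e /=; split.
  move=> [x]; rewrite sat_fren H1 => -[e' e'e e'phi]; exists e' => // v.
  have [->|vu] := pselect (v = u); first by right; left.
  case: (e'e v) => [->|]; last by right; right.
  left; rewrite /envr; move: (pf v); rewrite /f; case: pselect => // _ /= p.
  by rewrite (Prop_irrelevance p erefl).
move=> [e' e'e e'phi]; exists (e' u); rewrite sat_fren H1; exists e' => // v.
have [vu|vu] := pselect (v = u).
  left; rewrite /envr; move: (pf v); rewrite /f; case: pselect => // _ /=.
  by rewrite vu => p; rewrite (Prop_irrelevance p erefl).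
case: (e'e v) => [->|[/esym//|]]; last by right.
left; rewrite /envr; move: (pf v); rewrite /f; case: pselect => // _ /= p.
by rewrite (Prop_irrelevance p erefl).
Qed.

(** Points with an element in every sort: with them a family of elements can be
    indexed by an arbitrary type without choosing a sort for every index. *)
Definition Y : Type := forall s, M s.

Definition sumf (A B : Type) (g : A -> Y) (h : B -> Y) (v : A + B) : Y :=
  match v with inl a => g a | inr b => h b end.
Definition optf (A : Type) (g : A -> Y) (d : Y) (v : option A) : Y :=
  if v is Some a then g a else d.

Definition ysat (V : Type) (g : V -> Y) (phi : formula L (fun v : V * S => v.2)) : Prop :=
  sat (fun v => g v.1 v.2) phi.

(** [P] is defined by a formula with parameters [b].  The variables are the pairs
    of an index and a sort; the index [None] carries no information and provides
    a variable when V and B are empty. *)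
Definition dfn (B : Type) (b : B -> Y) (V : Type) (P : (V -> Y) -> Prop) :=
  exists phi : formula L (fun v : option (V + B) * S => v.2),
    forall g d, P g <-> ysat (optf (sumf g b) d) phi.

Section Closure.
Variables (B : Type) (b : B -> Y).
Local Notation dfnb := (dfn b).

Lemma dfn_iff (V : Type) (P Q : (V -> Y) -> Prop) :
  (forall g, P g <-> Q g) -> dfnb P -> dfnb Q.
Proof. by move=> PQ [phi Hphi]; exists phi => g d; rewrite -PQ. Qed.

Lemma dfn_not (V : Type) (P : (V -> Y) -> Prop) :
  dfnb P -> dfnb (fun g => ~ P g).
Proof. by move=> [phi Hphi]; exists (FNot phi) => g d; rewrite (Hphi g d). Qed.

Lemma dfn_and (V : Type) (P Q : (V -> Y) -> Prop) :
  dfnb P -> dfnb Q -> dfnb (fun g => P g /\ Q g).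
Proof.
move=> [phi Hphi] [psi Hpsi]; exists (FAnd phi psi) => g d.
by rewrite (Hphi g d) (Hpsi g d).
Qed.

Lemma dfn_or (V : Type) (P Q : (V -> Y) -> Prop) :
  dfnb P -> dfnb Q -> dfnb (fun g => P g \/ Q g).
Proof.
move=> dP dQ; apply: (dfn_iff (P := fun g => ~ (~ P g /\ ~ Q g))).
  by move=> g; rewrite not_andP !not_notP.
by apply: dfn_not; apply: dfn_and; apply: dfn_not.
Qed.

Lemma dfn_imp (V : Type) (P Q : (V -> Y) -> Prop) :
  dfnb P -> dfnb Q -> dfnb (fun g => P g -> Q g).
Proof.
move=> dP dQ; apply: (dfn_iff (P := fun g => ~ P g \/ Q g)).
  by move=> g; rewrite implyE.
by apply: dfn_or => //; apply: dfn_not.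
Qed.

Lemma dfn_sat (V U : Type) (sv : U -> S) (phi : formula L sv) (rho : U -> V + B) :
  dfnb (fun g : V -> Y => sat (fun u => sumf g b (rho u) (sv u)) phi).
Proof.
pose f u := (Some (rho u), sv u).
by exists (fren (f := f) (sv' := fun v : option (V + B) * S => v.2) (fun=> erefl) phi) => g d;
  rewrite /ysat sat_fren.
Qed.

Lemma dfn_ren (V V' : Type) (P : (V -> Y) -> Prop) (rho : V -> V') :
  dfnb P -> dfnb (fun g => P (fun v => g (rho v))).
Proof.
move=> [phi Hphi].
pose f (v : option (V + B) * S) : option (V' + B) * S :=
  (omap (fun w => match w with inl a => inl (rho a) | inr b => inr b end) v.1, v.2).
exists (fren (f := f) (sv' := fun v : option (V' + B) * S => v.2) (fun=> erefl) phi) => g d.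
rewrite (Hphi _ d) /ysat sat_fren; apply sat_ext.
by case=> -[[a|c]|] s.
Qed.

Lemma dfn_sub (V V' : Type) (P : (V -> Y) -> Prop) (rho : V -> V' + B) :
  dfnb P -> dfnb (fun g => P (fun v => sumf g b (rho v))).
Proof.
move=> [phi Hphi].
pose f (v : option (V + B) * S) : option (V' + B) * S :=
  (omap (fun w => match w with inl a => rho a | inr b => inr b end) v.1, v.2).
exists (fren (f := f) (sv' := fun v : option (V' + B) * S => v.2) (fun=> erefl) phi) => g d.
rewrite (Hphi _ d) /ysat sat_fren; apply sat_ext.
by case=> -[[a|c]|] s.
Qed.

Lemma dfn_ex (V W : Type) (P : (V + W -> Y) -> Prop) :
  dfnb P -> dfnb (fun g : V -> Y => exists h : W -> Y, P (sumf g h)).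
Proof.
move=> [phi Hphi].
pose isW (u : option (V + W + B) * S) := if u.1 is Some (inl (inr _)) then true else false.
pose l := List.filter isW (fvars phi).
have [phi' Hphi'] := ex_vars phi l.
pose f (u : option (V + W + B) * S) : option (V + B) * S :=
  (match u.1 with
   | Some (inl (inl v)) => Some (inl v)
   | Some (inl (inr _)) => None
   | Some (inr c) => Some (inr c)
   | None => None end, u.2).
exists (fren (f := f) (sv' := fun v : option (V + B) * S => v.2) (fun=> erefl) phi') => g d.
rewrite /ysat sat_fren Hphi'.
set e0 := envr _ _.
split=> [[h /(Hphi _ d) Ph]|[e' e'e e'phi]].
  pose e1 (u : option (V + W + B) * S) : M u.2 := optf (sumf (sumf g h) b) d u.1 u.2.
  exists (fun u => if pselect (List.In u l) then e1 u else e0 u).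
    by move=> u; case: pselect => ?; [right|left].
  move: Ph; rewrite /ysat; apply sat_supp => u uphi; case: pselect => // ul.
  move: uphi ul; case: u => [[[[v|w]|c]|] s] //= uphi []; apply/List.filter_In.
  by split.
exists (fun w s => e' (Some (inl (inr w)), s)).
apply/(Hphi _ d); rewrite /ysat; move: e'phi; apply sat_ext.
move=> u; case: (e'e u) => [|/List.filter_In []]; case: u => [[[[v|w]|c]|] s] //=.
Qed.

End Closure.

End Definability.

(** * Comparability and squares of infinite types *)

Lemma ex_choice (X Z : Type) (P : X -> Z -> Prop) :
  (forall x, exists z, P x z) -> exists f : X -> Z, forall x, P x (f x).
Proof. by move=> /choice [f Hf]; exists f. Qed.

Section Comparability.

Import classical_sets.
Local Open Scope classical_set_scope.

Variables (T : Type) (A B : set T).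

(** Graphs of partial injections from A to B. *)
Definition pinj (H : set (T * T)) : Prop :=
  (forall x y, H (x, y) -> A x /\ B y) /\
  forall x y x' y', H (x, y) -> H (x', y') -> x = x' <-> y = y'.

(** A maximal partial injection, given by Zorn's lemma, is total on A or onto B. *)
Lemma comparable_sets :
  (exists f : T -> T, (forall x, A x -> B (f x)) /\
     forall x y, A x -> A y -> f x = f y -> x = y) \/
  (exists f : T -> T, (forall x, B x -> A (f x)) /\
     forall x y, B x -> B y -> f x = f y -> x = y).
Proof.
have [F Fp Ftot|H [[HAB Hinj] Hmax]] := @Zorn_bigcup (T * T) pinj.
  split=> [x y [X FX] /(proj1 (Fp _ FX))//|x y x' y' [X FX Xxy] [X' FX' Xxy']].
  have [XX'|X'X] := Ftot _ _ FX FX'.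
    exact: (proj2 (Fp _ FX')) (XX' _ Xxy) Xxy'.
  exact: (proj2 (Fp _ FX)) Xxy (X'X _ Xxy').
have [Atot|] := EM (forall x, A x -> exists y, H (x, y)).
  left; have [f Hf] : exists f : T -> T, forall x, A x -> H (x, f x).
    apply: (@ex_choice _ _ (fun x y => A x -> H (x, y))) => x.
    have [/Atot [y ?]|?] := EM (A x); first by exists y.
    by exists x.
  exists f; split=> [x /Hf /HAB []//|x y /Hf Hx /Hf Hy].
  by move=> fxy; apply (Hinj _ _ _ _ Hx Hy).
move=> /existsNP [x0 /not_implyP [Ax0 /forallNP Hx0]].
have [Btot|] := EM (forall y, B y -> exists x, H (x, y)).
  right; have [f Hf] : exists f : T -> T, forall y, B y -> H (f y, y).
    apply: (@ex_choice _ _ (fun y x => B y -> H (x, y))) => y.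
    have [/Btot [x ?]|?] := EM (B y); first by exists x.
    by exists y.
  exists f; split=> [x /Hf /HAB []//|x y /Hf Hx /Hf Hy].
  by move=> fxy; apply (Hinj _ _ _ _ Hx Hy).
move=> /existsNP [y0 /not_implyP [By0 /forallNP Hy0]].
exfalso; apply: (Hmax (H `|` [set (x0, y0)])).
  split; first by move=> p Hp; left.
  by move/(_ (x0, y0) (or_intror erefl)); apply: Hx0.
split=> [x y [/HAB//|[-> ->]//]|x y x' y'].
move=> [Hxy|[-> ->]] [Hxy'|[-> ->]] //; first exact: Hinj.
  by split=> [xx|yy]; [move: Hxy; rewrite xx => /Hx0|move: Hxy; rewrite yy => /Hy0].
by split=> [xx|yy]; [move: Hxy'; rewrite -xx => /Hx0|move: Hxy'; rewrite -yy => /Hy0].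
Qed.

End Comparability.

Section Hessenberg.

Import classical_sets.
Local Open Scope classical_set_scope.

Variables (T : Type) (iota : nat -> T).
Hypothesis iota_inj : injective iota.

Definition sqdom (F : set (T * T * T)) : set T := [set a | exists z, F (a, a, z)].

(** Graphs of injections A * A -> A, for A the domain [sqdom F] of the diagonal. *)
Definition sqinj (F : set (T * T * T)) : Prop :=
  [/\ forall a b, sqdom F a -> sqdom F b -> exists z, F (a, b, z),
      forall a b z, F (a, b, z) -> [/\ sqdom F a, sqdom F b & sqdom F z]
    & forall p z p' z', F (p, z) -> F (p', z') -> p = p' <-> z = z'].

Let F0 : set (T * T * T) :=
  [set p | exists i j, p = (iota i, iota j, iota (pickle (i, j)))].

Lemma sqdom_sub (F G : set (T * T * T)) : F `<=` G -> sqdom F `<=` sqdom G.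
Proof. by move=> FG a [z /FG Gz]; exists z. Qed.

Let sqinj0 : sqinj F0.
Proof.
have dom i : sqdom F0 (iota i) by exists (iota (pickle (i, i))), i, i.
split=> [a b [z [i [j [-> _ _]]]] [z' [i' [j' [-> _ _]]]]|a b z [i [j [-> -> ->]]]|].
- by exists (iota (pickle (i, i'))), i, i'.
- by split.
move=> p z p' z' [i [j [-> ->]]] [i' [j' [-> ->]]].
split=> [[/iota_inj -> /iota_inj ->]//|/iota_inj /(pcan_inj pickleK) [-> ->]//].
Qed.

Lemma sqinj_bigcup (C : set (set (T * T * T))) (G0 : set (T * T * T)) :
  C G0 -> C `<=` sqinj -> total_on C subset -> sqinj (\bigcup_(F in C) F).
Proof.
move=> CG0 Cs Ctot.
have up F : C F -> F `<=` \bigcup_(F in C) F by move=> CF p Fp; exists F.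
have pr F G p p' : C F -> C G -> F p -> G p' -> exists2 H, C H & H p /\ H p'.
  move=> CF CG Fp Gp'; have [FG|GF] := Ctot _ _ CF CG.
    by exists G => //; split=> //; apply: FG.
  by exists F => //; split=> //; apply: GF.
split=> [a b [z [F CF Fz]] [z' [G CG Gz']]|a b z [F CF Fz]|p z p' z' [F CF Fz] [G CG Gz']].
- have [H CH [Hz Hz']] := pr _ _ _ _ CF CG Fz Gz'.
  have [sq _ _] := Cs _ CH.
  have [w Hw] : exists w, H (a, b, w) by apply: sq; [exists z | exists z'].
  by exists w, H.
- have [_ /(_ _ _ _ Fz) [? ? ?] _] := Cs _ CF.
  by split; apply: (sqdom_sub (up _ CF)).
- have [H CH [Hz Hz']] := pr _ _ _ _ CF CG Fz Gz'.
  have [_ _ inj] := Cs _ CH; exact: inj Hz Hz'.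
Qed.

(** Hessenberg's theorem, by Zorn's lemma: let F be maximal among the injections
    A * A -> A that extend the one on [iota].  If the complement of A injects
    into A, then so does the whole type, and F gives the injection.  Otherwise
    the complement contains a copy B of A, and F extends to A + B, because
    the three new rectangles inject into B; this contradicts maximality. *)
Theorem square_injects : exists f : T * T -> T, injective f.
Proof.
have [C CP Ctot|F1] := @Zorn_bigcup _ (fun F => sqinj (F0 `|` F)).
  have -> : F0 `|` \bigcup_(F in C) F =
      \bigcup_(F in [set F0] `|` [set F0 `|` F | F in C]) F.
    apply/seteqP; split=> p.
      case=> [F0p|[F CF Fp]]; first by exists F0 => //; left.
      by exists (F0 `|` F); [right; exists F | right].
    case=> F [-> F0p|[G CG <-]]; first by left.
    by case=> [?|Gp]; [left | right; exists G].
  apply: (sqinj_bigcup (G0 := F0)); first by left.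
    by move=> F [->|[G CG <-]]; [exact: sqinj0 | exact: CP].
  move=> F G [->|[F' CF' <-]] [->|[G' CG' <-]].
  - by left.
  - by left=> p; left.
  - by right=> p; left.
  - by have [FG|GF] := Ctot _ _ CF' CG'; [left|right];
      move=> p [|Fp]; [left|right; apply: FG|left|right; apply: GF].
set F := F0 `|` F1; move=> [[sq dom inj] Fmax].
pose A := sqdom F.
have Aiota i : A (iota i) by exists (iota (pickle (i, i))); left; exists i, i.
have [f Hf] : exists f : T -> T -> T, forall a b, A a -> A b -> F (a, b, f a b).
  suff /ex_choice [f Hf] : forall p, exists z, A p.1 -> A p.2 -> F (p, z).
    by exists (fun a b => f (a, b)) => a b; exact: (Hf (a, b)).
  move=> [a b]; have [Aa|?] := EM (A a); last by exists a.
  have [Ab|?] := EM (A b); last by exists a.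
  by have [z Fz] := sq a b Aa Ab; exists z.
have fA a b : A a -> A b -> A (f a b).
  by move=> Aa Ab; have [] := dom _ _ _ (Hf _ _ Aa Ab).
have f_inj a b a' b' : A a -> A b -> A a' -> A b' -> f a b = f a' b' ->
    a = a' /\ b = b'.
  by move=> Aa Ab Aa' Ab' /(proj2 (inj _ _ _ _ (Hf _ _ Aa Ab) (Hf _ _ Aa' Ab'))) [-> ->].
have [[g [gB g_inj]]|[h [hA h_inj]]] := comparable_sets A (~` A); last first.
  pose e t := if pselect (A t) then f (iota 0) t else f (iota 1) (h t).
  have eA t : A (e t).
    by rewrite /e; case: pselect => At; apply: fA => //; apply: hA.
  have e_inj : injective e.
    move=> s t; rewrite /e; case: pselect => As; case: pselect => At /f_inj [] //;
      do ?exact: hA.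
    - by move=> /iota_inj.
    - by move=> /iota_inj.
    - by move=> _; apply: h_inj.
  exists (fun p => f (e p.1) (e p.2)) => -[s t] [s' t'] /= /f_inj [] //.
  by move=> /e_inj -> /e_inj ->.
exfalso.
pose B : set T := g @` A.
have AB a : A a -> ~ B a by move=> Aa [c Ac ca]; apply: (gB _ Ac); rewrite ca.
have [st Hst] : exists st : T -> T, (forall a, A a -> st a = a) /\
    forall a, A a -> st (g a) = a.
  suff /ex_choice [st Hst] : forall u, exists a,
      (A u -> a = u) /\ forall c, A c -> u = g c -> a = c.
    by exists st; split=> [a /(proj1 (Hst a))|a Aa]; [|exact: (proj2 (Hst (g a)))].
  move=> u; have [Au|nAu] := EM (A u).
    by exists u; split=> // c Ac uc; case: (AB _ Au); exists c.
  have [[c Ac cu]|nBu] := EM (B u).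
    by exists c; split=> // c' Ac'; rewrite -cu => /g_inj ->.
  by exists u; split=> // c Ac uc; case: nBu; exists c.
have [stA stg] := Hst.
pose D := A `|` B.
have stD u : D u -> A (st u) by move=> [Au|[c Ac <-]]; [rewrite stA|rewrite stg].
have st_inj u v : D u -> D v -> (B u <-> B v) -> st u = st v -> u = v.
  move=> [Au|[c Ac <-]] [Av|[d Ad <-]] uv.
  - by rewrite !stA.
  - by case: (AB _ Au); apply uv; exists d.
  - by case: (AB _ Av); apply uv; exists c.
  - by rewrite !stg // => ->.
(* the tag tells the three rectangles A * B, B * A and B * B apart *)
pose tag u v := iota (if `[< B u >] then if `[< B v >] then 2 else 0 else 1).
have tagA u v : A (tag u v) by apply: Aiota.
pose val u v := g (f (tag u v) (f (st u) (st v))).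
have ffA u v : D u -> D v -> A (f (st u) (st v)).
  by move=> Du Dv; apply: fA; apply: stD.
have fffA u v : D u -> D v -> A (f (tag u v) (f (st u) (st v))).
  by move=> Du Dv; apply: fA => //; apply: ffA.
have valB u v : D u -> D v -> B (val u v).
  by move=> Du Dv; exists (f (tag u v) (f (st u) (st v))) => //; apply: fffA.
pose F2 : set (T * T * T) :=
  [set p | [/\ D p.1.1, D p.1.2, (B p.1.1 \/ B p.1.2) & p.2 = val p.1.1 p.1.2]].
apply: (Fmax (F1 `|` F2)).
  split; first by move=> p; left.
  move/(_ (g (iota 0), g (iota 0), val (g (iota 0)) (g (iota 0)))) => F1g.
  have Bg : B (g (iota 0)) by exists (iota 0).
  have [] := dom (g (iota 0)) (g (iota 0)) (val (g (iota 0)) (g (iota 0))).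
    by right; apply: F1g; right; split=> //; [right|right|left].
  by move=> /AB.
rewrite setUA -/F.
have domD : sqdom (F `|` F2) = D.
  apply/seteqP; split=> [a [z [Fz|[]//]]|a [Aa|Ba]].
  - by left; have [] := dom _ _ _ Fz.
  - by exists (f a a); left; apply: Hf.
  - by exists (val a a); right; split=> //; [right|right|left].
rewrite /sqinj domD; split.
- move=> a b Da Db; have [nab|] := EM (B a \/ B b).
    by exists (val a b); right; split.
  move=> /not_orP [nBa nBb]; exists (f a b); left; apply: Hf.
    by case: Da.
  by case: Db.
- move=> a b z [/dom [? ? ?]|[/= Da Db _ ->]]; first by split; left.
  by split=> //; right; apply: valB.
move=> [a b] z [a' b'] z' [Fz|[/= Da Db Bab ->]] [Fz'|[/= Da' Db' Bab' ->]].
- exact: inj.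
- have [Aa Ab Az] := dom _ _ _ Fz; split=> [[aa bb]|zz].
    by move: Bab'; rewrite -aa -bb => -[/(AB _ Aa)|/(AB _ Ab)].
  by case: (AB _ Az); rewrite zz; apply: valB.
- have [Aa Ab Az] := dom _ _ _ Fz'; split=> [[aa bb]|zz].
    by move: Bab; rewrite aa bb => -[/(AB _ Aa)|/(AB _ Ab)].
  by case: (AB _ Az); rewrite -zz; apply: valB.
split=> [[-> ->]//|].
move=> /(g_inj _ _ (fffA _ _ Da Db) (fffA _ _ Da' Db')).
move=> /(f_inj _ _ _ _ (tagA _ _) (ffA _ _ Da Db) (tagA _ _) (ffA _ _ Da' Db')) [tt'].
move=> /(f_inj _ _ _ _ (stD _ Da) (stD _ Db) (stD _ Da') (stD _ Db')) [saa sbb].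
have [Baa Bbb] : (B a <-> B a') /\ (B b <-> B b').
  move: Bab Bab' (iota_inj tt') => /=.
  by do 4?case: (asboolP (B _)) => ? //; tauto.
by congr (_, _); apply: st_inj.
Qed.

Theorem seq_injects : exists f : seq T -> T, injective f.
Proof.
have [p p_inj] := square_injects.
pose enc := foldr (fun x a => p (x, a)) (iota 0).
(* the length is recorded since [iota 0] may itself code a pair *)
exists (fun s => p (iota (size s), enc s)) => s t /p_inj [/iota_inj].
elim: s t => [|x s IH] [|y t] //= [st] /p_inj [-> /IH]; by move=> ->.
Qed.

End Hessenberg.

(** * Small types *)

Definition embeds (A B : Type) : Prop := exists f : A -> B, injective f.

Lemma embeds_trans (A B C : Type) : embeds A B -> embeds B C -> embeds A C.
Proof. by move=> [f fi] [g gi]; exists (g \o f); apply: inj_comp. Qed.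

Lemma embeds_lt (A B C : Type) : embeds A B -> card_lt B C -> card_lt A C.
Proof.
move=> [f fi] [[g gi] ng]; split; first by exists (g \o f); apply: inj_comp.
by move=> [h hi]; apply: ng; exists (f \o h); apply: inj_comp.
Qed.

Lemma In_flat (T U : Type) (f : T -> seq U) (l : seq T) x y :
  List.In x l -> List.In y (f x) -> List.In y (flatten [seq f z | z <- l]).
Proof.
by elim: l => //= z l IH [->|xl] yx; apply In_cat; [left | right; apply: IH].
Qed.

Lemma existT_inj (I : Type) (F : I -> Type) (i : I) (x y : F i) :
  existT F i x = existT F i y -> x = y.
Proof.
move=> xy; have := projT2_eq xy.
by rewrite (Prop_irrelevance (projT1_eq xy) erefl).
Qed.

Section Small.

Variables (T : Type).
Hypothesis T_inf : embeds nat T.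

Lemma embeds_prod A B : embeds A T -> embeds B T -> embeds (A * B) T.
Proof.
move=> [f fi] [g gi]; have [iota iotai] := T_inf.
have [p pi] := square_injects iotai.
by exists (fun x => p (f x.1, g x.2)) => -[a b] [a' b'] /pi [/fi -> /gi ->].
Qed.

Lemma embeds_count (A : countType) : embeds A T.
Proof. by apply: embeds_trans T_inf; exists pickle; apply: pcan_inj pickleK. Qed.

Lemma embeds_sum A B : embeds A T -> embeds B T -> embeds (A + B) T.
Proof.
move=> AT BT; have [iota iotai] := T_inf.
have [p pi] := square_injects iotai; case: AT BT => [f fi] [g gi].
exists (fun x => match x with inl a => p (iota 0, f a) | inr b => p (iota 1, g b) end).
by move=> [a|b] [a'|b'] /pi [] // => [/fi -> | /iotai | /iotai | /gi ->].
Qed.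

Lemma embeds_option A : embeds A T -> embeds (option A) T.
Proof.
move=> AT; apply: (@embeds_trans _ (A + unit)).
  by exists (fun x => if x is Some a then inl a else inr tt) => -[a|] [b|] // [->].
by apply: embeds_sum => //; apply: embeds_count.
Qed.

Lemma embeds_seq A : embeds A T -> embeds (seq A) T.
Proof.
move=> [f fi]; have [iota iotai] := T_inf.
have [p pi] := seq_injects iotai.
by exists (fun s => p (map f s)) => s t /pi /(inj_map fi).
Qed.

Lemma embeds_tree A : embeds A T -> embeds (GenTree.tree A) T.
Proof.
move=> AT; apply: (@embeds_trans _ (seq (nat + A))).
  by exists (@GenTree.encode A); apply: pcan_inj (@GenTree.codeK A).
by apply: embeds_seq; apply: embeds_sum.
Qed.

End Small.

(** * Types in many variables *)

Section Saturation.

Variables (kappa S : Type) (L : language S) (M : structure L).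
Hypothesis M_sat : saturated kappa M.

Section ManyVariables.

Import classical_sets.
Local Open Scope classical_set_scope.

Variables (V : Type) (sv : V -> S).
Variables (y0 : forall s, M s).
Hypothesis V_small : card_lt (V + S) kappa.
Variables (Sigma : formula L sv -> Prop) (F0 : set {v : V & M (sv v)}).

Definition extends_set (F : set {v : V & M (sv v)}) (e : forall v, M (sv v)) : Prop :=
  forall v x, F (existT _ v x) -> e v = x.

Definition fsat (F : set {v : V & M (sv v)}) : Prop :=
  forall l : seq (formula L sv), (forall phi, List.In phi l -> Sigma phi) ->
    exists2 e, extends_set F e & forall phi, List.In phi l -> sat e phi.

Lemma finite_chain (C : set (set {v : V & M (sv v)})) G0
    (l : seq {v : V & M (sv v)}) :
  C G0 -> total_on C subset ->
  (forall p, List.In p l -> (\bigcup_(F in C) F) p) ->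
  exists2 G, C G & forall p, List.In p l -> G p.
Proof.
move=> CG0 Ctot; elim: l => [|p l IH] Hl; first by exists G0.
have [G CG lG] : exists2 G, C G & forall p, List.In p l -> G p.
  by apply: IH => p' p'l; apply: Hl; right.
have [H CH Hp] := Hl p (or_introl erefl).
have [GH|HG] := Ctot _ _ CG CH.
  by exists H => // p' [<-//|/lG /GH].
by exists G => // p' [<-|/lG //]; apply: HG.
Qed.

Lemma fsat_bigcup (C : set (set {v : V & M (sv v)})) G0 :
  C G0 -> C `<=` fsat -> total_on C subset -> fsat (\bigcup_(F in C) F).
Proof.
move=> CG0 Cf Ctot l lS; set U := \bigcup_(F in C) F.
have Ufun v x x' : U (existT _ v x) -> U (existT _ v x') -> x = x'.
  move=> Ux Ux'.
  have [|G CG lG] := @finite_chain C G0 [:: existT _ v x; existT _ v x'] CG0 Ctot.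
    by move=> p [<-|[<-|[]]].
  have [//|e He _] := Cf G CG [::].
  rewrite -(He v x); last by apply: lG; left.
  by rewrite (He v x') //; apply: lG; right; left.
pose vs := flatten [seq fvars phi | phi <- l].
have [ls [lsU lsvs]] : exists ls : seq {v : V & M (sv v)},
    (forall p, List.In p ls -> U p) /\
    forall v x, List.In v vs -> U (existT _ v x) -> List.In (existT _ v x) ls.
  elim: vs => [|v vs [ls [lsU lsvs]]]; first by exists [::].
  have [[x Ux]|nU] := EM (exists x, U (existT _ v x)).
    exists (existT _ v x :: ls); split=> [p [<-//|/lsU//]|v' x' [vv'|v'vs] Ux'].
      move: x' Ux'; rewrite -vv' => x' Ux'; left.
      by rewrite (Ufun _ _ _ Ux Ux').
    by right; apply: lsvs.
  exists ls; split=> // v' x' [vv'|v'vs] Ux'; last by apply: lsvs.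
  by case: nU; move: x' Ux'; rewrite -vv' => x' Ux'; exists x'.
have [G CG lG] := finite_chain CG0 Ctot lsU.
have [e He el] := Cf G CG l lS.
pose e' v := if pselect (exists x, U (existT _ v x)) is left ex
             then sval (cid ex) else e v.
exists e'.
  move=> v x Ux; rewrite /e'; case: pselect => [ex|[]]; last by exists x.
  by case: cid => x' /= Ux'; apply: Ufun Ux.
move=> phi phil; move: (el phi phil); apply sat_supp => v vphi.
rewrite /e'; case: pselect => // ex; case: cid => x /= Ux.
apply: esym; apply: He; apply: lG; apply: lsvs => //.
exact: In_flat phil vphi.
Qed.

Fixpoint fconj (phi0 : formula L sv) (l : seq (formula L sv)) : formula L sv :=
  if l is phi :: l then FAnd phi (fconj phi0 l) else phi0.

Lemma sat_fconj phi0 l e : sat e phi0 ->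
  (sat (M := M) e (fconj phi0 l) <-> forall phi, List.In phi l -> sat e phi).
Proof.
move=> e0; elim: l => [|phi l IH] /=; first by split.
rewrite IH; split=> [[H1 H2] psi [<-//|/H2//]|H].
by split=> [|psi psil]; apply: H; [left|right].
Qed.

(** A finite part of Sigma says about the next variable that it has a value for
    which the unassigned variables can be filled in: these formulas form a
    1-type over the values assigned by [F], which saturation realizes. *)
Lemma fsat_extend (F : set {v : V & M (sv v)}) (v0 : V) :
  fsat F -> (forall x, ~ F (existT _ v0 x)) ->
  exists x, fsat (F `|` [set existT _ v0 x]).
Proof.
move=> Ff v0F.
have Ffun v x x' : F (existT _ v x) -> F (existT _ v x') -> x = x'.
  move=> Fx Fx'; have [//|e He _] := Ff [::].
  by rewrite -(He v x) // (He v x').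
(* the points [y0 s] stand for the variables that get quantified over *)
pose A := ({p : {v : V & M (sv v)} | F p} + S)%type.
pose sa (a : A) := match a with inl p => sv (tag (sval p)) | inr s => s end.
pose ea (a : A) : M (sa a) :=
  match a return M (sa a) with inl p => tagged (sval p) | inr s => y0 s end.
pose good l x := exists2 e, extends_set F e /\ e v0 = x &
   forall phi, List.In phi l -> sat (M := M) e phi.
have def l : exists th : formula L (osrt (sv v0) sa), forall x,
    sat (oenv x ea) th <-> good l x.
  pose phi0 : formula L sv :=
    FEx (FEq (Var L (osrt (sv v0) sv) None) (Var L (osrt (sv v0) sv) None)).
  pose Phi := fconj phi0 l.
  have HPhi e : sat (M := M) e Phi <-> forall phi, List.In phi l -> sat e phi.
    by apply: sat_fconj; exists (y0 _).
  pose free v := `[< v <> v0 /\ forall x, ~ F (existT _ v x) >].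
  have [Phi' HPhi'] := ex_vars M Phi (List.filter free (fvars Phi)).
  have nat_ v : {w : option A | osrt (sv v0) sa w = sv v /\
     (forall x (p : osrt (sv v0) sa w = sv v), v = v0 \/ (exists y, F (existT _ v y)) ->
       (forall q : v = v0, eq_rect _ M (oenv x ea w) _ p = eq_rect _ (M \o sv) x _ (esym q)) /\
       (v <> v0 -> F (existT _ v (eq_rect _ M (oenv x ea w) _ p))))}.
    apply: cid.
    have [->|vv0] := EM (v = v0).
      exists None; split=> // x p _; split=> // q.
      by rewrite (Prop_irrelevance p erefl) (Prop_irrelevance q erefl).
    have [[y Fy]|nF] := EM (exists y, F (existT _ v y)).
      exists (Some (inl (exist _ _ Fy))); split=> // x p _; split=> // _.
      by rewrite (Prop_irrelevance p erefl).
    exists (Some (inr (sv v))); split=> // x p [//|[y Fy]].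
    by case: nF; exists y.
  pose f v := sval (nat_ v).
  have pf v : osrt (sv v0) sa (f v) = sv v := (svalP (nat_ v)).1.
  exists (fren pf Phi') => x.
  rewrite sat_fren HPhi'; set e0 := envr _ _.
  have e0v0 : e0 v0 = x.
    have [_ H] := svalP (nat_ v0).
    by have [H1 _] := H x (pf v0) (or_introl erefl); exact: (H1 erefl).
  have e0F : extends_set F e0.
    move=> v y Fy; have [_ H] := svalP (nat_ v).
    have vv0 : v <> v0 by move=> vv0; move: y Fy; rewrite vv0 => y /v0F.
    have [_ /(_ vv0) Fe0] := H x (pf v) (or_intror (ex_intro _ y Fy)).
    exact: Ffun Fe0 Fy.
  split=> [[e ee0 /HPhi el]|[e [eF ev0] /HPhi el]].
    exists e => //; split=> [v y Fy|].
      case: (ee0 v) => [->|/List.filter_In [_ /asboolP [_ /(_ y)]//]].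
      exact: e0F.
    case: (ee0 v0) => [->|/List.filter_In [_ /asboolP [nv _]]]; first exact: e0v0.
    by case: nv.
  exists (fun v => if pselect (List.In v (List.filter free (fvars Phi))) then e v else e0 v).
    by move=> v; case: pselect => ?; [right|left].
  move: el; apply sat_supp => v vPhi; case: pselect => //= vf.
  have [vv0|vv0] := EM (v = v0); first by rewrite vv0 ev0 e0v0.
  have [[y Fy]|nF] := EM (exists y, F (existT _ v y)).
    by rewrite (eF v y) // (e0F v y).
  case: vf; apply/List.filter_In; split=> //; apply/asboolP; split=> // y Fy.
  by apply: nF; exists y.
pose p th := exists2 l, (forall phi, List.In phi l -> Sigma phi) &
   forall x, sat (oenv x ea) th <-> good l x.
have [|l pl|x Hx] := @M_sat A sa ea (sv v0) p.
- apply: embeds_lt V_small.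
  exists (fun a : A => match a with inl p => inl (tag (sval p)) | inr s => inr s end).
  move=> [[[v x] Fx]|s] [[[v' x'] Fx']|s'] //= [].
    move=> vv'; move: x Fx x' Fx'; rewrite vv' => x Fx x' Fx'.
    have xx' := Ffun _ _ _ Fx Fx'; move: Fx; rewrite xx' => Fx.
    by rewrite (Prop_irrelevance Fx Fx').
  by move=> ->.
- have [l' [l'S l'l]] : exists l', (forall phi, List.In phi l' -> Sigma phi) /\
      forall x, good l' x -> forall th, List.In th l -> sat (oenv x ea) th.
    elim: l pl => [|th l IH] pl; first by exists [::].
    have [l1 [l1S l1l]] := IH (fun th thl => pl th (or_intror thl)).
    have [l2 l2S l2th] := pl th (or_introl erefl).
    exists (l2 ++ l1); split=> [phi /In_cat [/l2S|/l1S]//|x [e ex el] th' [<-|th'l]].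
      by apply/l2th; exists e => // phi phil; apply: el; apply In_cat; left.
    by apply: l1l th'l; exists e => // phi phil; apply: el; apply In_cat; right.
  have [e eF el'] := Ff l' l'S.
  by exists (e v0); apply: l'l; exists e.
exists x => l lS; have [th Hth] := def l.
have /Hth [e [eF ev0] el] := Hx th (ex_intro2 _ _ l lS Hth).
exists e => // v y [/eF//|vy].
have vv0 : v = v0 := f_equal (@tag _ _) vy.
by subst v; rewrite (existT_inj vy).
Qed.

(** A maximal compatible assignment is total. *)
Theorem saturated_many : fsat F0 ->
  exists2 e, extends_set F0 e & forall phi, Sigma phi -> sat e phi.
Proof.
move=> F0s.
have [C CP Ctot|F1 [Ff Fmax]] := @Zorn_bigcup _ (fun F => fsat (F0 `|` F)).
  have -> : F0 `|` \bigcup_(F in C) F =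
      \bigcup_(F in [set F0] `|` [set F0 `|` F | F in C]) F.
    apply/seteqP; split=> p.
      case=> [F0p|[F CF Fp]]; first by exists F0 => //; left.
      by exists (F0 `|` F); [right; exists F | right].
    case=> F [-> F0p|[G CG <-]]; first by left.
    by case=> [?|Gp]; [left | right; exists G].
  apply: (fsat_bigcup (G0 := F0)); first by left.
    by move=> F [->|[G CG <-]]; [exact: F0s | exact: CP].
  move=> F G [->|[F' CF' <-]] [->|[G' CG' <-]].
  - by left.
  - by left=> p; left.
  - by right=> p; left.
  - by have [FG|GF] := Ctot _ _ CF' CG'; [left|right];
      move=> p [|Fp]; [left|right; apply: FG|left|right; apply: GF].
set F := F0 `|` F1 in Ff.
have Ftot v : exists x, F (existT _ v x).
  have [//|/forallNP nF] := EM (exists x, F (existT _ v x)).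
  have [x Hx] := fsat_extend Ff nF.
  exfalso; apply: (Fmax (F1 `|` [set existT _ v x])); last by rewrite setUA.
  split; first by move=> p; left.
  move/(_ (existT _ v x)) => F1x; apply: (nF x); right.
  by apply: F1x; right.
exists (fun v => sval (cid (Ftot v))).
  move=> v x F0x; have [//|e eF _] := Ff [::].
  by case: cid => y /= Fy; rewrite -(eF v y Fy) (eF v x) //; left.
move=> phi Sphi; have [psi [<-//|[]]|e eF ephi] := Ff [:: phi].
move: (ephi phi (or_introl erefl)); apply sat_supp => v _.
by case: cid => y /= Fy; apply: esym; apply: eF.
Qed.

End ManyVariables.

Variable y0 : forall s, M s.
Local Notation Y := (Y M).

(** Compactness for families of definable predicates in a small set of variables. *)
Theorem saturated_dfn (B V : Type) (b : B -> Y) (F : ((V -> Y) -> Prop) -> Prop) :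
  card_lt (option (V + B) * S + S) kappa ->
  (forall P, F P -> dfn b P) ->
  (forall l, (forall P, List.In P l -> F P) ->
     exists g, forall P, List.In P l -> P g) ->
  exists g, forall P, F P -> P g.
Proof.
move=> small Fd Ffin.
pose sv (v : option (V + B) * S) := v.2.
pose Sigma (phi : formula L sv) := exists2 P, F P &
  forall g d, P g <-> ysat (optf (sumf g b) d) phi.
pose F0 (p : {v : option (V + B) * S & M (sv v)}) :=
  exists c s, p = existT (M \o sv) (Some (inr c), s) (b c s).
have [l lS|e eF0 eS] := @saturated_many _ sv y0 small Sigma F0.
  have [l' [l'F l'l]] : exists l' : seq ((V -> Y) -> Prop),
      (forall P, List.In P l' -> F P) /\
      forall g d, (forall P, List.In P l' -> P g) ->
        forall phi, List.In phi l -> ysat (optf (sumf g b) d) phi.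
    elim: l lS => [|phi l IH] lS; first by exists [::].
    have [l' [l'F l'l]] := IH (fun psi psil => lS psi (or_intror psil)).
    have [P FP HP] := lS phi (or_introl erefl).
    exists (P :: l'); split=> [Q [<-//|/l'F//]|g d Hg psi [<-|psil]].
      by apply/HP; apply: Hg; left.
    by apply: l'l psil => Q Ql; apply: Hg; right.
  have [g Hg] := Ffin l' l'F.
  exists (fun v => optf (sumf g b) y0 v.1 v.2); last exact: l'l.
  move=> v x [c [s vx]].
  have vcs : v = (Some (inr c), s) := f_equal (@tag _ _) vx.
  by subst v; rewrite (existT_inj vx).
exists (fun v s => e (Some (inl v), s)) => P FP.
have [phi Hphi] := Fd P FP.
apply/(Hphi _ (fun s => e (None, s))).
have := eS phi (ex_intro2 _ _ P FP Hphi).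
apply sat_ext => -[[[v|c]|] s] //=.
by apply: esym; apply: (eF0 (Some (inr c), s)); exists c, s.
Qed.

End Saturation.

(** * Definability with countably many parameters *)

Section Parametric.

Variables (S : Type) (L : language S) (M : structure L).
Variables (s0 : S) (y0 : Y M).
Local Notation Y := (Y M).
Local Notation dfn := (@dfn S L M).

Definition put (s : S) (t : M s) : Y :=
  fun s' => if pselect (s = s') is left e then eq_rect s M t s' e else y0 s'.

Lemma putE s (t : M s) : put t s = t.
Proof.
by rewrite /put; case: pselect => // e; rewrite (Prop_irrelevance e erefl).
Qed.

Lemma dfn_const B (b : B -> Y) V (A : Prop) : dfn b (fun _ : V -> Y => A).
Proof.
pose phi := FEq (Var L (fun v : option (V + B) * S => v.2) (None, s0)) (Var L _ (None, s0)).
have [a|na] := EM A; first by exists phi => g d; split.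
by exists (FNot phi) => g d; split=> //; case.
Qed.

Lemma dfn_all B (b : B -> Y) V (I : finType) (P : I -> (V -> Y) -> Prop) :
  (forall i, dfn b (P i)) -> dfn b (fun g => forall i, P i g).
Proof.
move=> dP; apply: (@dfn_iff _ _ _ _ b _ (fun g => forall i, i \in enum I -> P i g)).
  by move=> g; split=> H i; [apply: H; rewrite mem_enum | move=> _].
elim: (enum I) => [|i l IH]; first by apply: dfn_iff (dfn_const b V True).
apply: dfn_iff (dfn_and (dP i) IH) => g; split=> [[Pi Pl] j|H].
  by rewrite inE => /orP [/eqP ->|/Pl].
by split=> [|j jl]; apply: H; rewrite inE ?eqxx ?jl ?orbT.
Qed.

Lemma dfn_params B (b : B -> Y) B' (b' : B' -> Y) V (P : (V -> Y) -> Prop)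
    (r : B -> B') : (forall c, b c = b' (r c)) -> dfn b P -> dfn b' P.
Proof.
move=> br [phi Hphi].
pose f (v : option (V + B) * S) : option (V + B') * S :=
  (omap (fun w => match w with inl a => inl a | inr c => inr (r c) end) v.1, v.2).
exists (fren (f := f) (sv' := fun v : option (V + B') * S => v.2) (fun=> erefl) phi) => g d.
rewrite (Hphi _ d) /ysat sat_fren; apply sat_ext.
by case=> -[[a|c]|] s //=; rewrite /envr /= br.
Qed.

(** The parameters are not named, so that closure properties need not keep track
    of them; countably many allow any two families to be joined. *)
Definition Dfn (V : Type) (P : (V -> Y) -> Prop) : Prop :=
  exists b : nat -> Y, dfn b P.

Definition code_params (C : countType) (c : C -> Y) (i : nat) : Y :=
  if unpickle i is Some a then c a else y0.

Lemma dfn_Dfn (C : countType) (b : C -> Y) V (P : (V -> Y) -> Prop) :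
  dfn b P -> Dfn P.
Proof.
move=> dP; exists (code_params b); apply: (dfn_params (r := pickle)) dP => c.
by rewrite /code_params pickleK.
Qed.

Lemma Dfn_join V V' (P : (V -> Y) -> Prop) (Q : (V' -> Y) -> Prop) :
  Dfn P -> Dfn Q -> exists b : nat -> Y, dfn b P /\ dfn b Q.
Proof.
move=> [b dP] [b' dQ]; exists (code_params (sumf b b')); split.
  by apply: (dfn_params (r := fun c => pickle (inl c : nat + nat)%type)) dP => c;
    rewrite /code_params pickleK.
by apply: (dfn_params (r := fun c => pickle (inr c : nat + nat)%type)) dQ => c;
  rewrite /code_params pickleK.
Qed.

Lemma Dfn_iff V (P Q : (V -> Y) -> Prop) : (forall g, P g <-> Q g) -> Dfn P -> Dfn Q.
Proof. by move=> PQ [b dP]; exists b; apply: dfn_iff dP. Qed.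
Lemma Dfn_const V (A : Prop) : Dfn (fun _ : V -> Y => A).
Proof. by exists (fun=> y0); apply: dfn_const. Qed.
Lemma Dfn_not V (P : (V -> Y) -> Prop) : Dfn P -> Dfn (fun g => ~ P g).
Proof. by move=> [b dP]; exists b; apply: dfn_not. Qed.
Lemma Dfn_and V (P Q : (V -> Y) -> Prop) :
  Dfn P -> Dfn Q -> Dfn (fun g => P g /\ Q g).
Proof. by move=> dP dQ; have [b [? ?]] := Dfn_join dP dQ; exists b; apply: dfn_and. Qed.
Lemma Dfn_imp V (P Q : (V -> Y) -> Prop) :
  Dfn P -> Dfn Q -> Dfn (fun g => P g -> Q g).
Proof. by move=> dP dQ; have [b [? ?]] := Dfn_join dP dQ; exists b; apply: dfn_imp. Qed.
Lemma Dfn_equiv V (P Q : (V -> Y) -> Prop) :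
  Dfn P -> Dfn Q -> Dfn (fun g => P g <-> Q g).
Proof. by move=> dP dQ; apply: Dfn_and; apply: Dfn_imp. Qed.
Lemma Dfn_ex V W (P : (V + W -> Y) -> Prop) :
  Dfn P -> Dfn (fun g : V -> Y => exists h : W -> Y, P (sumf g h)).
Proof. by move=> [b dP]; exists b; apply: dfn_ex. Qed.

Lemma Dfn_all V (I : finType) (P : I -> (V -> Y) -> Prop) :
  (forall i, Dfn (P i)) -> Dfn (fun g => forall i, P i g).
Proof.
move=> dP; apply: (@Dfn_iff _ (fun g => forall i, i \in enum I -> P i g)).
  by move=> g; split=> H i; [apply: H; rewrite mem_enum | move=> _].
elim: (enum I) => [|i l IH]; first by apply: Dfn_iff (Dfn_const V True).
apply: Dfn_iff (Dfn_and (dP i) IH) => g; split=> [[Pi Pl] j|H].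
  by rewrite inE => /orP [/eqP ->|/Pl].
by split=> [|j jl]; apply: H; rewrite inE ?eqxx ?jl ?orbT.
Qed.

Lemma code_on (U : Type) (c : U -> Y) (l : seq U) :
  exists (b : nat -> Y) (idx : U -> nat), forall u, List.In u l -> b (idx u) = c u.
Proof.
elim: l => [|u l [b [idx Hb]]]; first by exists (fun=> y0), (fun=> 0).
exists (fun i => if i is i'.+1 then b i' else c u),
  (fun w => if pselect (w = u) then 0 else (idx w).+1) => w wl.
case: pselect => [wu|wu] /=; first by rewrite wu.
apply: Hb.
by case: wl => // /esym.
Qed.

(** Infinitely many constants may be substituted, as only finitely many of them
    occur in the formula. *)
Lemma Dfn_subst (V U : Type) (P : (U -> Y) -> Prop) (F : (V -> Y) -> U -> Y) :
  (forall u, (exists v, forall g, F g u = g v) \/ (exists y, forall g, F g u = y)) ->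
  Dfn P -> Dfn (fun g => P (F g)).
Proof.
move=> HF [b [phi Hphi]].
have /ex_choice [r Hr] : forall u, exists r : V + Y, forall g, F g u = sumf g id r.
  move=> u; case: (HF u) => [[v Hv]|[y Hy]]; first by exists (inl v).
  by exists (inr y).
pose c u := match r u with inl _ => y0 | inr y => y end.
pose us := pmap (fun w : option (U + nat) * S => if w.1 is Some (inl u) then Some u else None)
  (fvars phi).
have [b' [idx Hb']] := code_on c us.
have inus u s : List.In (Some (inl u), s) (fvars phi) -> List.In u us.
  rewrite /us; elim: (fvars phi) => //= w l IH [->/=|/IH H]; first by left.
  by case: w => [[[w|w]|] s'] //=; right.
pose f (v : option (U + nat) * S) : option (V + (nat + nat)) * S :=
  (match v.1 with
   | Some (inl u) => match r u with inl v => Some (inl v) | inr _ => Some (inr (inr (idx u))) end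
   | Some (inr i) => Some (inr (inl i))
   | None => None end, v.2).
apply: (@dfn_Dfn _ (sumf b b')).
exists (fren (f := f) (sv' := fun v : option (V + (nat + nat)) * S => v.2) (fun=> erefl) phi) => g d.
rewrite (Hphi (F g) d) /ysat sat_fren; apply: sat_supp => -[[[u|i]|] s] //= uphi.
rewrite Hr /envr /f /=.
by case E: (r u) => [v|y] //=; rewrite (Hb' u (inus u s uphi)) /c E.
Qed.

Lemma Dfn_sat (V U : Type) (sv : U -> S) (phi : formula L sv) (rho : U -> V) :
  Dfn (fun g : V -> Y => sat (fun u => g (rho u) (sv u)) phi).
Proof. exists (fun=> y0); exact: (dfn_sat (fun=> y0) phi (fun u => inl (rho u) : V + nat)). Qed.

Lemma Dfn_eq V (v w : V) (s : S) : Dfn (fun g : V -> Y => g v s = g w s).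
Proof.
have := Dfn_sat (FEq (Var L (fun=> s) true) (Var L (fun=> s) false))
  (fun c => if c then v else w).
by apply: Dfn_iff.
Qed.

Lemma Dfn_ren V V' (P : (V -> Y) -> Prop) (rho : V -> V') :
  Dfn P -> Dfn (fun g => P (fun v => g (rho v))).
Proof. by move=> [b dP]; exists b; apply: dfn_ren. Qed.

Lemma Dfn_exs V s (P : M s -> (V -> Y) -> Prop) :
  Dfn (fun g : option V -> Y => P (g None s) (fun v => g (Some v))) ->
  Dfn (fun g => exists t, P t g).
Proof.
move=> dP.
pose rho (v : option V) : V + unit := if v is Some a then inl a else inr tt.
apply: Dfn_iff (Dfn_ex (Dfn_ren rho dP)) => g; split=> [[h Ph]|[t Pt]].
  by exists (h tt s).
by exists (fun=> put t) => /=; rewrite putE.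
Qed.

End Parametric.

(** * Random pairs of predicates *)

Section Random.

Variables (kappa Lam S : Type) (L : language S) (M : structure L).
Hypothesis M_sat : saturated kappa M.
Hypotheses (nat_Lam : embeds nat Lam) (S_Lam : embeds S Lam).
Hypothesis Lam_kappa : card_lt Lam kappa.
Variables (s0 : S) (y0 : Y M) (n : nat).

Local Notation Y := (Y M).
Local Notation Dfn := (@Dfn S L M).
Local Notation q := n.+1.
Definition pt : Type := nat -> Y.
Definition point : Type := 'I_q -> pt.

Definition definable (P : point -> Prop) : Prop :=
  Dfn (fun g : 'I_q * nat -> Y => P (fun l j => g (l, j))).

Definition at_edge (W : Type) (x : 'I_q -> W -> pt) (v : {ffun 'I_q -> W}) :
  point := fun l => x l (v l).

Definition side (P1 P0 : point -> Prop) (r : bool) : point -> Prop :=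
  if r then P1 else P0.

Definition fits (P1 P0 : point -> Prop) (W : Type)
    (R : {ffun 'I_q -> W} -> bool) (x : 'I_q -> W -> pt) : Prop :=
  forall v, side P1 P0 (R v) (at_edge x v).

Definition Rand (P1 P0 : point -> Prop) : Prop :=
  forall (W : finType) (R : {ffun 'I_q -> W} -> bool), exists x, fits P1 P0 R x.

Lemma Rand_map (P1 P0 Q1 Q0 : point -> Prop) (F : 'I_q -> pt -> pt) :
  (forall x, P1 x -> Q1 (fun l => F l (x l))) ->
  (forall x, P0 x -> Q0 (fun l => F l (x l))) -> Rand P1 P0 -> Rand Q1 Q0.
Proof.
move=> PQ1 PQ0 HP W R; have [x Hx] := HP W R.
exists (fun l w => F l (x l w)) => v; move: (Hx v).
by case: (R v); [apply: PQ1 | apply: PQ0].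
Qed.

Lemma Rand_weaken (P1 P0 Q1 Q0 : point -> Prop) :
  (forall x, P1 x -> Q1 x) -> (forall x, P0 x -> Q0 x) -> Rand P1 P0 -> Rand Q1 Q0.
Proof. by move=> PQ1 PQ0; apply: (Rand_map (F := fun _ => id)). Qed.

Lemma Rand_swap (P1 P0 : point -> Prop) : Rand P1 P0 -> Rand P0 P1.
Proof.
move=> HP W R; have [x Hx] := HP W (fun v => ~~ R v).
by exists x => v; move: (Hx v); case: (R v).
Qed.

Lemma small_count (V : Type) : embeds V Lam -> card_lt (option (V + nat) * S + S) kappa.
Proof.
move=> VL; apply: embeds_lt Lam_kappa; apply: embeds_sum => //.
apply: embeds_prod => //; apply: embeds_option => //; exact: embeds_sum.
Qed.

(** Compactness: finite patterns suffice for countable ones. *)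
Lemma inf_array (P1 P0 : point -> Prop) : definable P1 -> definable P0 -> Rand P1 P0 ->
  forall (I : countType) (R : {ffun 'I_q -> I} -> bool),
    exists x, fits P1 P0 R x.
Proof.
move=> dP1 dP0 HP I R; have [b [{}dP1 {}dP0]] := Dfn_join y0 dP1 dP0.
pose pr v (g : 'I_q * I * nat -> Y) := side P1 P0 (R v) (fun l j => g (l, v l, j)).
pose F P := exists v, P = pr v.
have [|P [v ->]|l lF|g Hg] := @saturated_dfn kappa S L M M_sat y0 nat _ b F.
- exact/small_count/embeds_count.
- rewrite /pr; case: (R v).
    exact: (@dfn_ren _ _ _ _ _ _ _ _ (fun p : 'I_q * nat => (p.1, v p.1, p.2)) dP1).
  exact: (@dfn_ren _ _ _ _ _ _ _ _ (fun p : 'I_q * nat => (p.1, v p.1, p.2)) dP0).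
- have [vs Hvs] : exists vs : seq {ffun 'I_q -> I},
      forall P, List.In P l -> exists2 v, v \in vs & P = pr v.
    elim: l lF => [|P l IH] lF; first by exists [::].
    have [vs Hvs] := IH (fun Q Ql => lF Q (or_intror Ql)).
    have [v Pv] := lF P (or_introl erefl).
    exists (v :: vs) => Q [<-|/Hvs [w wvs ->]].
      by exists v => //; rewrite mem_head.
    by exists w => //; rewrite inE wvs orbT.
  case: vs Hvs => [|v0 vs] Hvs.
    by exists (fun _ => y0) => P /Hvs [].
  pose i0 := v0 ord0; pose s := flatten [seq codom (v : {ffun 'I_q -> I}) | v <- v0 :: vs].
  have [x Hx] := HP 'I_(size s).+1 (fun u => R [ffun k => nth i0 s (u k)]).
  exists (fun p => x p.1.1 (inord (index p.1.2 s)) p.2) => P /Hvs [v vvs ->].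
  have vs_s k : v k \in s.
    by apply/flatten_mapP; exists v => //; apply: codom_f.
  have := Hx [ffun k => inord (index (v k) s)].
  rewrite /pr /at_edge.
  have -> : [ffun k => nth i0 s ([ffun k0 => inord (index (v k0) s)] k : 'I_(size s).+1)] = v.
    by apply/ffunP => k; rewrite !ffunE inordK ?nth_index // ltnS index_size.
  congr (side _ _ _ _); apply: functional_extensionality_dep => k.
  by apply: functional_extensionality_dep => j; rewrite ffunE.
exists (fun l i j => g (l, i, j)) => v.
exact: (Hg (pr v) (ex_intro _ v erefl)).
Qed.

(** Disjoint copies of finitely many patterns fit into a single one. *)
Lemma union_pattern (I : finType) (U : I -> finType) (U' : finType)
    (j : forall i, U i -> U') (R : forall i, {ffun 'I_q -> U i} -> bool) :
  (forall i i' a a', j i a = j i' a' -> existT U i a = existT U i' a') ->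
  exists R' : {ffun 'I_q -> U'} -> bool,
    forall i (u : {ffun 'I_q -> U i}), R' [ffun k => j i (u k)] = R i u.
Proof.
move=> j_inj.
exists (fun v => [exists i, [exists u : {ffun 'I_q -> U i},
   (v == [ffun k => j i (u k)]) && R i u]]) => i u.
apply/existsP/idP => [[i' /existsP [u' /andP [/eqP uu' Ru']]]|Ru]; last first.
  by exists i; apply/existsP; exists u; rewrite eqxx.
have uu k : existT U i (u k) = existT U i' (u' k).
  by apply: j_inj; move/ffunP/(_ k): uu'; rewrite !ffunE.
have ii : i' = i by have := f_equal (@tag _ _) (uu ord0).
subst i'; suff <- : u' = u by [].
by apply/ffunP => k; apply: (@existT_inj _ U i); exact: esym (uu k).
Qed.

(** A parameter that may depend on the pattern can be chosen uniformly, by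
    saturation and by [union_pattern]. *)
Lemma Rand_fix (C : countType) (P1 P0 : (C -> Y) -> point -> Prop) :
  Dfn (fun g : C + 'I_q * nat -> Y => P1 (fun c => g (inl c)) (fun l j => g (inr (l, j)))) ->
  Dfn (fun g : C + 'I_q * nat -> Y => P0 (fun c => g (inl c)) (fun l j => g (inr (l, j)))) ->
  (forall (W : finType) (R : {ffun 'I_q -> W} -> bool),
     exists c x, fits (P1 c) (P0 c) R x) ->
  exists c, Rand (P1 c) (P0 c).
Proof.
move=> dP1 dP0 HP; have [b [{}dP1 {}dP0]] := Dfn_join y0 dP1 dP0.
pose pr (W : finType) R (c : C -> Y) :=
  exists x : 'I_q -> W -> pt, fits (P1 c) (P0 c) R x.
pose F P := exists (W : finType) R, P = @pr W R.
have [|P [W [R ->]]|l lF|c Hc] := @saturated_dfn kappa S L M M_sat y0 nat _ b F.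
- exact/small_count/embeds_count.
- apply: (@dfn_iff _ _ _ _ _ _ (fun g => exists h : 'I_q * W * nat -> Y,
    forall v : {ffun 'I_q -> W}, side (P1 g) (P0 g) (R v) (fun l j => h (l, v l, j)))).
    move=> g; split=> [[h Hh]|[x Hx]]; first by exists (fun l w j => h (l, w, j)).
    by exists (fun p => x p.1.1 p.1.2 p.2).
  apply: (@dfn_ex _ _ _ _ b _ _ (fun g => forall v : {ffun 'I_q -> W},
    side (P1 (fun c => g (inl c))) (P0 (fun c => g (inl c))) (R v)
      (fun l j => g (inr (l, v l, j))))).
  apply: (dfn_all s0) => v.
  pose rho (p : C + 'I_q * nat) : C + 'I_q * W * nat :=
    match p with inl c => inl c | inr p => inr (p.1, v p.1, p.2) end.
  by case: (R v); [exact: dfn_ren rho dP1 | exact: dfn_ren rho dP0].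
- suff [W [R HR]] : exists (W : finType) R, forall c, @pr W R c ->
      forall P, List.In P l -> P c.
    have [c [x Hx]] := HP W R; exists c; apply: HR; by exists x.
  elim: l lF => [|P l IH] lF; first by exists unit, (fun=> true).
  have [W1 [R1 H1]] := IH (fun Q Ql => lF Q (or_intror Ql)).
  have [W2 [R2 P2]] := lF P (or_introl erefl).
  pose U (i : bool) : finType := if i then W1 else W2.
  pose RU i : {ffun 'I_q -> U i} -> bool := match i with true => R1 | false => R2 end.
  pose jU i : U i -> (W1 + W2)%type :=
    match i return U i -> (W1 + W2)%type with true => inl | false => inr end.
  have [|R HR] := @union_pattern bool U (W1 + W2)%type jU RU.
    by case=> -[] a a' // [->].
  exists (W1 + W2)%type, R => c [x Hx] Q [<-|Ql].
    rewrite P2; exists (fun l w => x l (inr w)) => v.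
    have := Hx [ffun k => inr (v k)]; rewrite (HR false v).
    by congr (side _ _ _ _); apply: functional_extensionality_dep => k; rewrite /at_edge ffunE.
  apply: (H1 c) Ql; exists (fun l w => x l (inl w)) => v.
  have := Hx [ffun k => inl (v k)]; rewrite (HR true v).
  by congr (side _ _ _ _); apply: functional_extensionality_dep => k; rewrite /at_edge ffunE.
by exists c => W R; apply: (Hc (@pr W R)); exists W, R.
Qed.

Section Blocks.

Variable (E : finType).
Notation pattern := {ffun {ffun 'I_q -> E} -> bool}.
Definition block : Type := 'I_q -> E -> pt.

(** A realization of a pattern whose vertices are grouped into blocks, the
    transversals of which are recovered by [btrans]. *)
Definition block_fits (P1 P0 : point -> Prop) (W : finType)
   (R : {ffun 'I_q -> E * W} -> bool) (x : 'I_q -> E -> W -> pt) : Prop :=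
  forall v, side P1 P0 (R v) (fun l => x l (v l).1 (v l).2).

Definition btrans (W : finType) (x : 'I_q -> E -> W -> pt)
  (w : {ffun 'I_q * E -> W}) : block := fun l e => x l e (w (l, e)).

(** For one pattern the truth values of the [psi a] on transversals are colours,
    and [partite_ramsey] makes them depend on the pattern of the transversal only.
    The rule [T] can be taken the same for all patterns, since there are finitely
    many rules and counterexamples to each can be put side by side. *)
Theorem uniform_blocks (P1 P0 : point -> Prop) (A : finType)
    (psi : A -> block -> Prop) : Rand P1 P0 ->
  exists T : A -> pattern -> bool,
    forall (W : finType) (R : {ffun 'I_q -> E * W} -> bool),
    exists2 x, block_fits P1 P0 R x &
      forall w a, psi a (btrans x w) <-> T a (pat R w).
Proof.
move=> HP.
have one (W : finType) (R : {ffun 'I_q -> E * W} -> bool) : exists T : {ffun A * pattern -> bool},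
    exists2 x, block_fits P1 P0 R x & forall w a, psi a (btrans x w) <-> T (a, pat R w).
  have [W' [R' HR']] := partite_ramsey {ffun A -> bool} R.
  have [x Hx] := HP (E * W')%type R'.
  pose C (w : {ffun 'I_q * E -> W'}) : {ffun A -> bool} :=
    [ffun a => `[< psi a (fun l e => x l (e, w (l, e))) >]].
  have [h [hR hC]] := HR' C.
  exists [ffun p : A * pattern => `[< exists2 w, pat R w = p.2 & C (tmap h w) p.1 >]].
  exists (fun l e w => x l (e, h l e w)).
    move=> v; rewrite -hR; have := Hx (emap h v).
    by congr (side _ _ _ _); apply: functional_extensionality_dep => k; rewrite /at_edge ffunE.
  move=> w a; rewrite ffunE /=.
  have Cw : C (tmap h w) a <-> psi a (btrans (fun l e w => x l (e, h l e w)) w).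
    rewrite ffunE asboolE (_ : (fun l e => _) = btrans (fun l e w => x l (e, h l e w)) w) //.
    apply: functional_extensionality_dep => l; apply: functional_extensionality_dep => e.
    by rewrite /btrans ffunE.
  rewrite -Cw; split=> [Cwa|/asboolP [w' w'w]]; first by apply/asboolP; exists w.
  by rewrite (hC w' w).
have [//|nT] := EM (exists T : A -> pattern -> bool,
    forall (W : finType) (R : {ffun 'I_q -> E * W} -> bool),
    exists2 x, block_fits P1 P0 R x &
      forall w a, psi a (btrans x w) <-> T a (pat R w)).
exfalso.
have {}nT (T : {ffun A * pattern -> bool}) : exists (W : finType)
    (R : {ffun 'I_q -> E * W} -> bool), ~ exists2 x, block_fits P1 P0 R x &
      forall w a, psi a (btrans x w) <-> T (a, pat R w).
  apply: contrapT => nW; apply: nT; exists (fun a r => T (a, r)) => W R.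
  by apply: contrapT => nx; apply: nW; exists W, R.
have [W HW] := ex_choice nT.
have [R HR] : exists R : (forall T, {ffun 'I_q -> E * W T} -> bool), forall T,
    ~ exists2 x, block_fits P1 P0 (R T) x &
      forall w a, psi a (btrans x w) <-> T (a, pat (R T) w).
  by exists (fun T => sval (cid (HW T))) => T; exact: svalP (cid (HW T)).
pose W' : finType := {T : {ffun A * pattern -> bool} & W T}.
have [|R' HR'] := @union_pattern _ (fun T => E * W T)%type (E * W')%type
    (fun T p => (p.1, Tagged W p.2)) (fun T => R T).
  move=> T T' [e w] [e' w'] /= ew.
  have ww' : Tagged W w = Tagged W w' := f_equal snd ew.
  have TT' : T = T' := f_equal (@tag _ _) ww'.
  by subst T'; rewrite (f_equal fst ew : e = e') (existT_inj ww').
have [T [x Hx HT]] := one W' R'.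
have {}HR' (v : {ffun 'I_q -> E * W T}) :
    R' [ffun k => ((v k).1, Tagged W (v k).2)] = R T v := HR' T v.
apply: (HR T); exists (fun l e w => x l e (Tagged W w)).
  move=> v; rewrite -HR'; have := Hx [ffun k => ((v k).1, Tagged W (v k).2)].
  by congr (side _ _ _ _); apply: functional_extensionality_dep => k; rewrite ffunE.
move=> w a; have := HT [ffun p => Tagged W (w p)] a.
have -> : btrans x [ffun p => Tagged W (w p)] = btrans (fun l e w => x l e (Tagged W w)) w.
  apply: functional_extensionality_dep => l; apply: functional_extensionality_dep => e.
  by rewrite /btrans ffunE.
suff -> : pat R' [ffun p => Tagged W (w p)] = pat (R T) w by [].
apply/ffunP => i; rewrite !ffunE -HR'; congr (R' _).
by apply/ffunP => k; rewrite !ffunE.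
Qed.

End Blocks.
End Random.

(** * Absorbing one of the points *)

Section Core.

Variables (kappa Lam S : Type) (L : language S) (M : structure L).
Hypothesis M_sat : saturated kappa M.
Hypotheses (nat_Lam : embeds nat Lam) (S_Lam : embeds S Lam).
Hypothesis Lam_kappa : card_lt Lam kappa.
Variables (s0 : S) (y0 : Y M) (n : nat).

Local Notation Y := (Y M).
Local Notation Dfn := (@Dfn S L M).
Local Notation q := n.+1.
Local Notation pt := (pt M).
Local Notation point := (point M n).
Local Notation block := (block M n).
Local Notation definable := (@definable S L M n).
Local Notation pattern E := {ffun {ffun 'I_q -> E} -> bool}.

(** Substitutions under which definability is preserved: each coordinate is a
    variable or a constant. *)
Definition cwise (V : Type) (F : (V -> Y) -> point) : Prop :=
  forall l j, (exists v, forall g, F g l j = g v) \/ (exists y, forall g, F g l j = y).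

Lemma definable_at (P : point -> Prop) V (F : (V -> Y) -> point) :
  definable P -> cwise F -> Dfn (fun g => P (F g)).
Proof.
move=> dP HF; apply: (@Dfn_subst S L M y0 V _ (fun g : 'I_q * nat -> Y => P (fun l j => g (l, j)))
  (fun g p => F g p.1 p.2)) dP => -[l j]; exact: HF.
Qed.

Definition dfun (s : S) (f : point -> M s) : Prop :=
  Dfn (fun g : option ('I_q * nat) -> Y => f (fun l j => g (Some (l, j))) = g None s).

Definition drel (s : S) (chi : M s -> point -> Prop) : Prop :=
  Dfn (fun g : option ('I_q * nat) -> Y => chi (g None s) (fun l j => g (Some (l, j)))).

Lemma drel_at s (chi : M s -> point -> Prop) V (F : (V -> Y) -> point) v :
  drel chi -> cwise F -> Dfn (fun g => chi (g v s) (F g)).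
Proof.
move=> dchi HF.
apply: (@Dfn_subst S L M y0 V _ (fun g : option ('I_q * nat) -> Y =>
   chi (g None s) (fun l j => g (Some (l, j))))
  (fun g p => if p is Some p then F g p.1 p.2 else g v)) dchi => -[[l j]|]; first exact: HF.
by left; exists v.
Qed.

Lemma drel_const s (chi : M s -> point -> Prop) V (F : (V -> Y) -> point) t :
  drel chi -> cwise F -> Dfn (fun g => chi t (F g)).
Proof.
move=> dchi HF; rewrite -(putE y0 t).
apply: (@Dfn_subst S L M y0 V _ (fun g : option ('I_q * nat) -> Y =>
   chi (g None s) (fun l j => g (Some (l, j))))
  (fun g p => if p is Some p then F g p.1 p.2 else put y0 t)) dchi => -[[l j]|]; first exact: HF.
by right; exists (put y0 t).
Qed.

Lemma cwise_ren V V' (F : (V -> Y) -> point) (r : V -> V') :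
  cwise F -> cwise (fun g => F (fun v => g (r v))).
Proof.
move=> HF l j; case: (HF l j) => [[v Hv]|[y Hy]]; first by left; exists (r v) => g; rewrite Hv.
by right; exists y => g; rewrite Hy.
Qed.

Lemma dfun_rel s (f : point -> M s) : dfun f -> drel (fun t x => f x = t).
Proof. by []. Qed.

Lemma dfun_eq_at s (f : point -> M s) V (F G : (V -> Y) -> point) :
  dfun f -> cwise F -> cwise G -> Dfn (fun g => f (F g) = f (G g)).
Proof.
move=> df HF HG.
apply: (@Dfn_iff _ _ _ _ (fun g => exists t, f (F g) = t /\ f (G g) = t)).
  by move=> g; split=> [[t [-> ->]]//|FG]; exists (f (G g)).
apply: (Dfn_exs y0); apply: (Dfn_and y0).
  exact: (drel_at None (dfun_rel df) (cwise_ren Some HF)).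
exact: (drel_at None (dfun_rel df) (cwise_ren Some HG)).
Qed.

Lemma dfun_const_at s (f : point -> M s) V (F : (V -> Y) -> point) t :
  dfun f -> cwise F -> Dfn (fun g => f (F g) = t).
Proof. by move=> df HF; apply: (drel_const t (dfun_rel df)). Qed.

Lemma drel_fun s (chi : M s -> point -> Prop) (f : point -> M s) :
  drel chi -> dfun f -> definable (fun x => chi (f x) x).
Proof.
move=> dchi df.
apply: (@Dfn_iff _ _ _ _ (fun g : 'I_q * nat -> Y => exists t,
  f (fun l j => g (l, j)) = t /\ chi t (fun l j => g (l, j)))).
  by move=> g; split=> [[t [<-]]//|fg]; eexists; split.
by apply: (Dfn_exs y0); apply: (Dfn_and y0).
Qed.

Section Flip.

Variable E : finType.

Definition block_definable (psi : block E -> Prop) : Prop :=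
  Dfn (fun g : 'I_q * E * nat -> Y => psi (fun l e j => g (l, e, j))).

Definition ins (c : block E) (e : {ffun 'I_q -> E}) (x : point) : block E :=
  fun l a => if a == e l then x l else c l a.

Definition add (e : {ffun 'I_q -> E}) (r : pattern E) : pattern E :=
  [ffun i => (i == e) || r i].

(** If adding the edge [e] to the pattern [r] changes the truth value of [psi],
    then in a block where only the vertices of [e] vary, and which realizes
    elsewhere the pattern [r], [psi] holds or fails according to whether the
    varying vertices form an edge. *)
Lemma flip (P1 P0 : point -> Prop) (psi : block E -> Prop) (T : pattern E -> bool)
    (e : {ffun 'I_q -> E}) (r : pattern E) :
  definable P1 -> definable P0 -> block_definable psi ->
  (forall (W : finType) (R : {ffun 'I_q -> E * W} -> bool),
    exists2 x, block_fits P1 P0 R x & forall w, psi (btrans x w) <-> T (pat R w)) ->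
  r e = false -> T (add e r) != T r ->
  exists c (b : bool),
    Rand (fun x => P1 x /\ (psi (ins c e x) <-> b))
         (fun x => P0 x /\ (psi (ins c e x) <-> ~~ b)).
Proof.
move=> dP1 dP0 dpsi HT re Tne.
pose cb (c : 'I_q * E * nat -> Y) : block E := fun l a j => c (l, a, j).
have dQ (P : point -> Prop) (b : bool) : definable P -> Dfn (fun g : 'I_q * E * nat + 'I_q * nat -> Y =>
    P (fun l j => g (inr (l, j))) /\
    (psi (ins (cb (fun c => g (inl c))) e (fun l j => g (inr (l, j)))) <-> b)).
  move=> dP; apply: (Dfn_and y0); first by apply: (Dfn_ren (fun p => inr p) dP).
  apply: (Dfn_equiv y0); last exact: (Dfn_const s0 y0).
  apply: (@Dfn_subst S L M y0 _ _ (fun g : 'I_q * E * nat -> Y => psi (fun l a j => g (l, a, j)))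
    (fun g p => ins (cb (fun c => g (inl c))) e (fun l j => g (inr (l, j))) p.1.1 p.1.2 p.2)) dpsi.
  move=> [[l a] j]; left; rewrite /ins /cb /=.
  by case: (a == e l); [exists (inr (l, j)) | exists (inl (l, a, j))].
have [|||c HR] := @Rand_fix kappa Lam S L M M_sat nat_Lam S_Lam Lam_kappa s0 y0 n
    ('I_q * E * nat)%type
    (fun c x => P1 x /\ (psi (ins (cb c) e x) <-> T (add e r)))
    (fun c x => P0 x /\ (psi (ins (cb c) e x) <-> ~~ T (add e r))); last by exists (cb c), (T (add e r)).
- exact: (dQ P1 _ dP1).
- exact: (dQ P0 _ dP0).
move=> W R.
(* [None] is the fixed copy of the block, [Some w] the varying vertices *)
pose R0 (v : {ffun 'I_q -> E * option W}) := if [ffun k => (v k).1] == e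
  then [exists u : {ffun 'I_q -> W}, (v == [ffun k => (e k, Some (u k))]) && R u]
  else r [ffun k => (v k).1].
have [x Hx xT] := HT (option W) R0.
exists (fun p => x p.1.1 p.1.2 None p.2), (fun l w => x l (e l) (Some w)) => v.
pose w : {ffun 'I_q * E -> option W} :=
  [ffun p => if p.2 == e p.1 then Some (v p.1) else None].
have R0v : R0 [ffun k => (e k, Some (v k))] = R v.
  rewrite /R0 ifT; last by apply/eqP/ffunP => k; rewrite !ffunE.
  apply/existsP/idP => [[u /andP [/eqP uv Ru]]|Rv]; last by exists v; rewrite eqxx.
  suff -> : v = u by [].
  by apply/ffunP => k; move/ffunP/(_ k): uv; rewrite !ffunE => -[].
have patw : pat R0 w = if R v then add e r else r.
  apply/ffunP => i; rewrite ffunE.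
  have [->|ie] := eqVneq i e.
    have -> : tedge w e = [ffun k => (e k, Some (v k))].
      by apply/ffunP => k; rewrite !ffunE /= eqxx.
    by rewrite R0v; case: (R v); rewrite ?ffunE ?eqxx.
  have ti : [ffun k => (tedge w i k).1] = i by apply/ffunP => k; rewrite !ffunE.
  by rewrite /R0 ti (negPf ie); case: (R v); rewrite ?ffunE ?(negPf ie).
have bw : btrans x w = ins (cb (fun p => x p.1.1 p.1.2 None p.2)) e
    (at_edge (fun l w => x l (e l) (Some w)) v).
  apply: functional_extensionality_dep => l; apply: functional_extensionality_dep => a.
  rewrite /btrans /ins ffunE /= /at_edge /cb /=.
  by case: eqP => [->|].
have := Hx [ffun k => (e k, Some (v k))]; rewrite R0v.
rewrite (_ : (fun l => _) = at_edge (fun l w => x l (e l) (Some w)) v); last first.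
  by apply: functional_extensionality_dep => k; rewrite ffunE.
have := xT w; rewrite patw bw; case: (R v) => /= wT ?; split=> //.
by rewrite wT; move: Tne; case: (T r); case: (T _).
Qed.

End Flip.

Definition upd (x : point) (sg : 'I_q) (u : pt) : point :=
  fun l => if l == sg then u else x l.
Definition sel (E : finType) (y : block E) (i : {ffun 'I_q -> E}) : point :=
  fun l => y l (i l).

Lemma cwise_upd V (F : (V -> Y) -> point) sg (u : pt) :
  cwise F -> cwise (fun g => upd (F g) sg u).
Proof.
move=> HF l j; rewrite /upd; case: (l == sg); last exact: HF.
by right; exists (u j).
Qed.

Lemma upd_id (x : point) sg : upd x sg (x sg) = x.
Proof.
by apply: functional_extensionality_dep => l; rewrite /upd; case: eqP => [->|].
Qed.

Section Absorb.

Variables (s : S) (P1 P0 : point -> Prop) (f : point -> M s) (sg : 'I_q) (strict : bool).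
Hypotheses (dP1 : definable P1) (dP0 : definable P0) (df : dfun f).

(** A single point [u] can replace the vertices of class [sg] on all the edges
    through [e0], so as to realize there the pattern [r'] and to keep the values
    of [f]; on the non-edges these are kept only if [strict]. *)
Definition match_at (E : finType) (e0 : E) (r' : pattern E) (y : block E) : Prop :=
  exists u : pt, forall i : {ffun 'I_q -> E}, i sg = e0 ->
    side P1 P0 (r' i) (upd (sel y i) sg u) /\
    (strict || r' i -> f (upd (sel y i) sg u) = f (sel y i)).

Hypothesis no_flip : forall (E : finType) (e0 : E) (r' : pattern E)
    (e : {ffun 'I_q -> E}) (c : block E) (b : bool),
  e sg = e0 -> r' e = false ->
  ~ Rand (fun x => P1 x /\ (match_at e0 r' (ins c e x) <-> b))
         (fun x => P0 x /\ (match_at e0 r' (ins c e x) <-> ~~ b)).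

Lemma match_at_dfn (E : finType) (e0 : E) (r' : pattern E) : block_definable (match_at e0 r').
Proof.
rewrite /block_definable /match_at.
apply: (@Dfn_ex S L M _ nat (fun g : 'I_q * E * nat + nat -> Y => forall i : {ffun 'I_q -> E},
  i sg = e0 ->
    side P1 P0 (r' i) (upd (fun l j => g (inl (l, i l, j))) sg (fun j => g (inr j))) /\
    (strict || r' i -> f (upd (fun l j => g (inl (l, i l, j))) sg (fun j => g (inr j))) =
       f (fun l j => g (inl (l, i l, j)))))).
apply: (Dfn_all s0 y0) => i.
have cu : cwise (fun g : 'I_q * E * nat + nat -> Y =>
    upd (fun l j => g (inl (l, i l, j))) sg (fun j => g (inr j))).
  by move=> l j; left; rewrite /upd; case: (l == sg); eexists.
have cs : cwise (fun g : 'I_q * E * nat + nat -> Y => (fun l j => g (inl (l, i l, j)))).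
  by move=> l j; left; eexists.
apply: (Dfn_imp y0); first exact: (Dfn_const s0 y0).
apply: (Dfn_and y0).
  by case: (r' i); apply: definable_at.
apply: (Dfn_imp y0); first exact: (Dfn_const s0 y0).
exact: dfun_eq_at.
Qed.

Hypothesis P_Rand : Rand P1 P0.

(** By [no_flip] the truth of [match_at e0 r'] on a transversal with pattern r
    does not change when an edge outside of [r'] is added to r.  It holds trivially
    when r and [r'] agree on the edges through [e0], the point being already
    there; hence it holds for the pattern of all edges through [e0], whatever
    [r'] is. *)
Lemma match_all (E : finType) (e0 : E) : exists (y : block E),
  forall r', match_at e0 r' y.
Proof.
have [T HT] := uniform_blocks (match_at e0) P_Rand.
have flat (r : pattern E) : exists y : block E,
    (forall i : {ffun 'I_q -> E}, side P1 P0 (r i) (sel y i)) /\ forall r', match_at e0 r' y <-> T r' r.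
  have [x Hx xT] := HT unit (fun v => r [ffun k => (v k).1]).
  exists (btrans x [ffun=> tt]); split=> [i|r'].
    have := Hx [ffun k => (i k, tt)].
    rewrite (_ : [ffun k => _] = i); last by apply/ffunP => k; rewrite !ffunE.
    congr (side _ _ _ _); apply: functional_extensionality_dep => k.
    by rewrite /sel /btrans !ffunE.
  rewrite xT; suff -> : pat (fun v => r [ffun k => (v k).1]) [ffun=> tt] = r by [].
  apply/ffunP => i; rewrite ffunE; congr (r _).
  by apply/ffunP => k; rewrite !ffunE.
have Teq (r' r : pattern E) : (forall i : {ffun 'I_q -> E}, i sg = e0 -> r i = r' i) -> T r' r.
  move=> rr'; have [y [Hy /(_ r') <-]] := flat r.
  exists (y sg e0) => i isg; rewrite -isg.
  rewrite (_ : y sg (i sg) = sel y i sg) // upd_id; split=> //.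
  by rewrite -rr'.
have Tadd (r' r : pattern E) (e : {ffun 'I_q -> E}) : e sg = e0 -> r' e = false -> r e = false ->
    T r' (add e r) = T r' r.
  move=> esg r'e re; apply/eqP/negP => /negP Tne.
  have [|c [b]] := flip dP1 dP0 (match_at_dfn e0 r') _ re Tne.
    by move=> W R; have [x Hx xT] := HT W R; exists x.
  exact: no_flip.
have Tfull (r' : pattern E) : T r' [ffun i : {ffun 'I_q -> E} => i sg == e0].
  suff : forall es : seq {ffun 'I_q -> E},
      T r' [ffun i : {ffun 'I_q -> E} => (i sg == e0) && (r' i || (i \in es))].
    move=> /(_ (enum {ffun 'I_q -> E})).
    rewrite (_ : [ffun i => _] = [ffun i : {ffun 'I_q -> E} => i sg == e0]) //.
    by apply/ffunP => i; rewrite !ffunE mem_enum orbT andbT.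
  elim=> [|e es IH].
    by apply: Teq => i isg; rewrite !ffunE isg eqxx /= in_nil orbF.
  set r1 := [ffun i : {ffun 'I_q -> E} => (i sg == e0) && (r' i || (i \in es))] in IH.
  have [esg|esg] := eqVneq (e sg) e0; last first.
    suff -> : [ffun i : {ffun 'I_q -> E} => (i sg == e0) && (r' i || (i \in e :: es))] = r1 by [].
    apply/ffunP => i; rewrite !ffunE inE.
    by have [->|//] := eqVneq i e; rewrite (negPf esg).
  have -> : [ffun i : {ffun 'I_q -> E} => (i sg == e0) && (r' i || (i \in e :: es))] = add e r1.
    apply/ffunP => i; rewrite !ffunE inE.
    by have [->|//] := eqVneq i e; rewrite esg eqxx /= orbT.
  have [r1e|r1e] := boolP (r1 e).
    suff -> : add e r1 = r1 by [].
    by apply/ffunP => i; rewrite ffunE; have [->|//] := eqVneq i e; rewrite r1e.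
  rewrite Tadd //; last exact: negPf.
  by move: r1e; rewrite ffunE esg eqxx /=; case: (r' e).
have [y [_ Hy]] := flat [ffun i : {ffun 'I_q -> E} => i sg == e0].
by exists y => r'; apply/Hy.
Qed.

(** In a block given by [match_all] every vertex of class [sg] of a pattern on W
    is realized by the replacement point for the pattern of its neighbourhood,
    and the vertex [e0] of the block is the constant. *)
Theorem absorb : exists c : pt,
  Rand (fun x => P1 x /\ f x = f (upd x sg c))
       (fun x => P0 x /\ (strict -> f x = f (upd x sg c))).
Proof.
have cx : cwise (fun g : nat + 'I_q * nat -> Y => (fun l j => g (inr (l, j)))).
  by move=> l j; left; eexists.
have cu : cwise (fun g : nat + 'I_q * nat -> Y =>
    upd (fun l j => g (inr (l, j))) sg (fun j => g (inl j))).
  by move=> l j; left; rewrite /upd; case: (l == sg); eexists.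
have [||//|c Hc] := @Rand_fix kappa Lam S L M M_sat nat_Lam S_Lam Lam_kappa s0 y0 n nat
    (fun c x => P1 x /\ f x = f (upd x sg c))
    (fun c x => P0 x /\ (strict -> f x = f (upd x sg c))); last by exists c.
- apply: (Dfn_and y0); first exact: definable_at.
  exact: dfun_eq_at.
- apply: (Dfn_and y0); first exact: definable_at.
  apply: (Dfn_imp y0); first exact: (Dfn_const s0 y0).
  exact: dfun_eq_at.
move=> W R; have [y Hy] := match_all (None : option W).
have [u Hu] := ex_choice Hy.
(* the edges through w, as a pattern on the edges through [None] *)
pose rw (w : W) : pattern (option W) := [ffun i =>
  [exists v : {ffun 'I_q -> W}, [&& v sg == w, R v
     & i == [ffun l => if l == sg then None else Some (v l)]]]].
exists (y sg None), (fun l w => if l == sg then u (rw w) else y l (Some w)) => v.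
pose i : {ffun 'I_q -> option W} := [ffun l => if l == sg then None else Some (v l)].
have isg : i sg = None by rewrite ffunE eqxx.
have rwv : rw (v sg) i = R v.
  rewrite ffunE; apply/existsP/idP => [[v' /and3P [/eqP v'sg Rv' /eqP /ffunP ii']]|Rv].
    suff -> : v = v' by [].
    apply/ffunP => k; have [->//|ksg] := eqVneq k sg.
    by move: (ii' k); rewrite !ffunE (negPf ksg) => -[].
  by exists v; rewrite !eqxx Rv.
set x := at_edge _ _.
have xE : x = upd (sel y i) sg (u (rw (v sg))).
  apply: functional_extensionality_dep => k; rewrite /x /at_edge /upd /sel.
  by have [->//|ksg] := eqVneq k sg; rewrite ffunE (negPf ksg).
have xcE : upd x sg (y sg None) = sel y i.
  apply: functional_extensionality_dep => k; rewrite xE /upd /sel.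
  by have [->|//] := eqVneq k sg; rewrite isg.
have [] := Hu (rw (v sg)) i isg; rewrite rwv -xE -xcE.
by case: (R v) => /= Px Hf; split=> //; rewrite ?orbT ?orbF in Hf; auto.
Qed.

End Absorb.

End Core.

(** * Fixing the values of functions *)

Section Constants.

Variables (kappa Lam S : Type) (L : language S) (M : structure L).
Hypothesis M_sat : saturated kappa M.
Hypotheses (nat_Lam : embeds nat Lam) (S_Lam : embeds S Lam).
Hypothesis Lam_kappa : card_lt Lam kappa.
Variables (s0 : S) (y0 : Y M) (n : nat).

Local Notation Y := (Y M).
Local Notation q := n.+1.
Local Notation pt := (pt M).
Local Notation point := (point M n).
Local Notation block := (block M n).
Local Notation definable := (@definable S L M n).
Local Notation pattern E := {ffun {ffun 'I_q -> E} -> bool}.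

(** Two hyperedges that differ in one vertex, one an edge and the other not. *)
Lemma Rand_indep (chi : point -> Prop) (sg : 'I_q) :
  (forall x u, chi (upd x sg u) <-> chi x) ->
  ~ Rand chi (fun x => ~ chi x).
Proof.
move=> chi_sg HR; have [x Hx] := HR bool (fun v => v sg).
have /= := Hx [ffun=> true]; rewrite ffunE /= => H1.
have /= := Hx [ffun l => l != sg]; rewrite ffunE eqxx /=; apply.
have -> : at_edge x [ffun l => l != sg] = upd (at_edge x [ffun=> true]) sg (x sg false).
  apply: functional_extensionality_dep => l; rewrite /at_edge /upd !ffunE.
  by have [->|] := eqVneq l sg.
exact/chi_sg.
Qed.

(** By [uniform_blocks] the [a] for which [psi a] holds on an edge can be taken
    the same on all edges: patterns with one vertex in each block record only
    whether the vertices form an edge. *)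
Lemma Rand_or (P1 P0 : point -> Prop) (A : finType) (psi : A -> point -> Prop) :
  (forall x, P1 x -> exists a, psi a x) -> Rand P1 P0 ->
  exists a, Rand (fun x => P1 x /\ psi a x) P0.
Proof.
move=> P1psi HR.
have [T HT] := @uniform_blocks S L M n unit P1 P0 A (fun a y => psi a (fun l => y l tt)) HR.
pose full : pattern unit := [ffun=> true].
have [a Ta] : exists a, T a full.
  have [x Hx xT] := HT unit (fun=> true).
  have [a Ha] := P1psi _ (Hx [ffun=> (tt, tt)]).
  exists a; suff <- : pat (fun=> true) [ffun=> tt] = full.
    apply/xT; move: Ha; congr (psi a _).
    by apply: functional_extensionality_dep => l; rewrite /btrans !ffunE.
  by apply/ffunP => i; rewrite !ffunE.
exists a => W R.
have [x Hx xT] := HT W (fun v => R [ffun k => (v k).2]).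
exists (fun l => x l tt) => v.
have := Hx [ffun k => (tt, v k)].
rewrite (_ : [ffun k => _] = v); last by apply/ffunP => k; rewrite !ffunE.
rewrite (_ : (fun l => _) = at_edge (fun l => x l tt) v); last first.
  by apply: functional_extensionality_dep => k; rewrite ffunE.
case Rv: (R v) => //= Pv; split=> //.
have : psi a (fun l => btrans x [ffun p => v p.1] l tt).
  apply/xT; suff -> : pat (fun v => R [ffun k => (v k).2]) [ffun p => v p.1] = full by [].
  apply/ffunP => i; rewrite !ffunE -[RHS]Rv; congr (R _).
  by apply/ffunP => k; rewrite !ffunE.
congr (psi a _); apply: functional_extensionality_dep => l.
by rewrite /btrans ffunE.
Qed.

Lemma Rand_or0 (P1 P0 : point -> Prop) (A : finType) (psi : A -> point -> Prop) :
  (forall x, P0 x -> exists a, psi a x) -> Rand P1 P0 ->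
  exists a, Rand P1 (fun x => P0 x /\ psi a x).
Proof.
move=> P0psi /Rand_swap /(Rand_or P0psi) [a Ha].
by exists a; apply: Rand_swap.
Qed.

Lemma definable_and (P Q : point -> Prop) : definable P -> definable Q -> definable (fun x => P x /\ Q x).
Proof. exact: Dfn_and. Qed.
Lemma definable_not (P : point -> Prop) : definable P -> definable (fun x => ~ P x).
Proof. exact: Dfn_not. Qed.

Section OneSort.

Variable s : S.

Definition dep (f : point -> M s) (A : {set 'I_q}) : Prop :=
  forall x x' : point, (forall l, l \in A -> x l = x' l) -> f x = f x'.

Definition fixable (f : point -> M s) : Prop :=
  forall P1 P0 : point -> Prop, definable P1 -> definable P0 -> Rand P1 P0 ->
    exists a, Rand (fun x => P1 x /\ f x = a) (fun x => P0 x /\ f x = a).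

Definition fixables (A : {set 'I_q}) : Prop :=
  forall f : point -> M s, dfun f -> dep f A -> fixable f.

Lemma dfun_const (f : point -> M s) (a : M s) : dfun f -> definable (fun x => f x = a).
Proof.
move=> df; apply: (@dfun_const_at S L M y0 n s f _ (fun g l j => g (l, j))) => //.
by move=> l j; left; eexists.
Qed.

Lemma fix_many (I : eqType) (js : seq I) (f : I -> point -> M s) (P1 P0 : point -> Prop) :
  (forall i, i \in js -> dfun (f i) /\ fixable (f i)) ->
  definable P1 -> definable P0 -> Rand P1 P0 ->
  exists a : I -> M s, Rand (fun x => P1 x /\ forall i, i \in js -> f i x = a i)
                            (fun x => P0 x /\ forall i, i \in js -> f i x = a i).
Proof.
elim: js P1 P0 => [|i js IH] P1 P0 Hf dP1 dP0 HR.
  by exists (fun=> y0 s); apply: Rand_weaken HR => x Px; split.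
have [dfi fi] := Hf i (mem_head _ _).
have [a0 H0] := fi P1 P0 dP1 dP0 HR.
have [|||a Ha] := IH _ _ _ _ _ H0.
- by move=> j jjs; apply: Hf; rewrite inE jjs orbT.
- by apply: definable_and => //; apply: dfun_const.
- by apply: definable_and => //; apply: dfun_const.
exists (fun j => if j == i then a0 else a j).
apply: Rand_weaken Ha => x [[Px fix0] Hx]; split=> // j;
  by have [->//|ji] := eqVneq j i; rewrite inE (negPf ji) => /Hx.
Qed.

Lemma cwise_point : cwise (fun (g : 'I_q * nat -> Y) l j => g (l, j)).
Proof. by move=> l j; left; eexists. Qed.

(** The value of [f] on the edge [i] of the block [c] in which the vertices of
    [e] are replaced by the given points.  It depends only on those points that
    lie on [i], hence on fewer of them when [i] differs from [e] where [f] depends. *)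
Definition on_block (E : finType) (f : point -> M s) (c : block E)
    (e i : {ffun 'I_q -> E}) (x : point) : M s := f (sel (ins c e x) i).

Lemma dfun_at (f : point -> M s) (F : point -> point) :
  dfun f -> cwise (fun (g : 'I_q * nat -> Y) => F (fun l j => g (l, j))) ->
  dfun (fun x => f (F x)).
Proof.
move=> df HF; rewrite /dfun.
exact: (drel_at y0 None (dfun_rel df) (cwise_ren Some HF)).
Qed.

Lemma cwise_ins V (E : finType) (c : block E) (e i : {ffun 'I_q -> E}) (F : (V -> Y) -> point) :
  cwise F -> cwise (fun g => sel (ins c e (F g)) i).
Proof.
move=> HF l j; rewrite /sel /ins; case: (i l == e l); first exact: HF.
by right; eexists.
Qed.

Lemma dfun_on_block (E : finType) f (c : block E) (e i : {ffun 'I_q -> E}) :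
  dfun f -> dfun (on_block f c e i).
Proof. by move=> df; apply: dfun_at => //; apply: cwise_ins cwise_point. Qed.

Lemma dep_on_block (E : finType) f (c : block E) (e i : {ffun 'I_q -> E}) (A : {set 'I_q}) :
  dep f A -> dep (on_block f c e i) [set l in A | i l == e l].
Proof.
move=> fA x x' xx'; apply: fA => l lA; rewrite /sel /ins.
by case: eqP => // il; apply: xx'; rewrite inE lA; apply/eqP.
Qed.

(** [match_at] with prescribed values of [f]: the point of class [sg] no longer
    matters for it. *)
Definition match_to (E : finType) (P1 P0 : point -> Prop) (f : point -> M s)
    (sg : 'I_q) (e0 : E) (strict : bool) (r' : pattern E) (c : block E)
    (e : {ffun 'I_q -> E}) (a : {ffun 'I_q -> E} -> M s) (x : point) : Prop :=
  exists u : pt, forall i : {ffun 'I_q -> E}, i sg = e0 ->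
    side P1 P0 (r' i) (upd (sel (ins c e x) i) sg u) /\
    (strict || r' i -> f (upd (sel (ins c e x) i) sg u) = a i).

Lemma match_to_indep (E : finType) P1 P0 f sg (e0 : E) strict r' c e a x u :
  match_to P1 P0 f sg e0 strict r' c e a (upd x sg u) <->
  match_to P1 P0 f sg e0 strict r' c e a x.
Proof.
have E1 i w : upd (sel (ins c e (upd x sg u)) i) sg w = upd (sel (ins c e x) i) sg w.
  apply: functional_extensionality_dep => l; rewrite /upd /sel /ins.
  by have [|] := eqVneq l sg.
by split=> -[w Hw]; exists w => i isg; have := Hw i isg; rewrite E1.
Qed.

Lemma drel_match_to (E : finType) (P1 P0 : point -> Prop) f sg (e0 : E) strict r' c e
   (a : {ffun 'I_q -> E} -> option (M s)) :
  definable P1 -> definable P0 -> dfun f ->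
  drel (fun t x => match_to P1 P0 f sg e0 strict r' c e (fun i => odflt t (a i)) x).
Proof.
move=> dP1 dP0 df; rewrite /drel /match_to.
apply: (@Dfn_ex S L M _ nat (fun g : option ('I_q * nat) + nat -> Y =>
  forall i : {ffun 'I_q -> E}, i sg = e0 ->
    side P1 P0 (r' i) (upd (sel (ins c e (fun l j => g (inl (Some (l, j))))) i) sg (fun j => g (inr j))) /\
    (strict || r' i -> f (upd (sel (ins c e (fun l j => g (inl (Some (l, j))))) i) sg (fun j => g (inr j)))
      = odflt (g (inl None) s) (a i)))).
apply: (Dfn_all s0 y0) => i.
have cu : cwise (fun g : option ('I_q * nat) + nat -> Y =>
    upd (sel (ins c e (fun l j => g (inl (Some (l, j))))) i) sg (fun j => g (inr j))).
  move=> l j; rewrite /upd /sel /ins; case: (l == sg); first by left; eexists.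
  by case: (i l == e l); [left|right]; eexists.
apply: (Dfn_imp y0); first exact: (Dfn_const s0 y0).
apply: (Dfn_and y0).
  by case: (r' i); apply: (definable_at y0).
apply: (Dfn_imp y0); first exact: (Dfn_const s0 y0).
case: (a i) => [t|] /=; first exact: (dfun_const_at y0).
exact: (drel_at y0 (inl None) (dfun_rel df) cu).
Qed.

Lemma Rand_sides (P1 P0 Q : point -> Prop) (b : bool) :
  Rand (fun x => P1 x /\ (Q x <-> b)) (fun x => P0 x /\ (Q x <-> ~~ b)) ->
  Rand Q (fun x => ~ Q x).
Proof.
case: b => /= HR.
  by apply: Rand_weaken HR => x [_ Qx]; rewrite Qx.
by apply: Rand_swap; apply: Rand_weaken HR => x [_ Qx]; rewrite Qx.
Qed.

(** Suppose that a block predicate [match_at] flips.  The values of [f] on the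
    other edges of the block are functions of fewer points, and get fixed by
    induction; then the predicate is one of the value of [f] and of the points
    other than [sg], which the last hypothesis excludes.  So [absorb] replaces the
    point [sg] by a constant inside [f], which then depends on fewer points. *)
Theorem fixable_step (A : {set 'I_q}) (sg : 'I_q) (f : point -> M s) :
  sg \in A -> (forall A' : {set 'I_q}, A' \proper A -> fixables A') ->
  dfun f -> dep f A ->
  (forall chi : M s -> point -> Prop, drel chi ->
     (forall t x u, chi t (upd x sg u) <-> chi t x) ->
     ~ Rand (fun x => chi (f x) x) (fun x => ~ chi (f x) x)) ->
  fixable f.
Proof.
move=> sgA IH df fA C1 P1 P0 dP1 dP0 HR.
have [|c Hc] := @absorb kappa Lam S L M M_sat nat_Lam S_Lam Lam_kappa s0 y0 n s P1 P0 f sg true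
   dP1 dP0 df _ HR.
  move=> E e0 r' e c b esg r'e.
  set Q1 := (fun x => P1 x /\ _); set Q0 := (fun x => P0 x /\ _) => HQ.
  pose top (i : {ffun 'I_q -> E}) := [forall l in A, i l == e l].
  have topE i x : top i -> f (sel (ins c e x) i) = f x.
    move=> /forall_inP ti; apply: fA => l /ti il.
    by rewrite /sel /ins il.
  have dm : definable (fun x => match_at P1 P0 f sg true e0 r' (ins c e x)).
    apply: (@Dfn_subst S L M y0 _ _ (fun g : 'I_q * E * nat -> Y =>
       match_at P1 P0 f sg true e0 r' (fun l e j => g (l, e, j)))
       (fun g p => ins c e (fun l j => g (l, j)) p.1.1 p.1.2 p.2)) (match_at_dfn s0 y0 sg true dP1 dP0 df e0 r').
    move=> [[l a] j]; rewrite /ins /=; case: (a == e l); [left|right]; eexists; reflexivity.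
  have dQ1 : definable Q1 by apply: definable_and => //; apply: (Dfn_equiv y0) => //; exact: (Dfn_const s0 y0).
  have dQ0 : definable Q0 by apply: definable_and => //; apply: (Dfn_equiv y0) => //; exact: (Dfn_const s0 y0).
  have [|a Ha] := @fix_many _ [seq i <- enum {ffun 'I_q -> E} | ~~ top i]
     (on_block f c e) Q1 Q0 _ dQ1 dQ0 HQ.
    move=> i; rewrite mem_filter => /andP [nti _]; split; first exact: dfun_on_block.
    apply: (IH [set l in A | i l == e l]) => //; last exact: dep_on_block.
      2: exact: dfun_on_block.
    rewrite properE; apply/andP; split; first by apply/subsetP => l; rewrite inE => /andP [].
    apply: contra nti => /subsetP sub; apply/forall_inP => l /sub.
    by rewrite inE => /andP [].
  pose chi t x := match_to P1 P0 f sg e0 true r' c e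
    (fun i => odflt t (if top i then None else Some (a i))) x.
  apply: (C1 chi).
  - exact: drel_match_to.
  - by move=> t x u; apply: match_to_indep.
  apply: (@Rand_sides P1 P0 _ b).
  have chiE x : (forall i, i \in [seq i <- enum {ffun 'I_q -> E} | ~~ top i] -> on_block f c e i x = a i) ->
      chi (f x) x <-> match_at P1 P0 f sg true e0 r' (ins c e x).
    move=> Hx; have vE i : odflt (f x) (if top i then None else Some (a i)) = f (sel (ins c e x) i).
      case: ifP => ti /=; first by rewrite topE.
      by rewrite -Hx // mem_filter ti mem_enum.
    by split=> -[u Hu]; exists u => i isg; have := Hu i isg; rewrite vE.
  by apply: Rand_weaken Ha => x [[Px Hx] /chiE xE]; split=> //; rewrite xE.
have [||||a Ha] := IH (A :\ sg) (properD1 sgA) (fun x => f (upd x sg c)) _ _ _ _ _ _ Hc.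
- by apply: dfun_at => //; apply: cwise_upd cwise_point.
- move=> x x' xx'; apply: fA => l lA; rewrite /upd.
  by have [//|lsg] := eqVneq l sg; apply: xx'; rewrite !inE lsg.
- apply: definable_and => //; apply: (dfun_eq_at y0) => //; first exact: cwise_point.
  exact: cwise_upd cwise_point.
- apply: definable_and => //; apply: (Dfn_imp y0); first exact: (Dfn_const s0 y0).
  apply: (dfun_eq_at y0) => //; first exact: cwise_point.
  exact: cwise_upd cwise_point.
exists a; apply: Rand_weaken Ha => x [[Px fx] <-]; split=> //; exact: fx.
Qed.

(** As for [fixable_step], but the values of [f] on the non-edges are not
    prescribed.  The edge that flips is not in the pattern [r'], so that the value of
    [f] on it does not enter in the predicate; this ignores the point [sg] once
    the other values are fixed, and [Rand_indep] applies. *)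
Theorem fix_edges (f : point -> M s) (P1 P0 : point -> Prop) :
  (forall A : {set 'I_q}, A != setT -> fixables A) -> dfun f ->
  definable P1 -> definable P0 -> Rand P1 P0 -> exists a, Rand (fun x => P1 x /\ f x = a) P0.
Proof.
move=> IH df dP1 dP0 HR; pose sg : 'I_q := ord0.
have fT : dep f setT.
  move=> x x' xx'; congr (f _); apply: functional_extensionality_dep => l.
  by apply: xx'; rewrite inE.
have [|c Hc] := @absorb kappa Lam S L M M_sat nat_Lam S_Lam Lam_kappa s0 y0 n s P1 P0 f sg false
   dP1 dP0 df _ HR.
  move=> E e0 r' e c b esg r'e.
  set Q1 := (fun x => P1 x /\ _); set Q0 := (fun x => P0 x /\ _) => HQ.
  have dm : definable (fun x => match_at P1 P0 f sg false e0 r' (ins c e x)).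
    apply: (@Dfn_subst S L M y0 _ _ (fun g : 'I_q * E * nat -> Y =>
       match_at P1 P0 f sg false e0 r' (fun l e j => g (l, e, j)))
       (fun g p => ins c e (fun l j => g (l, j)) p.1.1 p.1.2 p.2)) (match_at_dfn s0 y0 sg false dP1 dP0 df e0 r').
    move=> [[l a] j]; rewrite /ins /=; case: (a == e l); [left|right]; eexists; reflexivity.
  have dQ1 : definable Q1 by apply: definable_and => //; apply: (Dfn_equiv y0) => //; exact: (Dfn_const s0 y0).
  have dQ0 : definable Q0 by apply: definable_and => //; apply: (Dfn_equiv y0) => //; exact: (Dfn_const s0 y0).
  have [|a Ha] := @fix_many _ [seq i <- enum {ffun 'I_q -> E} | i != e]
     (on_block f c e) Q1 Q0 _ dQ1 dQ0 HQ.
    move=> i; rewrite mem_filter => /andP [ie _]; split; first exact: dfun_on_block.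
    apply: (IH [set l in setT | i l == e l]) => //; last exact: dep_on_block.
      2: exact: dfun_on_block.
    apply: contra ie => /eqP iT; apply/eqP/ffunP => l.
    by move/setP/(_ l): iT; rewrite !inE => /eqP.
  pose chi x := match_to P1 P0 f sg e0 false r' c e a x.
  apply: (@Rand_indep chi sg); first by move=> x u; apply: match_to_indep.
  apply: (@Rand_sides P1 P0 _ b).
  have chiE x : (forall i, i \in [seq i <- enum {ffun 'I_q -> E} | i != e] -> on_block f c e i x = a i) ->
      chi x <-> match_at P1 P0 f sg false e0 r' (ins c e x).
    move=> Hx; have vE i : r' i -> a i = f (sel (ins c e x) i).
      move=> r'i; rewrite -Hx // mem_filter mem_enum andbT.
      by apply: contraTneq r'i => ->; rewrite r'e.
    by split=> -[u Hu]; exists u => i isg; have [Pi fi] := Hu i isg; split=> //= r'i;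
      rewrite (fi r'i) vE.
  by apply: Rand_weaken Ha => x [[Px Hx] /chiE xE]; split=> //; rewrite xE.
have [|||||a Ha] := IH (~: [set sg]) _ (fun x => f (upd x sg c)) _ _ _ _ _ _ Hc.
- by apply/eqP => /setP /(_ sg); rewrite !inE eqxx.
- by apply: dfun_at => //; apply: cwise_upd cwise_point.
- move=> x x' xx'; apply: fT => l lA; rewrite /upd.
  by have [//|lsg] := eqVneq l sg; apply: xx'; rewrite !inE lsg.
- apply: definable_and => //; apply: (dfun_eq_at y0) => //; first exact: cwise_point.
  exact: cwise_upd cwise_point.
- apply: definable_and => //; apply: (Dfn_imp y0); first exact: (Dfn_const s0 y0).
  apply: (dfun_eq_at y0) => //; first exact: cwise_point.
  exact: cwise_upd cwise_point.
exists a; apply: Rand_weaken Ha => x [[Px fx] fa] //; split=> //; by rewrite fx.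
Qed.

End OneSort.
End Constants.

(** * Random predicates and the independence property *)

Section Independence.

Variables (kappa Lam S : Type) (L : language S) (M : structure L).
Hypothesis M_sat : saturated kappa M.
Hypotheses (nat_Lam : embeds nat Lam) (S_Lam : embeds S Lam).
Hypothesis Lam_kappa : card_lt Lam kappa.
Variables (s0 : S) (y0 : Y M) (n : nat).

Local Notation Y := (Y M).
Local Notation dfn := (@dfn S L M).
Local Notation q := n.+1.
Local Notation pt := (pt M).
Local Notation point := (point M n).
Local Notation definable := (@definable S L M n).

(** The pattern of the array is the disjoint union of all finite patterns, so that
    a pair of predicates which fits it on some array is random. *)
Lemma universal_array (P1 P0 : point -> Prop) : definable P1 -> definable P0 -> Rand P1 P0 ->
  exists (I : countType) (R : {ffun 'I_q -> I} -> bool) (x : 'I_q -> I -> pt),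
    fits P1 P0 R x /\
    forall (Q1 Q0 : point -> Prop) y, fits Q1 Q0 R y -> Rand Q1 Q0.
Proof.
move=> dP1 dP0 HR.
pose I : countType := {d : nat & ({ffun {ffun 'I_q -> 'I_d} -> bool} * 'I_d)%type}.
pose vtx d (R : {ffun {ffun 'I_q -> 'I_d} -> bool}) (w : 'I_d) : I :=
  Tagged (fun d => ({ffun {ffun 'I_q -> 'I_d} -> bool} * 'I_d)%type) (R, w).
pose R (v : {ffun 'I_q -> I}) : bool :=
  [exists u : {ffun 'I_q -> 'I_(tag (v ord0))},
    (v == [ffun l => vtx _ (tagged (v ord0)).1 (u l)]) && (tagged (v ord0)).1 u].
have RE d (R0 : {ffun {ffun 'I_q -> 'I_d} -> bool}) (u : {ffun 'I_q -> 'I_d}) :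
    R [ffun l => vtx d R0 (u l)] = R0 u.
  rewrite /R; set v := [ffun l => _].
  have v0 : v ord0 = vtx d R0 (u ord0) by rewrite ffunE.
  rewrite v0 /=; apply/existsP/idP => [[u' /andP [/eqP vu' Ru']]|Ru].
    suff -> : u = u' by [].
    apply/ffunP => l; move/ffunP/(_ l): vu'; rewrite !ffunE => vv.
    by have := f_equal snd (existT_inj (vv : Tagged _ _ = Tagged _ _)).
  by exists u; rewrite Ru andbT.
have [x Hx] := inf_array M_sat nat_Lam S_Lam Lam_kappa y0 dP1 dP0 HR R.
exists I, R, x; split=> // Q1 Q0 y Hy W RW.
pose d := #|W|.
pose R0 := [ffun u : {ffun 'I_q -> 'I_d} => RW [ffun l => enum_val (u l)]].
exists (fun l w => y l (vtx d R0 (enum_rank w))) => v.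
have := Hy [ffun l => vtx d R0 ([ffun k => enum_rank (v k)] l)].
rewrite RE ffunE.
have -> : [ffun l => enum_val ([ffun k => enum_rank (v k)] l)] = v.
  by apply/ffunP => l; rewrite !ffunE enum_rankK.
by congr (side _ _ _ _); apply: functional_extensionality_dep => l; rewrite /at_edge !ffunE.
Qed.

Definition comb (sg : 'I_q) (u : pt) (y : 'I_n -> pt) : point :=
  fun l => if unlift sg l is Some k then y k else u.

Lemma comb_lift sg u y k : comb sg u y (lift sg k) = y k.
Proof. by rewrite /comb liftK. Qed.
Lemma comb_self sg u y : comb sg u y sg = u.
Proof. by rewrite /comb unlift_none. Qed.

(** In the pattern the vertices of the n other groups are the natural numbers, and
    those of the group [sg] are the subsets of the finite boxes {0, ..., D - 1}^n;
    arbitrary subsets follow by saturation. *)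
Theorem Rand_IP (P : point -> Prop) (sg : 'I_q) : definable P -> Rand P (fun x => ~ P x) ->
  exists (a : 'I_n -> nat -> pt) (b : ({ffun 'I_n -> nat} -> Prop) -> pt),
    forall J (i : {ffun 'I_n -> nat}), P (comb sg (b J) (fun k => a k (i k))) <-> J i.
Proof.
move=> dP HR.
pose I : countType := (nat + {D : nat & {ffun {ffun 'I_n -> 'I_D} -> bool}})%type.
pose R (v : {ffun 'I_q -> I}) : bool := if v sg is inr (existT D J) then
  [exists i : {ffun 'I_n -> 'I_D}, [forall k, v (lift sg k) == inl (val (i k))] && J i]
  else false.
have dnP := definable_not dP.
have [x Hx] := inf_array M_sat nat_Lam S_Lam Lam_kappa y0 dP dnP HR R.
pose a (k : 'I_n) (i : nat) : pt := x (lift sg k) (inl i).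
have fin D (J : {ffun {ffun 'I_n -> 'I_D} -> bool}) : exists u : pt,
    forall i : {ffun 'I_n -> 'I_D}, P (comb sg u (fun k => a k (i k))) <-> J i.
  exists (x sg (inr (existT _ D J))) => i.
  pose v : {ffun 'I_q -> I} := [ffun l => if unlift sg l is Some k
     then inl (val (i k)) else inr (existT _ D J)].
  have vsg : v sg = inr (existT _ D J) by rewrite ffunE unlift_none.
  have vl k : v (lift sg k) = inl (val (i k)) by rewrite ffunE liftK.
  have Rv : R v = J i.
    rewrite /R vsg; apply/existsP/idP => [[i' /andP [/forallP ii' Ji']]|Ji].
      suff -> : i = i' by [].
      by apply/ffunP => k; apply: val_inj; move: (ii' k); rewrite vl => /eqP [].
    by exists i; rewrite Ji andbT; apply/forallP => k; rewrite vl.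
  have := Hx v; rewrite Rv.
  have -> : at_edge x v = comb sg (x sg (inr (existT _ D J))) (fun k => a k (i k)).
    apply: functional_extensionality_dep => l; rewrite /at_edge /comb.
    by case: unliftP => [k ->|->]; rewrite ?vl ?vsg.
  by case: (J i).
exists a.
suff /ex_choice [b Hb] : forall J : {ffun 'I_n -> nat} -> Prop, exists u : pt,
  forall i : {ffun 'I_n -> nat}, P (comb sg u (fun k => a k (i k))) <-> J i by exists b.
move=> J; have [b dPb] := dP.
pose c := sumf b (fun p : 'I_n * nat * nat => a p.1.1 p.1.2 p.2).
pose F (Q : (nat -> Y) -> Prop) := exists i : {ffun 'I_n -> nat}, Q = fun g =>
  if `[< J i >] then P (comb sg g (fun k => a k (i k))) else ~ P (comb sg g (fun k => a k (i k))).
have [|Q [i ->]|l lF|u Hu] := @saturated_dfn kappa S L M M_sat y0 _ nat c F.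
- apply: embeds_lt Lam_kappa; apply: embeds_sum => //; apply: embeds_prod => //.
  by apply: embeds_option => //; apply: embeds_count.
- have dPi : dfn c (fun g : nat -> Y => P (comb sg g (fun k => a k (i k)))).
    have dPc : dfn c (fun g : 'I_q * nat -> Y => P (fun l j => g (l, j))).
      by apply: (dfn_params (r := inl)) dPb.
    pose rho (p : 'I_q * nat) : nat + (nat + 'I_n * nat * nat) :=
      if unlift sg p.1 is Some k then inr (inr (k, i k, p.2)) else inl p.2.
    apply: dfn_iff (dfn_sub rho dPc) => g.
    suff -> : (fun l j => sumf g c (rho (l, j))) = comb sg g (fun k => a k (i k)) by [].
    apply: functional_extensionality_dep => l; apply: functional_extensionality_dep => j.
    by rewrite /rho /comb /=; case: (unlift sg l).
  by case: `[< J i >] => //; apply: dfn_not.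
- have [D HD] : exists D, forall Q, List.In Q l -> exists2 i : {ffun 'I_n -> 'I_D},
      true & Q = fun g => if `[< J [ffun k => val (i k)] >]
        then P (comb sg g (fun k => a k (i k))) else ~ P (comb sg g (fun k => a k (i k))).
    suff [D HD] : exists D, forall Q, List.In Q l -> exists2 i : {ffun 'I_n -> nat},
        forall k, i k < D & Q = fun g => if `[< J i >]
        then P (comb sg g (fun k => a k (i k))) else ~ P (comb sg g (fun k => a k (i k))).
      exists D => Q /HD [i iD ->]; exists [ffun k => Ordinal (iD k)] => //.
      rewrite (_ : [ffun k => _] = i); last by apply/ffunP => k; rewrite !ffunE.
      rewrite (_ : (fun k => a k ([ffun k0 => Ordinal (iD k0)] k)) = (fun k => a k (i k))) //.
      by apply: functional_extensionality_dep => k; rewrite ffunE.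
    elim: l lF => [|Q l IH] lF; first by exists 0.
    have [D HD] := IH (fun Q' Q'l => lF Q' (or_intror Q'l)).
    have [i Qi] := lF Q (or_introl erefl).
    exists (maxn D (\max_k (i k)).+1) => Q' [<-|/HD [i' i'D ->]].
      by exists i => // k; rewrite leq_max ltnS leq_bigmax orbT.
    by exists i' => // k; rewrite leq_max i'D.
  have [u Hu] := fin D [ffun i : {ffun 'I_n -> 'I_D} => `[< J [ffun k => val (i k)] >]].
  exists u => Q /HD [i _ ->]; have := Hu i; rewrite ffunE.
  by case: `[< J _ >] => ->.
exists u => i; have := Hu _ (ex_intro _ i erefl).
by case: asboolP.
Qed.

(** Renaming of variables; those that do not occur in [phi] only need to be sent
    to some variable of their sort. *)
Lemma retarget (U V : Type) (su : U -> S) (sv : V -> S) (phi : formula L su)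
    (Z : Type) (e : Z -> forall u, M (su u)) (e' : Z -> forall v, M (sv v)) :
  (forall u, exists v (pf : sv v = su u), List.In u (fvars phi) ->
     forall z, eq_rect _ M (e' z v) _ pf = e z u) ->
  exists phi' : formula L sv, forall z, sat (e' z) phi' <-> sat (e z) phi.
Proof.
move=> H; have {}H u : {v | exists pf : sv v = su u, List.In u (fvars phi) ->
     forall z, eq_rect _ M (e' z v) _ pf = e z u} := cid (H u).
pose f u := sval (H u).
have pf u : sv (f u) = su u by have [pf _] := svalP (H u).
exists (fren pf phi) => z; rewrite sat_fren; apply sat_supp => u uphi.
rewrite /envr; have [pf' Hpf'] := svalP (H u).
by rewrite -(Hpf' uphi z) (Prop_irrelevance (pf u) pf').
Qed.

Variable Ss : seq S.
Hypothesis Ss_all : forall s, List.In s Ss.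

(** All sorts at the first [m] positions of a point: the finite context of the
    variables that stand for it in formulas of the form phi(x; y_1, ..., y_n). *)
Definition coords (m : nat) : seq (nat * S) :=
  flatten [seq [seq (j, s) | s <- Ss] | j <- iota 0 m].

Definition cctx (m : nat) : ctx S :=
  @Ctx S (size (coords m)) (fun i => (nth (0, s0) (coords m) i).2).

Definition ctup (m : nat) (x : pt) : tup M (cctx m) :=
  fun i => x (nth (0, s0) (coords m) i).1 (nth (0, s0) (coords m) i).2.
Arguments ctup : clear implicits.

Lemma coordsP (m j : nat) (s : S) : j < m ->
  exists (i : 'I_(len (cctx m))) (pf : @srt _ (cctx m) i = s),
    forall x, eq_rect _ M (ctup m x i) _ pf = x j s.
Proof.
move=> jm.
have : List.In (j, s) (coords m).
  apply: (@In_flatten _ _ (fun j => [seq (j, s) | s <- Ss]) (iota 0 m) j).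
    by rewrite mem_iota.
  by move: (Ss_all s); elim: Ss => //= s' l IH [->|/IH]; [left|right].
move=> /(@List.In_nth _ _ _ (0, s0)) [i [/ltP im ij]].
have {}im : i < size (coords m) by [].
have {}ij : nth (0, s0) (coords m) i = (j, s).
  rewrite -ij; elim: (coords m) i {im ij} => [|c l IH] [|i] //=.
exists (Ordinal im), (f_equal snd ij) => x; rewrite /ctup /=.
by move: (f_equal snd ij); rewrite ij => p; rewrite (Prop_irrelevance p erefl).
Qed.

(** The interleaving of two streams. *)
Definition leave (x c : pt) : pt := fun j => if odd j then c j./2 else x j./2.

Lemma leave_even x c j : leave x c j.*2 = x j.
Proof. by rewrite /leave odd_double doubleK. Qed.
Lemma leave_odd x c j : leave x c j.*2.+1 = c j.
Proof. by rewrite /leave /= odd_double /= uphalf_double. Qed.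

Hypothesis n_gt0 : 0 < n.

(** The parameters of [P], and the irrelevant values [y0], are interleaved with
    the points of the groups, so that [P] becomes an instance of a formula
    phi(x; y_1, ..., y_n).  The group [sg] is restricted to coordinates that are
    among [x] or constant. *)
Lemma to_pformula (P : point -> Prop) (sg : 'I_q) : definable P ->
  exists (m : nat) (c : pt), forall (xs : ctx S) (Z : Type) (e : Z -> tup M xs) (x0 : Z -> pt),
    (forall j s, j < m -> (exists (i : 'I_(len xs)) (pf : srt i = s),
         forall z, eq_rect _ M (e z i) _ pf = x0 z j s) \/
       forall z, x0 z j s = y0 s) ->
    exists phi : pformula L xs (fun _ : 'I_n => cctx m),
      forall z (x : 'I_n -> pt), P (comb sg (x0 z) x) <->
        psat phi (e z) (fun k => ctup m (leave (x k) c)).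
Proof.
move=> [b [phi Hphi]].
pose ix (u : option ('I_q * nat + nat) * S) : nat :=
  match u.1 with Some (inl p) => p.2.*2 | Some (inr i) => i.+1.*2.+1 | None => 1 end.
have [m m1 Hm] : exists2 m, 1 < m & forall u, List.In u (fvars phi) -> ix u < m.
  elim: (fvars phi) => [|u l [m m1 IH]]; first by exists 2.
  exists (maxn m (ix u).+1); first by rewrite leq_max m1.
  by move=> v [<-|/IH vm]; rewrite leq_max ?ltnSn ?orbT // vm.
pose c : pt := fun i => if i is i'.+1 then b i' else y0.
exists m, c => xs Z e x0 Hx.
pose gz (z : Z * ('I_n -> pt)) (p : 'I_q * nat) := comb sg (x0 z.1) z.2 p.1 p.2.
pose ee (z : Z * ('I_n -> pt)) (u : option ('I_q * nat + nat) * S) : M u.2 :=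
  optf (sumf (gz z) b) y0 u.1 u.2.
pose ee' (z : Z * ('I_n -> pt)) := penv (e z.1) (fun k => ctup m (leave (z.2 k) c)).
have grp k j s : j < m -> exists v (pf : @psrt S n xs (fun _ => cctx m) v = s),
    forall z, eq_rect _ M (ee' z v) _ pf = leave (z.2 k) c j s.
  move=> jm; have [i [pf Hi]] := coordsP s jm.
  by exists (inr (existT _ k i)), pf => z; rewrite -Hi.
pose k0 := Ordinal n_gt0.
have junk s : exists v (pf : @psrt S n xs (fun _ => cctx m) v = s),
    forall z, eq_rect _ M (ee' z v) _ pf = y0 s.
  have [v [pf Hv]] := grp k0 1 s m1; exists v, pf => z; rewrite Hv.
  by rewrite (leave_odd _ _ 0).
have [u|phi' Hphi'] := @retarget _ _ _ (@psrt S n xs (fun _ => cctx m)) phi _ ee ee'; last first.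
  exists phi' => z x.
  by rewrite /psat -[penv _ _]/(ee' (z, x)) Hphi' (Hphi (gz (z, x)) y0).
have [uphi|nphi] := EM (List.In u (fvars phi)); last first.
  by have [v [pf _]] := junk u.2; exists v, pf.
move: (Hm u uphi) => {uphi}; case: u => [[[[l j]|i]|] s]; rewrite /ix /= => um.
- case E: (unlift sg l) => [k|].
    have [v [pf Hv]] := grp k j.*2 s um.
    by exists v, pf => _ z; rewrite Hv leave_even /ee /gz /= /comb E.
  have jm : j < m by apply: leq_ltn_trans um; rewrite -addnn leq_addr.
  case: (Hx j s jm) => [[i [pf Hi]]|Hy].
    by exists (inl i), pf => _ z; rewrite /ee /gz /= /comb E -Hi.
  by have [v [pf Hv]] := junk s; exists v, pf => _ z; rewrite Hv /ee /gz /= /comb E Hy.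
- have [v [pf Hv]] := grp k0 i.+1.*2.+1 s um.
  by exists v, pf => _ z; rewrite Hv leave_odd.
- by have [v [pf Hv]] := junk s; exists v, pf => _ z; rewrite Hv.
Qed.

End Independence.

(** * Sorts that are stably embedded *)

Section Coordinates.

Variables (kappa Lam S : Type) (L : language S) (M : structure L).
Hypothesis M_sat : saturated kappa M.
Hypotheses (nat_Lam : embeds nat Lam) (S_Lam : embeds S Lam).
Hypothesis Lam_kappa : card_lt Lam kappa.
Variables (s0 : S) (y0 : Y M) (n : nat).

Local Notation Y := (Y M).
Local Notation Dfn := (@Dfn S L M).
Local Notation q := n.+1.
Local Notation pt := (pt M).
Local Notation point := (point M n).
Local Notation definable := (@definable S L M n).

(** No predicate that depends on one of the points through a single element of
    sort [s] is random against its negation.  This is the hypothesis of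
    [fixable_step] for the function that returns this element. *)
Definition coord_free (s : S) : Prop :=
  forall (sg : 'I_q) (j : nat) (chi : M s -> point -> Prop), drel chi ->
    (forall t x u, chi t (upd x sg u) <-> chi t x) ->
    ~ Rand (fun x => chi (x sg j s) x) (fun x => ~ chi (x sg j s) x).

Lemma dfun_coord (sg : 'I_q) (j : nat) (s : S) : dfun (fun x : point => x sg j s).
Proof. exact: Dfn_eq y0 _ _ _ _. Qed.

Lemma fixables0 (s : S) : @fixables S L M n s set0.
Proof.
move=> f df f0 P1 P0 dP1 dP0 HR; exists (f (fun _ _ => y0)).
have fE x : f x = f (fun _ _ => y0) by apply: f0 => l; rewrite inE.
by apply: Rand_weaken HR => x Px; split.
Qed.

Lemma fixable_coord (s : S) sg j : coord_free s -> fixable (fun x : point => x sg j s).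
Proof.
move=> Hs; apply: (fixable_step M_sat nat_Lam S_Lam Lam_kappa s0 y0 (set11 sg)).
- move=> A /properP [/subsetP As [l]]; rewrite inE => /eqP -> nA.
  suff -> : A = set0 by apply: fixables0.
  apply/setP => k; rewrite inE; apply/negP => kA; move: (As k kA) nA.
  by rewrite inE => /eqP <-; rewrite kA.
- exact: dfun_coord.
- by move=> x x' ->; rewrite ?set11.
- exact: Hs.
Qed.

Lemma finite_support (P : point -> Prop) : definable P ->
  exists m, forall x x' : point, (forall l j, j < m -> x l j = x' l j) -> P x <-> P x'.
Proof.
move=> [b [phi Hphi]].
pose ix (u : option ('I_q * nat + nat) * S) : nat :=
  match u.1 with Some (inl p) => p.2 | _ => 0 end.
have [m Hm] : exists m, forall u, List.In u (fvars phi) -> ix u < m.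
  elim: (fvars phi) => [|u l [m IH]]; first by exists 0.
  exists (maxn m (ix u).+1).
  by move=> v [<-|/IH vm]; rewrite leq_max ?ltnSn ?orbT // vm.
exists m => x x' xx'.
rewrite (Hphi (fun p => x p.1 p.2) y0) (Hphi (fun p => x' p.1 p.2) y0).
by apply: sat_supp => -[[[[l j]|i]|] s] //= /Hm /=; rewrite /ix /= => /xx' ->.
Qed.

(** The finitely many elements of sort [s] on which [P] depends in the group [sg]
    are fixed one at a time, and then [P] ignores this group. *)
Theorem one_sort_not_Rand (s : S) (P : point -> Prop) (sg : 'I_q) : coord_free s -> definable P ->
  (forall x u, (forall j, u j s = x sg j s) -> P (upd x sg u) <-> P x) ->
  ~ Rand P (fun x => ~ P x).
Proof.
move=> Hs dP Ps HR; have [m Hm] := finite_support dP.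
have [i _||//||a Ha] := @fix_many S L M y0 n s _ (iota 0 m) (fun j x => x sg j s) P (fun x => ~ P x).
- by split; [apply: dfun_coord | apply: fixable_coord].
- by [].
- exact: definable_not.
- by [].
apply: (@Rand_indep S L M n (fun x => P (upd x sg (fun j => put y0 (a j)))) sg).
  move=> x u; suff -> : upd (upd x sg u) sg (fun j => put y0 (a j)) =
     upd x sg (fun j => put y0 (a j)) by [].
  by apply: functional_extensionality_dep => l; rewrite /upd; case: eqP.
have key x : (forall i, i \in iota 0 m -> x sg i s = a i) ->
    P (upd x sg (fun j => put y0 (a j))) <-> P x.
  move=> xa; pose u j := if j < m then put y0 (a j) else x sg j.
  rewrite -(Ps x u); last first.
    move=> j; rewrite /u; case: ifP => // jm.
    by rewrite putE -xa // mem_iota.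
  apply: Hm => l j jm; rewrite /upd /u.
  by case: (l == sg); rewrite // jm.
by apply: Rand_weaken Ha => x [Px /key]; tauto.
Qed.

Section Embedded.

Variables (s : S) (L' : language unit) (N : interp L' (fun _ : unit => M s)).
Hypothesis N_def : definable_structure N.

Lemma Dfn_fun V (f : Defs.fsym L') (r : 'I_(len (fdom f)) -> V) (v : V) :
  Dfn (fun g : V -> Y => fint N (f := f) (fun i => g (r i) s) = g v s).
Proof.
have [phi Hphi] := N_def.1 f.
have := Dfn_sat y0 phi (fun i => if i is Some i then r i else v).
apply: Dfn_iff => g; rewrite Hphi; apply: sat_ext.
by case.
Qed.

Lemma Dfn_rel V (f : rsym L') (r : 'I_(len (rdom f)) -> V) :
  Dfn (fun g : V -> Y => rint N (r := f) (fun i => g (r i) s)).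
Proof.
have [phi Hphi] := N_def.2 f.
by have := Dfn_sat y0 phi r; apply: Dfn_iff => g; rewrite Hphi.
Qed.

Local Notation neval := (@eval _ L' (Structure N) _ _).

Lemma Dfn_terms V (I : finType) (sv : V -> unit) (si : I -> unit)
    (ts : forall i, term L' sv (si i)) (P : (I -> M s) -> (V -> Y) -> Prop) :
  (forall i, Dfn (fun g : option V -> Y => neval (fun v => g (Some v) s) (ts i) = g None s)) ->
  Dfn (fun g : V + I -> Y => P (fun i => g (inr i) s) (fun v => g (inl v))) ->
  Dfn (fun g : V -> Y => P (fun i => neval (fun v => g v s) (ts i)) g).
Proof.
move=> dts dP.
apply: (@Dfn_iff _ _ _ _ (fun g : V -> Y => exists h : I -> Y,
  (forall i, neval (fun v => g v s) (ts i) = h i s) /\ P (fun i => h i s) g)).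
  move=> g; split=> [[h [hi]]|Pg].
    suff -> : (fun i => neval (fun v => g v s) (ts i)) = (fun i => h i s) by [].
    exact: functional_extensionality_dep.
  exists (fun i => put y0 (neval (fun v => g v s) (ts i) : M s)); split=> [i|].
    by rewrite putE.
  suff -> : (fun i => put y0 (neval (fun v => g v s) (ts i) : M s) s) =
    fun i => neval (fun v => g v s) (ts i) by [].
  by apply: functional_extensionality_dep => i; rewrite putE.
apply: (@Dfn_ex S L M V I (fun g => (forall i, neval (fun v => g (inl v) s) (ts i) = g (inr i) s)
  /\ P (fun i => g (inr i) s) (fun v => g (inl v)))).
apply: (Dfn_and y0) => //; apply: (Dfn_all s0 y0) => i.
exact: (Dfn_ren (fun v => if v is Some v then inl v else inr i) (dts i)).
Qed.

Lemma Dfn_eval V (sv : V -> unit) u (t : term L' sv u) :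
  Dfn (fun g : option V -> Y => neval (fun v => g (Some v) s) t = g None s).
Proof.
elim: t => [v|f ts IH] /=; first exact: (Dfn_eq y0 (Some v) None s).
apply: (@Dfn_iff _ _ _ _ (fun g : option V -> Y => exists h : 'I_(len (fdom f)) -> Y,
  (forall i, neval (fun v => g (Some v) s) (ts i) = h i s) /\
  fint N (f := f) (fun i => h i s) = g None s)).
  move=> g; split=> [[h [hi]]|Pg].
    suff -> : (fun i => neval (fun v => g (Some v) s) (ts i)) = (fun i => h i s) by [].
    exact: functional_extensionality_dep.
  exists (fun i => put y0 (neval (fun v => g (Some v) s) (ts i) : M s)); split=> [i|].
    by rewrite putE.
  suff -> : (fun i => put y0 (neval (fun v => g (Some v) s) (ts i) : M s) s) =
    fun i => neval (fun v => g (Some v) s) (ts i) by [].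
  by apply: functional_extensionality_dep => i; rewrite putE.
apply: (@Dfn_ex S L M _ _ (fun g => (forall i, neval (fun v => g (inl (Some v)) s) (ts i) = g (inr i) s)
  /\ fint N (f := f) (fun i => g (inr i) s) = g (inl None) s)).
apply: (Dfn_and y0); last exact: Dfn_fun.
apply: (Dfn_all s0 y0) => i.
exact: (Dfn_ren (fun v => if v is Some v then inl (Some v) else inr i) (IH i)).
Qed.

Theorem Dfn_transl V (sv : V -> unit) (psi : formula L' sv) :
  Dfn (fun g : V -> Y => @sat _ L' (Structure N) V sv (fun v => g v s) psi).
Proof.
elim: psi => {V sv} [V sv u t t'|V sv r ts|V sv psi IH|V sv psi IH psi' IH'|V sv u psi IH] /=.
- apply: (@Dfn_iff _ _ _ _ (fun g : V -> Y => exists y : M s,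
    neval (fun v => g v s) t = y /\ neval (fun v => g v s) t' = y)).
    by move=> g; split=> [[y [-> ->]]//|tt']; eexists.
  by apply: (Dfn_exs y0); apply: (Dfn_and y0); apply: Dfn_eval.
- apply: (Dfn_terms (P := fun h g => rint N (r := r) h)).
    by move=> i; apply: Dfn_eval.
  exact: Dfn_rel.
- exact: Dfn_not.
- exact: Dfn_and.
apply: (Dfn_exs y0); apply: Dfn_iff IH => g.
by apply: sat_ext; case.
Qed.

Variable Ss : seq S.
Hypothesis Ss_all : forall s, List.In s Ss.
Hypothesis n_gt0 : 0 < n.
Hypothesis N_SE : hanced_stably_embedded kappa n N.

(** (SE)_n for an array of points: the relation [chi] between elements of the
    sort and rows of the array is defined by a formula of the sort, with
    parameters indexed as the points of the array are. *)
Lemma SE_array (sg : 'I_q) (chi : M s -> point -> Prop) (I : countType)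
    (x : 'I_q -> I -> pt) : drel chi ->
  (forall t x u, chi t (upd x sg u) <-> chi t x) ->
  exists (zs : 'I_n -> ctx unit) (psi : pformula L' (ctx1 tt) zs)
      (b : forall k : 'I_n, I -> tup (Structure N) (zs k)),
    forall (t : M s) (v : {ffun 'I_q -> I}),
      chi t (at_edge x v) <->
      psat psi (@tup1 _ (Structure N) tt t) (fun k => b k (v (lift sg k))).
Proof.
move=> dchi chisg.
have dP : definable (fun x => chi (x sg 0 s) x) by apply: (drel_fun y0) => //; apply: dfun_coord.
have [m [c Hmc]] := to_pformula s0 y0 Ss_all n_gt0 sg dP.
have [j u jm|phi Hphi] := Hmc (ctx1 s) (M s) (fun t => @tup1 _ M s t)
  (fun t j => if j == 0 then put y0 t else y0).
  have [_|_] := eqVneq j 0; last by right.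
  have [su|su] := EM (s = u).
    left; exists ord0, su => t; rewrite /put; case: pselect => // e.
    by rewrite (Prop_irrelevance e su).
  by right=> t; rewrite /put; case: pselect.
have IK : card_lt I kappa by apply: embeds_lt Lam_kappa; apply: embeds_count.
have [zs [psi [b Hb]]] := N_SE phi
  (fun k i => ctup (leave (x (lift sg k) i) c)) IK.
exists zs, psi, b => t v.
rewrite -(Hb (fun k => v (lift sg k))).
rewrite -(Hphi t (fun k => x (lift sg k) (v (lift sg k)))) comb_self /= putE.
rewrite -[X in _ <-> chi t X](upd_id _ sg) comb_self.
set u := fun j => _; rewrite -(chisg t (at_edge x v) u).
suff -> : upd (at_edge x v) sg u =
   upd (comb sg u (fun k => x (lift sg k) (v (lift sg k)))) sg u by [].
apply: functional_extensionality_dep => l; rewrite /upd /at_edge /comb.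
by case: unliftP => [k ->|->]; rewrite ?eqxx.
Qed.

Definition pad (m : nat) (b : 'I_m -> M s) : pt :=
  fun j => if insub j is Some i then put y0 (b i) else y0.

Lemma padE m (b : 'I_m -> M s) (i : 'I_m) : pad b i s = b i.
Proof. by rewrite /pad valK putE. Qed.

Hypothesis N_NIP : theory_NIP n (Structure N).

(** On a universal array [SE_array] turns [chi] into a formula of the sort, random
    by universality, against NIP_n of the sort. *)
Theorem coord_free_embedded : coord_free s.
Proof.
move=> sg j0 chi dchi chisg HR.
have dP : definable (fun x => chi (x sg j0 s) x) by apply: (drel_fun y0) => //; apply: dfun_coord.
have [I [R [x [Hx univ]]]] :=
  universal_array M_sat nat_Lam S_Lam Lam_kappa y0 dP (definable_not dP) HR.
have [zs [psi [b Hb]]] := SE_array x dchi chisg.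
pose Q (z : point) := @psat _ L' (Structure N) _ _ _ psi
  (@tup1 _ (Structure N) tt (z sg 0 s)) (fun k j => z (lift sg k) j s).
pose y (l : 'I_q) (i : I) : pt := if unlift sg l is Some k then pad (b k i)
   else fun j => put y0 (x sg i j0 s).
have {univ} HQ : Rand Q (fun z => ~ Q z).
  apply: (univ _ _ y) => v; have := Hx v.
  have QE : Q (at_edge y v) <-> chi (at_edge x v sg j0 s) (at_edge x v).
    rewrite Hb /Q /at_edge /y unlift_none putE.
    apply: sat_ext => -[i|[k i]] //=.
    by rewrite liftK padE.
  by case: (R v) => /=; rewrite QE.
have nIP : ~ has_IP (Structure N) psi := @N_NIP (ctx1 tt) zs psi.
apply: nIP.
have dQ : definable Q.
  have := Dfn_ren (fun v : 'I_1 + {k & 'I_(len (zs k))} => match v return 'I_q * nat with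
     inl _ => (sg, 0) | inr ki => (lift sg (tag ki), val (tagged ki)) end) (Dfn_transl psi).
  by apply: Dfn_iff => g; apply: sat_ext => -[i|[k i]].
have [a [b' Hab]] := Rand_IP M_sat nat_Lam S_Lam Lam_kappa y0 sg dQ HQ.
exists (fun k i j => a k i j s), (fun J => @tup1 _ (Structure N) tt (b' J 0 s)) => J i.
rewrite -Hab /Q comb_self; apply: sat_ext => -[j|[k j]] //=.
by rewrite comb_lift.
Qed.

(** The hypothesis of [fixable_step] holds by [SE_array]: the new parameters are
    appended to the points.  As [f] ignores the point [l0], the resulting predicate
    depends on it through elements of the sort only, and [one_sort_not_Rand]
    applies. *)
Lemma fixables_embedded (A : {set 'I_q}) : A != setT -> @fixables S L M n s A.
Proof.
have [m] := ubnP #|A|; elim: m A => // m IH A Am AT f df fA.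
have [A0|[sg sgA]] := set_0Vmem A.
  by apply: fixables0 => //; rewrite -A0.
have [l0 l0A] : exists l0, l0 \notin A.
  apply/existsP; apply: contraNT AT; rewrite negb_exists => /forallP H.
  by apply/eqP/setP => l; rewrite inE; have := H l; rewrite negbK.
apply: (fixable_step M_sat nat_Lam S_Lam Lam_kappa s0 y0 sgA) => // [A' A'A|chi dchi chisg HR].
  apply: IH; first by apply: leq_trans (proper_card A'A) _; rewrite -ltnS.
  by apply: contraTneq A'A => ->; rewrite properE subTset negb_and AT.
have dP : definable (fun x => chi (f x) x) by apply: (drel_fun y0).
have [I [R [x [Hx univ]]]] :=
  universal_array M_sat nat_Lam S_Lam Lam_kappa y0 dP (definable_not dP) HR.
have [zs [psi [b Hb]]] := SE_array x dchi chisg.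
(* the old points are at even positions, the new parameters at odd ones *)
pose evens (z : point) : point := fun l j => z l j.*2.
pose psi' t (z : point) := @psat _ L' (Structure N) _ _ _ psi
  (@tup1 _ (Structure N) tt t) (fun k j => z (lift sg k) j.*2.+1 s).
pose Q (z : point) := psi' (f (evens z)) z.
pose y (l : 'I_q) (i : I) : pt :=
  leave (x l i) (if unlift sg l is Some k then pad (b k i) else fun=> y0).
have {univ} HQ : Rand Q (fun z => ~ Q z).
  apply: (univ _ _ y) => v; have := Hx v.
  have QE : Q (at_edge y v) <-> chi (f (at_edge x v)) (at_edge x v).
    rewrite Hb /Q.
    have -> : evens (at_edge y v) = at_edge x v.
      apply: functional_extensionality_dep => l; apply: functional_extensionality_dep => j.
      by rewrite /evens /at_edge /y leave_even.
    apply: sat_ext => -[i|[k i]] //=.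
    by rewrite /at_edge /y leave_odd liftK padE.
  by case: (R v) => /=; rewrite QE.
have dQ : definable Q.
  apply: (drel_fun y0); last first.
    by apply: (dfun_at y0) => // l j; left; eexists.
  have := Dfn_ren (fun v : 'I_1 + {k & 'I_(len (zs k))} => match v return option ('I_q * nat) with
     inl _ => None | inr ki => Some (lift sg (tag ki), (val (tagged ki)).*2.+1) end) (Dfn_transl psi).
  by apply: Dfn_iff => g; apply: sat_ext => -[i|[k i]].
apply: (one_sort_not_Rand (sg := l0) coord_free_embedded dQ _ HQ) => z u us.
have -> : Q (upd z l0 u) = psi' (f (evens z)) (upd z l0 u).
  congr psi'; apply: fA => l lA; rewrite /evens /upd.
  by have [ll0|//] := eqVneq l l0; rewrite -ll0 lA in l0A.
apply: sat_ext => -[i|[k i]] //=.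
by rewrite /upd; case: eqP => [->|//].
Qed.

End Embedded.
End Coordinates.

(** * Codes of formulas *)

Lemma map_inj_in (I : eqType) (T : Type) (f g : I -> T) (l : seq I) :
  [seq f i | i <- l] = [seq g i | i <- l] -> forall i, i \in l -> f i = g i.
Proof.
elim: l => //= j l IH [fg /IH H] i; rewrite inE => /orP [/eqP ->//|]; exact: H.
Qed.

(** Formulas are coded by trees with leaves in a small type, injectively up to
    logical equivalence, so that there are few definable sets without
    parameters. *)

Section Encode.

Variables (S Lam : Type) (L : language S) (M : structure L).
Variables (eS : S -> Lam) (ef : Defs.fsym L -> Lam) (er : rsym L -> Lam).
Hypotheses (eSi : injective eS) (efi : injective ef) (eri : injective er).
Local Notation T := (GenTree.tree Lam).
Local Notation Node := (@GenTree.Node Lam).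
Local Notation Leaf := (@GenTree.Leaf Lam).

Fixpoint tenc (V : Type) (sv : V -> S) (nu : V -> T) (s : S) (t : term L sv s) : T :=
  match t with
  | Var v => Node 0 [:: nu v]
  | App f ts => Node 1 (Leaf (ef f) :: [seq tenc nu (ts i) | i <- enum 'I_(len (fdom f))])
  end.

Definition shift (V : Type) (nu : V -> T) (v : option V) : T :=
  if v is Some w then Node 1 [:: nu w] else Node 0 [::].

Fixpoint fenc (V : Type) (sv : V -> S) (nu : V -> T) (phi : formula L sv) : T :=
  match phi with
  | FEq _ t u => Node 0 [:: tenc nu t; tenc nu u]
  | FRel r ts => Node 1 (Leaf (er r) :: [seq tenc nu (ts i) | i <- enum 'I_(len (rdom r))])
  | FNot phi => Node 2 [:: fenc nu phi]
  | FAnd phi psi => Node 3 [:: fenc nu phi; fenc nu psi]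
  | FEx s phi => Node 4 [:: Leaf (eS s); fenc (shift nu) phi]
  end.

Lemma tenc_inj (V : Type) (sv : V -> S) (nu : V -> T) (e : forall v, M (sv v)) s
    (t : term L sv s) s' (t' : term L sv s') : injective nu ->
  tenc nu t = tenc nu t' -> existT M s (eval e t) = existT M s' (eval e t').
Proof.
move=> nui; elim: t s' t' => [v|f ts IH] s' [v'|f' ts'] //=; first by case=> /nui ->.
case=> /efi ff; subst f' => tt; congr existT; congr (fint _).
apply: functional_extensionality_dep => i; apply: (@existT_inj _ M).
by apply: IH; apply: (map_inj_in tt); rewrite mem_enum.
Qed.

Lemma shift_inj (V : Type) (nu : V -> T) : injective nu -> injective (shift nu).
Proof. by move=> nui [v|] [w|] //= [/nui ->]. Qed.

Theorem fenc_inj (V : Type) (sv : V -> S) (nu : V -> T) (phi phi' : formula L sv) :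
  injective nu -> fenc nu phi = fenc nu phi' ->
  forall e : forall v, M (sv v), sat e phi <-> sat e phi'.
Proof.
move=> nui; elim: phi nu nui phi' => {V sv}
  [V sv s t u|V sv r ts|V sv phi IH|V sv phi IH psi IH'|V sv s phi IH] nu nui
  [s' t' u'|r' ts'|phi'|phi' psi'|s' phi'] //=.
- case=> tt' uu' e.
  have Ht := tenc_inj e nui tt'; have Hu := tenc_inj e nui uu'.
  have ss : s = s' by exact: projT1_eq Ht.
  by subst s'; rewrite (existT_inj Ht) (existT_inj Hu).
- case=> /eri rr; subst r' => tt e.
  suff -> : (fun i => eval e (ts i)) = (fun i => eval e (ts' i)) by [].
  apply: functional_extensionality_dep => i; apply: (@existT_inj _ M).
  by apply: (tenc_inj _ nui); apply: (map_inj_in tt); rewrite mem_enum.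
- by case=> /(IH nu nui) H e; rewrite H.
- by case=> /(IH nu nui) H /(IH' nu nui) H' e; rewrite H H'.
case=> /eSi ss; subst s' => /(IH _ (shift_inj nui)) H e.
by split=> -[x Hx]; exists x; apply/H.
Qed.

End Encode.

Section Codes.

Variables (S Lam : Type) (L : language S) (M : structure L).
Variable s0 : S.
Hypotheses (S_Lam : embeds S Lam) (f_Lam : embeds (Defs.fsym L) Lam) (r_Lam : embeds (rsym L) Lam).
Local Notation Y := (Y M).
Local Notation T := (GenTree.tree Lam).

Definition def0 V (P : (V -> Y) -> Prop) : Prop := @dfn S L M void (of_void Y) V P.

Lemma def0_formula (P : (nat -> Y) -> Prop) : def0 P ->
  exists phi : formula L (fun v : nat * S => v.2), forall u, P u <-> ysat u phi.
Proof.
move=> [phi Hphi].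
pose f (v : option (nat + void) * S) : nat * S :=
  (if v.1 is Some (inl i) then i else 0, v.2).
exists (fren (f := f) (sv' := fun v : nat * S => v.2) (fun=> erefl) phi) => u.
rewrite (Hphi u (u 0)) /ysat sat_fren; apply: sat_ext.
by case=> -[[i|[]]|] s.
Qed.

(** Trees that do not code a formula decode to the empty set. *)
Lemma codes : exists dec : T -> (nat -> Y) -> Prop,
  (forall c, def0 (dec c)) /\
  forall phi : formula L (fun v : nat * S => v.2), exists c, forall u,
    dec c u <-> ysat u phi.
Proof.
have [eS eSi] := S_Lam; have [ef efi] := f_Lam; have [er eri] := r_Lam.
pose nu (v : nat * S) : T := GenTree.Node v.1 [:: GenTree.Leaf (eS v.2)].
have nui : injective nu by move=> [i s] [j s'] [/= -> /eSi ->].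
pose enc (phi : formula L (fun v : nat * S => v.2)) : T := fenc eS ef er nu phi.
exists (fun c u => exists phi, enc phi = c /\ ysat u phi).
have E phi u : (exists phi', enc phi' = enc phi /\ ysat u phi') <-> ysat u phi.
  split=> [[phi' [pp]]|]; last by exists phi.
  by apply (fenc_inj eSi efi eri nui pp).
split=> [c|phi]; last by exists (enc phi) => u; apply: E.
have [[phi <-]|nc] := EM (exists phi, enc phi = c); last first.
  apply: (dfn_iff (P := fun=> False)); last exact: dfn_const.
  by move=> u; split=> // -[phi [pc _]]; case: nc; exists phi.
pose f (v : nat * S) : option (nat + void) * S := (Some (inl v.1), v.2).
exists (fren (f := f) (sv' := fun v : option (nat + void) * S => v.2) (fun=> erefl) phi) => u d.
by rewrite E /ysat sat_fren; apply: sat_ext => -[].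
Qed.

End Codes.

(** * Elementary substructures *)

Section TarskiVaught.

Variables (kappa S : Type) (L : language S) (M : structure L).
Variable K : forall s, M s -> Prop.
Hypothesis K_TV : forall (V : Type) (sv : V -> S) (e : forall v, M (sv v)) s
    (phi : formula L (osrt s sv)),
  (forall v, K (e v)) -> (exists x, sat (oenv x e) phi) ->
  exists x, K x /\ sat (oenv x e) phi.

Lemma closed_fint (f : Defs.fsym L) (x : tup (fun s => {x : M s | K x}) (fdom f)) :
  K (fint (itp M) (fun i => sval (x i))).
Proof.
pose sv := @srt _ (fdom f).
pose phi : formula L (osrt (fcod f) sv) :=
  FEq (Var L (osrt (fcod f) sv) None)
    (App (fun i => Var L (osrt (fcod f) sv) (Some i))).
have [|y [Ky /= <- //]] := @K_TV _ sv (fun i => sval (x i)) _ phi (fun i => svalP (x i)).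
by exists (fint (itp M) (fun i => sval (x i))).
Qed.

Definition submodel : structure L :=
  Structure (@Interp S L (fun s => {x : M s | K x})
    (fun f x => exist _ _ (closed_fint x))
    (fun r x => rint (itp M) (fun i => sval (x i)))).

Lemma eval_submodel V (sv : V -> S) (e : forall v, submodel (sv v)) s (t : term L sv s) :
  sval (eval e t) = eval (M := M) (fun v => sval (e v)) t.
Proof.
elim: t => //= f ts IH; congr (fint _).
by apply: functional_extensionality_dep => i; apply: IH.
Qed.

Lemma sat_submodel V (sv : V -> S) (phi : formula L sv) (e : forall v, submodel (sv v)) :
  sat e phi <-> sat (M := M) (fun v => sval (e v)) phi.
Proof.
elim: phi e => {V sv} [V sv s t u|V sv r ts|V sv phi IH|V sv phi IH psi IH'|V sv s phi IH] e /=.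
- rewrite -!eval_submodel; split=> [->//|]; exact: eq_sig_hprop.
- suff -> : (fun i => eval (fun v => sval (e v)) (ts i)) = (fun i => sval (eval e (ts i))) by [].
  by apply: functional_extensionality_dep => i; rewrite eval_submodel.
- by rewrite IH.
- by rewrite IH IH'.
have E (x : submodel s) : sat (oenv x e) phi <->
    sat (M := M) (oenv (sval x) (fun v => sval (e v))) phi.
  by rewrite IH; apply: sat_ext => -[].
split=> [[x /E Hx]|/(K_TV (fun v => svalP (e v))) [x [Kx Hx]]]; first by exists (sval x).
by exists (exist _ x Kx); apply/E.
Qed.

Theorem small_submodel : card_lt {s : S & {x : M s | K x}} kappa -> small_model kappa K.
Proof.
move=> K_small; split=> //; exists submodel, (fun s x => sval x); split.
  by move=> V sv e phi; apply: sat_submodel.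
by move=> s x; split=> [Kx|[y <-]]; [exists (exist _ x Kx) | exact: svalP].
Qed.

End TarskiVaught.

(** * Names and the random realization *)

Section Quantifiers.
Variables (S : Type) (L : language S) (M : structure L) (s0 : S).
Local Notation Y := (Y M).
Variables (B : Type) (b : B -> Y).

Lemma dfn_exY V (P : Y -> (V -> Y) -> Prop) :
  dfn b (fun g : option V -> Y => P (g None) (fun v => g (Some v))) ->
  dfn b (fun g => exists y, P y g).
Proof.
move=> dP.
pose rho (v : option V) : V + unit := if v is Some a then inl a else inr tt.
apply: dfn_iff (dfn_ex (dfn_ren rho dP)) => g; split=> [[h Ph]|[y Py]].
  by exists (h tt).
by exists (fun=> y).
Qed.

Lemma dfn_allY V (P : Y -> (V -> Y) -> Prop) :
  dfn b (fun g : option V -> Y => P (g None) (fun v => g (Some v))) ->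
  dfn b (fun g => forall y, P y g).
Proof.
move=> dP; apply: (@dfn_iff _ _ _ _ _ _ (fun g => ~ exists y, ~ P y g)).
  by move=> g; split=> [nP y|Pg [y]]; [apply: contrapT => nPy; apply: nP; exists y | apply].
by apply: dfn_not; apply: dfn_exY; apply: dfn_not.
Qed.

Lemma dfn_equiv V (P Q : (V -> Y) -> Prop) :
  dfn b P -> dfn b Q -> dfn b (fun g => P g <-> Q g).
Proof. by move=> dP dQ; apply: dfn_and; apply: dfn_imp. Qed.

Lemma dfn_eq V (v w : V) (s : S) : dfn b (fun g : V -> Y => g v s = g w s).
Proof.
have := dfn_sat b (FEq (Var L (fun=> s) true) (Var L (fun=> s) false))
  (fun c => if c then inl v else inl w).
by apply: dfn_iff.
Qed.

Lemma dfn_vars (V U : Type) (sv : U -> S) (phi : formula L sv) (rho : U -> V) :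
  dfn b (fun g : V -> Y => sat (fun u => g (rho u) (sv u)) phi).
Proof. exact: (dfn_sat b phi (fun u => inl (rho u))). Qed.

Lemma dfn_In V (I : Type) (l : seq I) (P : I -> (V -> Y) -> Prop) :
  (forall i, List.In i l -> dfn b (P i)) ->
  dfn b (fun g => forall i, List.In i l -> P i g).
Proof.
elim: l => [|i l IH] dP; first by apply: dfn_iff (dfn_const s0 b V True).
have dl : dfn b (fun g => forall i, List.In i l -> P i g).
  by apply: IH => j jl; apply: dP; right.
apply: dfn_iff (dfn_and (dP i (or_introl erefl)) dl) => g.
split=> [[Pi Pl] j [<-//|/Pl//]|H].
by split=> [|j jl]; apply: H; [left|right].
Qed.

End Quantifiers.

Section Names.

Variables (kappa Lam S : Type) (L : language S) (M : structure L).
Hypothesis M_sat : saturated kappa M.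
Hypotheses (nat_Lam : embeds nat Lam) (S_Lam : embeds S Lam).
Hypothesis Lam_kappa : card_lt Lam kappa.
Variables (s0 : S) (y0 : Y M) (n : nat).

Local Notation Y := (Y M).
Local Notation def0 := (@def0 S L M).
Local Notation q := n.+1.
Local Notation pt := (pt M).
Local Notation point := (point M n).
Local Notation definable := (@definable S L M n).
Local Notation T := (GenTree.tree Lam).

Variables (dec : T -> pt -> Prop) (t : S) (sg : 'I_q).
Hypothesis dec_def : forall c, def0 (dec c).
Hypothesis fixed : forall s, s <> t -> forall A : {set 'I_q}, A != setT ->
  @fixables S L M n s A.

(** Terms for streams: the q points themselves, Henkin witnesses in the group [i]
    for the set coded by [c] over the stream [a], constants of sort [s] for
    the element defined by [c] over [a], and interleavings. *)
Inductive name :=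
| Base (i : 'I_q)
| Wit (i : 'I_q) (c : T) (a : name)
| Cst (s : S) (c : T) (a : name)
| Pair (a b : name).

(** The names whose value depends on the point [i] alone, or on no point. *)
Fixpoint hull (i : 'I_q) (nu : name) : bool :=
  match nu with
  | Base i' => i == i'
  | Wit i' _ _ => i == i'
  | Cst _ _ _ => true
  | Pair a b => hull i a && hull i b
  end.

(** Interleavings are computed and not interpreted: [path] gives the name and the
    position where a coordinate of the stream is to be found. *)
Fixpoint path (nu : name) (j : nat) : name * nat :=
  if nu is Pair a b then if odd j then path b j./2 else path a j./2 else (nu, j).

Definition value (g : name * nat -> Y) (nu : name) : pt := fun j => g (path nu j).

Lemma value_pair g a b : value g (Pair a b) = leave (value g a) (value g b).
Proof.
apply: functional_extensionality_dep => j; rewrite /value /leave /=.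
by case: (odd j).
Qed.

Lemma hull_path i nu j : hull i nu -> hull i (path nu j).1.
Proof.
elim: nu j => [i'|i' c a _|s c a _|a IHa b IHb] //= j /andP [ia ib].
by case: (odd j); [apply: IHb | apply: IHa].
Qed.

(** The set coded by [c] over [u] is the singleton of the element of [z] of sort [s]. *)
Definition unique_at (c : T) (s : S) (z : Y) (u : pt) : Prop :=
  forall y : Y, dec c (leave (fun=> y) u) <-> y s = z s.

(** What a name is meant to satisfy.  A witness has to exist only over streams of
    its own group.  Constants are required in the sorts other than [t] only, but over
    any stream, including those that involve all the points. *)
Definition obeys (nu : name) (g : name * nat -> Y) : Prop :=
  match nu with
  | Base _ | Pair _ _ => True
  | Wit i c a => hull i a -> (exists h, dec c (leave h (value g a))) ->
      dec c (leave (value g nu) (value g a))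
  | Cst s c a => s <> t -> (exists z, unique_at c s z (value g a)) ->
      dec c (leave (fun=> value g nu 0) (value g a))
  end.

Lemma dec_at c V (r1 r2 : nat -> V) :
  def0 (fun g : V -> Y => dec c (leave (fun j => g (r1 j)) (fun j => g (r2 j)))).
Proof.
have := dfn_ren (fun j => if odd j then r2 j./2 else r1 j./2) (dec_def c).
apply: dfn_iff => g.
suff -> : (fun v => g (if odd v then r2 v./2 else r1 v./2)) =
  leave (fun j => g (r1 j)) (fun j => g (r2 j)) by [].
by apply: functional_extensionality_dep => j; rewrite /leave; case: (odd j).
Qed.

Lemma unique_def c s V (vz : V) (r : nat -> V) :
  def0 (fun g : V -> Y => unique_at c s (g vz) (fun j => g (r j))).
Proof.
apply: dfn_allY; apply: dfn_equiv; last exact: dfn_eq.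
exact: (dec_at c (fun=> None) (fun j => Some (r j))).
Qed.

Lemma unique_ex_def c s V (r : nat -> V) :
  def0 (fun g : V -> Y => exists z, unique_at c s z (fun j => g (r j))).
Proof.
apply: dfn_exY; exact: (unique_def c s None (fun j => Some (r j))).
Qed.

Lemma obeys_def nu : def0 (obeys nu).
Proof.
case: nu => [i|i c a|s c a|a b] /=; try exact: (dfn_const s0).
  apply: dfn_imp; first exact: dfn_const.
  apply: dfn_imp; last exact: (dec_at c (path (Wit i c a)) (path a)).
  have := dfn_ex (dec_at c (fun j => inr j : name * nat + nat) (fun j => inl (path a j))).
  exact: dfn_iff.
apply: dfn_imp; first exact: dfn_const.
apply: dfn_imp; first exact: unique_ex_def.
exact: (dec_at c (fun=> path (Cst s c a) 0) (path a)).
Qed.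

(** A formula phi(x; y_1, ..., y_n) with x of sort [t], and names for the values of
    the parameters. *)
Record clause := Clause {
  cys : 'I_n -> ctx S;
  cphi : pformula L (ctx1 t) cys;
  carg : forall k, 'I_(len (cys k)) -> name * nat }.

Definition cval (d : clause) (g : name * nat -> Y) : forall k, tup M (cys d k) :=
  fun k i => value g (carg i).1 (carg i).2 (srt i).
Arguments cval : clear implicits.
Definition csat (d : clause) (y : Y) (g : name * nat -> Y) : Prop :=
  psat (cphi d) (tup1 (y t)) (cval d g).

Definition over_groups (d : clause) : Prop :=
  forall k (i : 'I_(len (cys d k))), hull (lift sg k) (carg i).1.

Definition allowed (d : clause) : Prop := formula_NIP M (cphi d) /\ over_groups d.

Lemma csat_def d V (v : V) (r : name * nat -> V) :
  def0 (fun g : V -> Y => csat d (g v) (fun u => g (r u))).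
Proof.
have := dfn_vars (of_void Y) (cphi d) (fun u : 'I_1 + {k & 'I_(len (cys d k))} =>
  match u with inl _ => v | inr ki => r (path (carg (tagged ki)).1 (carg (tagged ki)).2) end).
by apply: dfn_iff => g; apply: sat_ext => -[i|[k i]].
Qed.

Variable d0 : clause.

Definition point_value (g : name * nat -> Y) : Y := value g (Base sg) 0.
Definition target (g : name * nat -> Y) : Prop := csat d0 (point_value g) g.

Lemma target_def : def0 target.
Proof. exact: (csat_def d0 (path (Base sg) 0) id). Qed.

Definition implied (ds : seq clause) (g : name * nat -> Y) : Prop :=
  forall y, (forall d, List.In d ds -> csat d y g) -> csat d0 y g.

Definition witness (ds : seq clause) (g : name * nat -> Y) : Prop :=
  (forall d, List.In d ds -> csat d (point_value g) g) /\ implied ds g.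

Lemma witness_def ds : def0 (witness ds).
Proof.
apply: dfn_and.
  by apply: dfn_In => // d _; exact: (csat_def d (path (Base sg) 0) id).
apply: dfn_allY; apply: dfn_imp; last exact: (csat_def d0 None Some).
by apply: dfn_In => // d _; exact: (csat_def d None Some).
Qed.

(** An interpretation of the names in terms of q points, which respects the
    groups. *)
Definition group_local (G : point -> name * nat -> Y) : Prop := forall w : name * nat,
  (exists i j, (forall x, G x w = x i j) /\ forall i', hull i' w.1 -> i = i') \/
  (exists y, forall x, G x w = y).

Lemma local_value G i nu x : group_local G -> hull i nu -> value (G x) nu = value (G (fun=> x i)) nu.
Proof.
move=> GL inu; apply: functional_extensionality_dep => j; rewrite /value.
case: (GL (path nu j)) => [[i' [j' [Gx Hi]]]|[y Gy]]; last by rewrite !Gy.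
by rewrite !Gx (Hi i (hull_path j inu)).
Qed.

Lemma local_point_value G x : group_local G -> point_value (G x) = point_value (G (fun=> x sg)).
Proof. by move=> GL; rewrite /point_value -(local_value x GL (eqxx sg : hull sg (Base sg))). Qed.

Lemma local_cval G d x : group_local G -> over_groups d ->
  cval d (G x) = fun k i => value (G (fun=> x (lift sg k))) (carg i).1 (carg i).2 (srt i).
Proof.
move=> GL dg; apply: functional_extensionality_dep => k.
apply: functional_extensionality_dep => i.
by rewrite /cval (local_value x GL (dg k i)).
Qed.

Lemma definable_value (Q : (name * nat -> Y) -> Prop) G : def0 Q -> group_local G -> definable (fun x => Q (G x)).
Proof.
move=> dQ GL.
apply: (Dfn_subst y0 (F := fun (g : 'I_q * nat -> Y) w => G (fun l j => g (l, j)) w)).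
  by move=> w; case: (GL w) => [[i [j [Gx _]]]|[y Gy]]; [left; exists (i, j) | right; exists y].
by apply: (dfn_Dfn y0) dQ.
Qed.

Theorem clause_NIP G d : group_local G -> allowed d ->
  ~ Rand (fun x => csat d (point_value (G x)) (G x)) (fun x => ~ csat d (point_value (G x)) (G x)).
Proof.
move=> GL [dNIP dg] HR; apply: dNIP.
have dP : definable (fun x => csat d (point_value (G x)) (G x)) :=
  definable_value (csat_def d (path (Base sg) 0) id) GL.
have [a [b Hab]] := Rand_IP M_sat nat_Lam S_Lam Lam_kappa y0 sg dP HR.
exists (fun k i j => value (G (fun=> a k i)) (carg j).1 (carg j).2 (srt j)),
  (fun J => tup1 (point_value (G (fun=> b J)) t)) => J i.
rewrite -Hab /csat (local_cval _ GL dg) (local_point_value (comb _ _ _) GL) comb_self.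
suff -> : (fun k i0 => value (G (fun=> comb sg (b J) (fun k0 => a k0 (i k0)) (lift sg k))) (carg i0).1
    (carg i0).2 (srt i0)) = (fun k (j : 'I_(len (cys d k))) =>
      value (G (fun=> a k (i k))) (carg j).1 (carg j).2 (srt j)) by [].
by apply: functional_extensionality_dep => k; rewrite comb_lift.
Qed.

(** If the clauses [ds] are true on the edges and imply [d0] there, then on a
    non-edge, where [d0] fails, some clause of [ds] fails too: implication does not
    involve the point [sg], and an additional point of this group that forms edges
    with all the others shows that implication holds on non-edges as well.  Hence
    the conjunction of [ds], and by [Rand_or0] a single clause, is random. *)
Theorem no_witness G ds (A : point -> Prop) : group_local G -> over_groups d0 ->
  (forall d, List.In d ds -> allowed d) ->
  ~ Rand (fun x => A x /\ witness ds (G x)) (fun x => ~ target (G x)).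
Proof.
move=> GL d0g dsa HR.
have HQ : Rand (fun x => forall d, List.In d ds -> csat d (point_value (G x)) (G x))
    (fun x => ~ forall d, List.In d ds -> csat d (point_value (G x)) (G x)).
  move=> W R.
  (* [None] is the additional point of the group [sg] *)
  pose R' (v : {ffun 'I_q -> option W}) := if v sg is None then true else
    [exists u : {ffun 'I_q -> W}, (v == [ffun l => Some (u l)]) && R u].
  have [x Hx] := HR (option W) R'.
  exists (fun l w => x l (Some w)) => v.
  set xv := at_edge _ v.
  have xvE : xv = at_edge x [ffun l => Some (v l)].
    by apply: functional_extensionality_dep => l; rewrite /xv /at_edge ffunE.
  have R'v : R' [ffun l => Some (v l)] = R v.
    rewrite /R' ffunE; apply/existsP/idP => [[u /andP [/eqP uv Ru]]|Rv]; last by exists v; rewrite eqxx.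
    suff -> : v = u by [].
    by apply/ffunP => l; move/ffunP/(_ l): uv; rewrite !ffunE => -[].
  pose v0 : {ffun 'I_q -> option W} := [ffun l => if l == sg then None else Some (v l)].
  have R'v0 : R' v0 by rewrite /R' ffunE eqxx.
  have cE d : over_groups d -> cval d (G (at_edge x v0)) = cval d (G xv).
    move=> dg; rewrite !local_cval //; apply: functional_extensionality_dep => k.
    by rewrite /xv /at_edge ffunE eq_sym (negPf (neq_lift sg k)).
  have := Hx v0; rewrite R'v0 /= => -[_ [_ imp]].
  have := Hx [ffun l => Some (v l)]; rewrite R'v -xvE.
  case: (R v) => /=; first by case=> _ [].
  move=> nP all_d; apply: nP.
  have := imp (point_value (G xv)); rewrite /csat (cE _ d0g); apply=> d dds.
  have := all_d d dds; rewrite /csat cE //; exact: (dsa d dds).2.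
have [|i Hi] := @Rand_or0 S L M n _ _ 'I_(size ds)
    (fun i x => ~ csat (nth d0 ds i) (point_value (G x)) (G x)) _ HQ.
  move=> x nall; apply: contrapT => nex; apply: nall => d dds.
  have [i [/ltP ids id]] := List.In_nth _ d d0 dds.
  apply: contrapT => nd; apply: nex; exists (Ordinal (ids : i < size ds)) => /=.
  by rewrite (_ : nth d0 ds i = d) // -id; elim: (ds) (i) => [|? ? IH] [|?] /=.
have ids : List.In (nth d0 ds i) ds.
  case: i {Hi} => i /=; elim: (ds) i => [|d l IH] [|i] //= ids; first by left.
  by right; apply: IH.
apply: (@clause_NIP G (nth d0 ds i) GL (dsa _ ids)).
by apply: Rand_weaken Hi => x; [apply | case].
Qed.

Definition covered (l : seq name) (nu : name) : Prop := forall j,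
  (exists i, (path nu j).1 = Base i) \/ List.In (path nu j).1 l.

(** Each name comes before the names that it refers to, and once only; new names
    are put in front. *)
Fixpoint good (l : seq name) : Prop :=
  if l is nu :: l' then
    [/\ good l', ~ List.In nu l' &
      match nu with Wit _ _ a | Cst _ _ a => covered l' a | _ => False end]
  else True.

Lemma covered_sub l l' nu : (forall mu, List.In mu l -> List.In mu l') -> covered l nu -> covered l' nu.
Proof. by move=> ll' H j; case: (H j) => [|/ll']; [left|right]. Qed.

Lemma good_ext nu l : good l -> exists l', [/\ good l',
  forall mu, List.In mu l -> List.In mu l' & covered l' nu].
Proof.
elim: nu l => [i|i c a IH|s c a IH|a IHa b IHb] l gl.
- by exists l; split=> // j; left; exists i.
- have [l1 [gl1 ll1 p1]] := IH l gl.
  have [il1|nil1] := EM (List.In (Wit i c a) l1); first by exists l1; split=> // j; right.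
  by exists (Wit i c a :: l1); split=> [//|mu /ll1|j]; right => //; left.
- have [l1 [gl1 ll1 p1]] := IH l gl.
  have [il1|nil1] := EM (List.In (Cst s c a) l1); first by exists l1; split=> // j; right.
  by exists (Cst s c a :: l1); split=> [//|mu /ll1|j]; right => //; left.
have [l1 [gl1 ll1 p1]] := IHa l gl; have [l2 [gl2 l12 p2]] := IHb l1 gl1.
exists l2; split=> // [mu /ll1/l12//|j /=].
case: (odd j); first exact: p2.
exact: covered_sub l12 p1 _.
Qed.

Lemma good_list (l : seq name) : exists l', good l' /\ forall nu, List.In nu l -> covered l' nu.
Proof.
elim: l => [|nu l [l1 [gl1 H1]]]; first by exists [::].
have [l2 [gl2 l12 p2]] := good_ext nu gl1.
exists l2; split=> // mu [<-//|/H1]; exact: covered_sub.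
Qed.

Lemma value_indep (g g' : name * nat -> Y) l nu a :
  (forall mu j, mu <> nu -> g (mu, j) = g' (mu, j)) -> ~ List.In nu l ->
  (forall i, nu <> Base i) -> covered l a -> value g a = value g' a.
Proof.
move=> gg' nul nuB pa; apply: functional_extensionality_dep => j; rewrite /value.
have := pa j; case: (path a j) => mu j' /= H; apply: gg' => mn.
by rewrite mn in H; case: H => [[i /nuB]|].
Qed.

Lemma good_obeys (g g' : name * nat -> Y) l nu mu : good l ->
  (forall mu j, mu <> nu -> g (mu, j) = g' (mu, j)) -> ~ List.In nu l ->
  (forall i, nu <> Base i) -> List.In mu l -> obeys mu g -> obeys mu g'.
Proof.
move=> gl gg' nul nuB mul.
have {}gl : (match mu with Wit _ _ a | Cst _ _ a => covered l a | _ => True end : Prop).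
  elim: l gl nul mul => //= nu' l IH [gl nl pl] nul [num|mul]; last first.
    have := IH gl (fun H => nul (or_intror H)) mul.
    by case: (mu) => // *; apply: covered_sub (_ : covered l _) => // ? ?; right.
  by subst mu; case: (nu') pl => // *; apply: covered_sub (_ : covered l _) => // ? ?; right.
have mn : mu <> nu by move=> mn; rewrite mn in mul.
have V a := @value_indep g g' l nu a gg' nul nuB.
case: mu mul gl mn => //= [i c a|s c a] mul pa mn.
  by rewrite -(V a pa) (_ : value g' _ = value g (Wit i c a)) //;
    apply: functional_extensionality_dep => j; rewrite /value /= gg'.
by rewrite -(V a pa) (_ : value g' _ 0 = value g (Cst s c a) 0) // /value /= gg'.
Qed.

Hypothesis d0_base : forall k (i : 'I_(len (cys d0 k))), (carg i).1 = Base (lift sg k).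

Lemma d0_over : over_groups d0.
Proof. by move=> k i; rewrite d0_base /= eqxx. Qed.

Lemma target_base g g' : (forall i j, g (Base i, j) = g' (Base i, j)) -> target g <-> target g'.
Proof.
move=> gg'; rewrite /target /csat /point_value /value /= gg'.
suff -> : cval d0 g = cval d0 g' by [].
apply: functional_extensionality_dep => k; apply: functional_extensionality_dep => i.
by rewrite /cval d0_base /value /= gg'.
Qed.

Definition base_values (x : point) (w : name * nat) : Y := if w.1 is Base i then x i w.2 else y0.

Hypothesis Rand0 : Rand (fun x => target (base_values x)) (fun x => ~ target (base_values x)).

Definition approx (l : seq name) : Prop := exists G, group_local G /\
  Rand (fun x => target (G x) /\ forall nu, List.In nu l -> obeys nu (G x)) (fun x => ~ target (G x)).

(** The witnesses are appended to the point of the group [i]. *)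
Lemma approx_Wit i c a l : good (Wit i c a :: l) -> approx l -> approx (Wit i c a :: l).
Proof.
move=> [gl nul pa] [G [GL HG]].
pose nu := Wit i c a.
pose G' (x : point) (w : name * nat) : Y :=
  if pselect (w.1 = nu) then x i w.2.*2.+1 else G (fun k j => x k j.*2) w.
pose W u h := dec c (leave h (value (G (fun=> u)) a)).
have /ex_choice [wit Hwit] : forall u, exists h, (exists h, W u h) -> W u h.
  move=> u; have [[h Wh]|nW] := EM (exists h, W u h); first by exists h.
  by exists (fun=> y0).
pose F (k : 'I_q) u := leave u (wit u).
have FE x : (fun k j => F k (x k) j.*2) = x.
  apply: functional_extensionality_dep => k; apply: functional_extensionality_dep => j.
  by rewrite /F leave_even.
have E x mu j : mu <> nu -> G x (mu, j) = G' (fun k => F k (x k)) (mu, j).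
  by move=> mn; rewrite /G' /=; case: pselect => //= _; rewrite FE.
have Enu x j : G' (fun k => F k (x k)) (nu, j) = wit (x i) j.
  by rewrite /G' /=; case: pselect => //= _; rewrite /F leave_odd.
have PE x : target (G x) <-> target (G' (fun k => F k (x k))) by apply: target_base => k j; apply: E.
exists G'; split.
  move=> w; rewrite /G'; case: pselect => wn.
    by left; exists i, w.2.*2.+1; split=> // i'; rewrite wn /= => /eqP ->.
  case: (GL w) => [[k [j [Gx Hk]]]|[y Gy]]; last by right; exists y => x; rewrite /= Gy.
  by left; exists k, j.*2; split=> // x; rewrite Gx.
apply: (Rand_map (F := F)) HG => x; last by rewrite PE.
move=> [Px Axl]; split=> [|mu [<-|mul]]; first exact/PE; last first.
  by apply: (good_obeys (nu := nu) gl (E x) nul _ mul) (Axl mu mul).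
move=> ia; set g := G' _.
have -> : value g a = value (G (fun=> x i)) a.
  rewrite -(local_value x GL ia); apply/esym; exact: (value_indep (E x) nul _ pa).
have -> : value g (Wit i c a) = wit (x i).
  apply: functional_extensionality_dep => j; exact: Enu.
exact: Hwit.
Qed.

Lemma unique_val c s z z' u : unique_at c s z u -> unique_at c s z' u -> z s = z' s.
Proof. by move=> H H'; apply/(H' z)/H. Qed.

(** The element defined over the points is a function of them; [fix_edges] makes
    it constant on the edges. *)
Lemma approx_Cst s c a l : good (Cst s c a :: l) -> approx l -> approx (Cst s c a :: l).
Proof.
move=> [gl nul pa] [G [GL HG]].
pose nu := Cst s c a.
have [st|st] := EM (s = t).
  exists G; split=> //; apply: Rand_weaken HG => // x [Px Axl]; split=> // mu [<-//|].
  exact: Axl.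
pose U x z := unique_at c s z (value (G x) a).
pose f x : M s := if pselect (exists z, U x z) is left e then sval (cid e) s else y0 s.
have fE x tau : f x = tau <-> (exists z, U x z /\ z s = tau) \/ (~ (exists z, U x z) /\ y0 s = tau).
  rewrite /f; case: pselect => e; last first.
    by split=> [?|[[z [Uz _]]|[]//]]; [right | case: e; exists z].
  split=> [<-|[[z [Uz <-]]|[/(_ e)]//]]; last exact: unique_val (svalP (cid e)) Uz.
  by left; exists (sval (cid e)); split=> //; exact: svalP.
pose H (g : option ('I_q * nat) -> Y) (w : option (name * nat)) : Y :=
  if w is Some w then G (fun l j => g (Some (l, j))) w else g None.
have HH w : (exists v, forall g, H g w = g v) \/ (exists y, forall g, H g w = y).
  case: w => [w|]; last by left; exists None.
  case: (GL w) => [[i [j [Gx _]]]|[y Gy]]; last by right; exists y => g; rewrite /H Gy.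
  by left; exists (Some (i, j)) => g; rewrite /H Gx.
have df : dfun f.
  apply: (@Dfn_iff _ _ _ _ (fun g : option ('I_q * nat) -> Y =>
    ~ (~ (exists z, U (fun l j => g (Some (l, j))) z /\ z s = g None s) /\
       ~ (~ (exists z, U (fun l j => g (Some (l, j))) z) /\ y0 s = g None s)))).
    by move=> g; rewrite fE not_andP !not_notP.
  apply: Dfn_not; apply: (Dfn_and y0); apply: Dfn_not.
    have dQ : def0 (fun g : option (name * nat) -> Y => exists z,
        unique_at c s z (value (fun w => g (Some w)) a) /\ z s = g None s).
      apply: dfn_exY; apply: dfn_and; last exact: dfn_eq.
      exact: (unique_def c s None (fun j => Some (Some (path a j)))).
    exact: (Dfn_subst y0 HH (dfn_Dfn y0 dQ)).
  apply: (Dfn_and y0).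
    apply: Dfn_not.
    have dQ : def0 (fun g : option (name * nat) -> Y => exists z,
        unique_at c s z (value (fun w => g (Some w)) a)).
      exact: (unique_ex_def c s (fun j => Some (path a j))).
    exact: (Dfn_subst y0 HH (dfn_Dfn y0 dQ)).
  apply: (Dfn_subst y0 (F := fun (g : option ('I_q * nat) -> Y) b => if b then y0 else g None) _
    (Dfn_eq y0 true false s)).
  by case; [right; exists y0 | left; exists None].
have [||a0 Ha0] := @fix_edges _ _ _ _ _ M_sat nat_Lam S_Lam Lam_kappa s0 y0 n s f _ _ (fixed st) df _ _ HG.
- apply: (definable_value (Q := fun g => target g /\ forall nu, List.In nu l -> obeys nu g)) => //.
  apply: dfn_and; first exact: target_def.
  by apply: dfn_In => // mu _; apply: obeys_def.
- apply: (definable_value (Q := fun g => ~ target g)) => //.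
  by apply: dfn_not; apply: target_def.
pose G' (x : point) (w : name * nat) : Y := if pselect (w.1 = nu) then put y0 a0 else G x w.
have E x mu j : mu <> nu -> G x (mu, j) = G' x (mu, j).
  by move=> mn; rewrite /G' /=; case: pselect.
have PE x : target (G x) <-> target (G' x) by apply: target_base => k j; apply: E.
exists G'; split.
  move=> w; rewrite /G'; case: pselect => wn; last exact: GL.
  by right; exists (put y0 a0).
apply: Rand_weaken Ha0 => x; last by rewrite PE.
move=> [[Px Axl] fx]; split=> [|mu [<-|mul]]; first exact/PE; last first.
  by apply: (good_obeys (nu := nu) gl (E x) nul _ mul) (Axl mu mul).
move=> _; rewrite -(value_indep (E x) nul _ pa) // => exz.
have -> : value (G' x) (Cst s c a) 0 = put y0 a0.
  by rewrite /value /G' /=; case: pselect.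
move/fE: fx => [[z [Uz za]]|[/(_ exz)//]].
by apply/Uz; rewrite putE.
Qed.

Theorem approx_good l : good l -> approx l.
Proof.
elim: l => [|[i|i c a|s c a|a b] l IH] gl; try by case: gl.
- exists base_values; split=> [[[i|i c a|s c a|a b] j]|]; try by right; exists y0.
    by left; exists i, j; split=> // i' /eqP.
  by apply: Rand_weaken Rand0.
- by apply: approx_Wit => //; case: gl => /IH.
- by apply: approx_Cst => //; case: gl => /IH.
Qed.

Lemma name_Lam : embeds name Lam.
Proof.
pose A := ('I_q + S + T)%type.
have AL : embeds A Lam.
  apply: embeds_sum => //; first by apply: embeds_sum => //; apply: embeds_count.
  by apply: embeds_tree => //; exists id.
apply: embeds_trans (embeds_tree nat_Lam AL).
pose fix enc (nu : name) : GenTree.tree A := match nu with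
  | Base i => GenTree.Node 0 [:: GenTree.Leaf (inl (inl i))]
  | Wit i c a => GenTree.Node 1 [:: GenTree.Leaf (inl (inl i)); GenTree.Leaf (inr c); enc a]
  | Cst s c a => GenTree.Node 2 [:: GenTree.Leaf (inl (inr s)); GenTree.Leaf (inr c); enc a]
  | Pair a b => GenTree.Node 3 [:: enc a; enc b] end.
exists enc; elim=> [i|i c a IH|s c a IH|a IHa b IHb] [i'|i' c' a'|s' c' a'|a' b'] //=.
- by case=> ->.
- by case=> -> -> /IH ->.
- by case=> -> -> /IH ->.
- by case=> /IHa -> /IHb ->.
Qed.

(** Finitely many conditions are met by the value of an approximation on some edge. *)
Theorem realization : exists g : name * nat -> Y,
  [/\ target g, forall nu, obeys nu g &
    forall ds, (forall d, List.In d ds -> allowed d) -> ~ witness ds g].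
Proof.
pose F (Q : (name * nat -> Y) -> Prop) := [\/ Q = target, exists nu, Q = obeys nu |
  exists ds, (forall d, List.In d ds -> allowed d) /\ Q = fun g => ~ witness ds g].
have [|Q|l lF|g Hg] := @saturated_dfn kappa S L M M_sat y0 _ _ (of_void Y) F.
- apply: embeds_lt Lam_kappa; apply: embeds_sum => //; apply: embeds_prod => //.
  apply: embeds_option => //; apply: embeds_sum => //; last exact: embeds_count.
  by apply: embeds_prod => //; apply: name_Lam.
- case=> [->|[nu ->]|[ds [_ ->]]]; first exact: target_def; first exact: obeys_def.
  by apply: dfn_not; apply: witness_def.
- have [ns [dss [Hdss Hl]]] : exists ns dss,
      (forall ds, List.In ds dss -> forall d, List.In d ds -> allowed d) /\
      forall g, target g -> (forall nu, List.In nu ns -> obeys nu g) ->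
        (forall ds, List.In ds dss -> ~ witness ds g) -> forall Q, List.In Q l -> Q g.
    elim: l lF => [|Q l IH] lF; first by exists [::], [::].
    have [ns [dss [Hdss Hl]]] := IH (fun Q' Q'l => lF Q' (or_intror Q'l)).
    case: (lF Q (or_introl erefl)) => [QE|[nu QE]|[ds [dsa QE]]].
    + exists ns, dss; split=> // g Pg Ag Wg Q' [<-|]; first by rewrite QE.
      exact: Hl.
    + exists (nu :: ns), dss; split=> // g Pg Ag Wg Q' [<-|].
        by rewrite QE; apply: Ag; left.
      by apply: Hl => // mu mun; apply: Ag; right.
    + exists ns, (ds :: dss); split=> [ds' [<-//|]|g Pg Ag Wg Q' [<-|]]; first exact: Hdss.
        by rewrite QE; apply: Wg; left.
      by apply: Hl => // ds' ds'l; apply: Wg; right.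
  have [l' [gl' nsl']] := good_list ns.
  have [G [GL HG]] := approx_good gl'.
  apply: contrapT => ng.
  have [x [Px Axx]|i Hi] := @Rand_or S L M n _ _ 'I_(size dss)
      (fun i x => witness (nth [::] dss i) (G x)) _ HG.
    apply: contrapT => nex; apply: ng; exists (G x); apply: Hl => //.
      move=> nu /nsl' /(_ 0); case: nu => //= [i c a|s c a] [[? //]|]; exact: Axx.
    move=> ds dsl wds; apply: nex.
    have [i [/ltP idss id]] := List.In_nth _ ds [::] dsl.
    exists (Ordinal (idss : i < size dss)) => /=.
    by rewrite (_ : nth [::] dss i = ds) // -id; elim: (dss) (i) => [|? ? IH] [|?] /=.
  have ids : List.In (nth [::] dss i) dss.
    case: i {Hi} => i /=; elim: (dss) i => [|d l0 IH] [|i] //= ids; first by left.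
    by right; apply: IH.
  exact: (no_witness GL d0_over (Hdss _ ids) Hi).
exists g; split=> [|nu|ds dsa].
- by apply: (Hg target); constructor 1.
- by apply: (Hg (obeys nu)); constructor 2; exists nu.
by apply: (Hg (fun g => ~ witness ds g)); constructor 3; exists ds.
Qed.

End Names.

Arguments Base {Lam S n} i.
Arguments cval {Lam S L M n t} d g k.

(** * Small models from a realization *)

Section Realized.

Variables (kappa Lam S : Type) (L : language S) (M : structure L).
Hypothesis M_sat : saturated kappa M.
Hypotheses (nat_Lam : embeds nat Lam) (S_Lam : embeds S Lam).
Hypothesis Lam_kappa : card_lt Lam kappa.
Variables (s0 : S) (y0 : Y M) (n : nat).

Local Notation Y := (Y M).
Local Notation def0 := (@def0 S L M).
Local Notation q := n.+1.
Local Notation pt := (pt M).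
Local Notation T := (GenTree.tree Lam).
Local Notation name := (name Lam S n).

Variables (dec : T -> pt -> Prop) (t : S) (sg : 'I_q).
Hypothesis dec_all : forall phi : formula L (fun v : nat * S => v.2),
  exists c, forall u, dec c u <-> ysat u phi.

Variables (d0 : clause Lam L n t) (g : name * nat -> Y).
Hypotheses (g_target : target (M := M) sg d0 g) (g_obeys : forall nu, obeys dec t nu g).
Hypothesis g_free : forall ds, (forall d, List.In d ds -> allowed M sg d) ->
  ~ witness (M := M) sg d0 ds g.

(** The elements with a name in the hull of the k-th parameter group: the model K_k. *)
Definition Kpart (k : 'I_n) (s : S) (z : M s) : Prop :=
  exists nu j, hull (lift sg k) nu /\ value g nu j s = z.

(** Replaces the finitely many parameters of a formula by a single stream, since
    witnesses and constants are taken over one stream. *)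
Lemma collect (H : name -> Prop) (nu0 : name) (V : Type) (sv : V -> S) (e : forall v, M (sv v))
    (l : seq V) : H nu0 -> (forall a b, H a -> H b -> H (Pair a b)) ->
  (forall v, exists nu j, H nu /\ value g nu j (sv v) = e v) ->
  exists a p, H a /\ forall v, List.In v l -> value g a (p v) (sv v) = e v.
Proof.
move=> H0 HP He; elim: l => [|v l [a [p [Ha Hp]]]]; first by exists nu0, (fun=> 0).
have [nu [j [Hnu nuj]]] := He v.
exists (Pair nu a), (fun w => if pselect (w = v) then j.*2 else (p w).*2.+1).
split=> [|w wl]; first exact: HP.
rewrite value_pair; case: pselect => [wv|wv] /=; first by rewrite leave_even wv.
by rewrite leave_odd; apply: Hp; case: wl => // /esym.
Qed.

Lemma Kpart_TV k (V : Type) (sv : V -> S) (e : forall v, M (sv v)) s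
    (phi : formula L (osrt s sv)) :
  (forall v, Kpart k (e v)) -> (exists x, sat (oenv x e) phi) ->
  exists x, Kpart k x /\ sat (oenv x e) phi.
Proof.
move=> He [x0 Hx0].
have [|a [p [Ha Hp]]] := @collect (hull (lift sg k)) (Base (lift sg k)) V sv e
  (pmap id (fvars phi)) (eqxx _) _ He.
  by move=> a b /= Ha Hb; rewrite Ha Hb.
(* the bound variable is at the even positions, the stream at the odd ones *)
pose f (v : option V) : nat * S := (if v is Some w then (p w).*2.+1 else 0, osrt s sv v).
have [c Hc] := dec_all (fren (f := f) (sv' := fun v : nat * S => v.2) (fun=> erefl) phi).
have E h : dec c (leave h (value g a)) <-> sat (oenv (h 0 s) e) phi.
  rewrite Hc /ysat sat_fren; apply: sat_supp => -[v|] vphi //.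
  by rewrite /envr /f /= leave_odd Hp //; apply: In_pmap.
have W : dec c (leave (value g (Wit (lift sg k) c a)) (value g a)).
  by apply: (g_obeys (Wit (lift sg k) c a) Ha); exists (fun=> put y0 x0); apply/E; rewrite putE.
exists (value g (Wit (lift sg k) c a) 0 s); split; last exact/E.
by exists (Wit (lift sg k) c a), 0; rewrite /= eqxx.
Qed.

Lemma Kpart_small k : small_model kappa (Kpart k).
Proof.
apply: small_submodel; first exact: Kpart_TV.
apply: embeds_lt Lam_kappa.
have NL : embeds (name * nat * S) Lam.
  by do 2! apply: embeds_prod => //; exact: name_Lam.
apply: embeds_trans NL.
have H (w : {s : S & {x : M s | Kpart k x}}) : exists v : name * nat,
    value g v.1 v.2 (tag w) = sval (tagged w).
  by case: w => s [x Kx]; have [nu [j [_ nuj]]] := Kx; exists (nu, j).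
have [f Hf] := ex_choice H.
exists (fun w => (f w, tag w)) => -[s x] [s' x'] [ff /= ss].
subst s'; congr existT; apply: eq_sig_hprop => /=; first by move=> ? ? ?; exact: Prop_irrelevance.
by have := Hf (existT _ s x); have := Hf (existT _ s x'); rewrite ff /= => -> ->.
Qed.

(** The definable closure of the elements that have a name. *)
Definition dcl (s : S) (z : M s) : Prop := exists (Z : pt -> Prop) nu,
  def0 Z /\ forall y : Y, Z (leave (fun=> y) (value g nu)) <-> y s = z.

Lemma dcl_name nu j s : dcl (value g nu j s).
Proof.
exists (fun u => u 0 s = u j.*2.+1 s), nu; split; first exact: dfn_eq.
by move=> y; rewrite leave_odd.
Qed.

Lemma dcl2 (Theta : Y -> Y -> Y -> Prop) s1 (z1 : M s1) s2 (z2 : M s2) s (z : M s) :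
  def0 (fun h : option bool -> Y => Theta (h (Some true)) (h (Some false)) (h None)) ->
  dcl z1 -> dcl z2 ->
  (forall y1 y2 y, y1 s1 = z1 -> y2 s2 = z2 -> Theta y1 y2 y <-> y s = z) -> dcl z.
Proof.
move=> dT [Z1 [nu1 [dZ1 H1]]] [Z2 [nu2 [dZ2 H2]]] HT.
exists (fun u => exists y1 y2, [/\ Z1 (leave (fun=> y1) (fun j => u j.*2.*2.+1)),
  Z2 (leave (fun=> y2) (fun j => u j.*2.+1.*2.+1)) & Theta y1 y2 (u 0)]), (Pair nu1 nu2); split.
  apply: dfn_exY; apply: dfn_exY.
  apply: (@dfn_iff _ _ _ _ _ _ (fun g : option (option nat) -> Y =>
    [/\ Z1 (leave (fun=> g (Some None)) (fun j => g (Some (Some j.*2.*2.+1)))) /\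
        Z2 (leave (fun=> g None) (fun j => g (Some (Some j.*2.+1.*2.+1)))) &
        Theta (g (Some None)) (g None) (g (Some (Some 0)))])).
    by move=> h; split=> [[[]]|[]].
  apply: (@dfn_iff _ _ _ _ _ _ (fun g : option (option nat) -> Y =>
    (Z1 (leave (fun=> g (Some None)) (fun j => g (Some (Some j.*2.*2.+1)))) /\
        Z2 (leave (fun=> g None) (fun j => g (Some (Some j.*2.+1.*2.+1))))) /\
        Theta (g (Some None)) (g None) (g (Some (Some 0))))).
    by move=> h; split=> -[].
  have lv (v : option (option nat)) (r : nat -> option (option nat)) (Z : pt -> Prop) : def0 Z ->
      def0 (fun g : option (option nat) -> Y => Z (leave (fun=> g v) (fun j => g (r j)))).
    move=> dZ; apply: dfn_iff (dfn_ren (fun j => if odd j then r j./2 else v) dZ) => h.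
    suff -> : (fun v0 => h (if odd v0 then r v0./2 else v)) = leave (fun=> h v) (fun j => h (r j)) by [].
    by apply: functional_extensionality_dep => j; rewrite /leave; case: (odd j).
  apply: dfn_and; first by apply: dfn_and; apply: lv.
  exact: (dfn_ren (fun w => match w with Some true => Some None | Some false => None
    | None => Some (Some 0) end) dT).
move=> y.
have e1 : (fun j => leave (fun=> y) (value g (Pair nu1 nu2)) j.*2.*2.+1) = value g nu1.
  by apply: functional_extensionality_dep => j; rewrite leave_odd value_pair leave_even.
have e2 : (fun j => leave (fun=> y) (value g (Pair nu1 nu2)) j.*2.+1.*2.+1) = value g nu2.
  by apply: functional_extensionality_dep => j; rewrite leave_odd value_pair leave_odd.
rewrite e1 e2; split=> [[y1 [y2 [/H1 Y1 /H2 Y2 /(HT _ _ _ Y1 Y2)]]]//|yz].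
exists (put y0 z1), (put y0 z2); split; [apply/H1|apply/H2|apply/HT => //]; rewrite ?putE //.
Qed.

(** Constants belong to every hull, hence to every K_k. *)
Lemma dcl_Kpart s (z : M s) k : s <> t -> dcl z -> Kpart k z.
Proof.
move=> st [Z [nu [dZ HZ]]].
have [phi Hphi] := def0_formula dZ; have [c Hc] := dec_all phi.
have cZ y : dec c (leave (fun=> y) (value g nu)) <-> y s = z by rewrite Hc -Hphi HZ.
exists (Cst s c nu), 0; split=> //.
apply/cZ; apply: (g_obeys (Cst s c nu)) => //.
by exists (put y0 z) => y; rewrite cZ putE.
Qed.

(** By compactness a finite part of [p] would imply [d0], and its formulas with
    the names of their parameters would be a witness. *)
Theorem no_NIP_type (p : ptype M n t) :
  (forall ys phi a, p ys phi a -> tp (point_value sg g t) Kpart phi a) ->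
  (forall ys (phi : pformula L (ctx1 t) ys) a, p ys phi a -> formula_NIP M phi) ->
  ~ Defs.implies p (cphi d0) (cval d0 g).
Proof.
move=> p_tp p_NIP p_d0.
pose A := (name * nat * S)%type.
pose sa (w : A) := w.2.
pose av (w : A) : M (sa w) := value g w.1.1 w.1.2 w.2.
pose fv (d : clause Lam L n t) (v : 'I_1 + {k & 'I_(len (cys d k))}) : option A :=
  match v with inl _ => None
  | inr ki => Some ((carg (tagged ki)).1, (carg (tagged ki)).2, srt (tagged ki)) end.
have pf d v : osrt t sa (fv d v) = @psrt S n (ctx1 t) (cys d) v by case: v => [i|[k i]].
pose ren d : formula L (osrt t sa) := fren (pf d) (cphi d).
have renE d (y : Y) : sat (oenv (y t) av) (ren d) <-> csat d y g.
  rewrite /ren sat_fren; apply: sat_ext => -[i|[k i]] /=;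
  by rewrite /envr; move: (pf d _) => /= e; rewrite (Prop_irrelevance e erefl).
pose P d := allowed M sg d /\ p (cys d) (cphi d) (cval d g).
pose Q psi := psi = FNot (ren d0) \/ exists2 d, P d & psi = ren d.
have [|l lQ|x Hx] := @M_sat A sa av t Q.
- by apply: embeds_lt Lam_kappa; do 2! apply: embeds_prod => //; exact: name_Lam.
- have [ds [Pds Hds]] : exists ds, (forall d, List.In d ds -> P d) /\
      forall x, ~ sat (oenv x av) (ren d0) -> (forall d, List.In d ds -> sat (oenv x av) (ren d)) ->
      forall psi, List.In psi l -> sat (oenv x av) psi.
    elim: l lQ => [|psi l IH] lQ; first by exists [::].
    have [ds [Pds Hds]] := IH (fun psi' H => lQ psi' (or_intror H)).
    case: (lQ psi (or_introl erefl)) => [->|[d Pd ->]].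
      exists ds; split=> // x nx dx psi' [<-//|]; exact: Hds.
    exists (d :: ds); split=> [d' [<-//|/Pds//]|x nx dx psi' [<-|]].
      by apply: dx; left.
    by apply: Hds => // d' d'l; apply: dx; right.
  apply: contrapT => nx; apply: (g_free (ds := ds)) => [d /Pds []//|].
  split=> [d /Pds [_ /p_tp []]//|y yds]; apply: contrapT => ny; apply: nx.
  exists (y t); apply: Hds; first by rewrite renE.
  by move=> d /yds; rewrite renE.
have := Hx _ (or_introl erefl) => /=; rewrite -(putE y0 x) renE; apply.
rewrite /csat putE; apply: p_d0 => ys phi a pa.
have [aK _] := p_tp _ _ _ pa.
have aK' k (i : 'I_(len (ys k))) : exists w : name * nat, hull (lift sg k) w.1 /\
    value g w.1 w.2 (srt i) = a k i.
  by have [nu [j [? ?]]] := aK k i; exists (nu, j).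
pose d := @Clause Lam S L n t ys phi (fun k i => sval (cid (aK' k i))).
have dE : cval d g = a.
  apply: functional_extensionality_dep => k; apply: functional_extensionality_dep => i.
  by rewrite /cval /=; case: (svalP (cid (aK' k i))).
have Pd : P d.
  split; last by rewrite dE.
  split; first exact: p_NIP pa.
  by move=> k i /=; case: (svalP (cid (aK' k i))).
have := Hx (ren d) (or_intror (ex_intro2 _ _ d Pd erefl)).
by rewrite -(putE y0 x) renE /csat putE dE.
Qed.

End Realized.

Arguments Kpart {Lam S L M n} sg g k s z.
Arguments dcl {Lam S L M n} g s z.

(** * Immediate extensions *)

Section BasicDefinable.

Variables (S : Type) (L : language S) (M : structure L).
Local Notation Y := (Y M).
Local Notation def0 := (@def0 S L M).

Lemma def0_fint (f : Defs.fsym L) V (r : 'I_(len (fdom f)) -> V) (v : V) :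
  def0 (fun g : V -> Y => fint (itp M) (fun i => g (r i) (srt i)) = g v (fcod f)).
Proof.
pose sv := osrt (fcod f) (@srt _ (fdom f)).
pose phi : formula L sv := FEq (App (fun i => Var L sv (Some i))) (Var L sv None).
have := dfn_vars (of_void Y) phi (fun w => if w is Some i then r i else v).
exact: dfn_iff.
Qed.

End BasicDefinable.

Section ValuedField.

Variables (kappa Lam : Type) (X : language vf_sort) (M : structure (vf_language X)).
Hypothesis M_sat : saturated kappa M.
Hypotheses (nat_Lam : embeds nat Lam) (S_Lam : embeds vf_sort Lam).
Hypotheses (f_Lam : embeds (Defs.fsym (vf_language X)) Lam)
  (r_Lam : embeds (rsym (vf_language X)) Lam).
Hypothesis Lam_kappa : card_lt Lam kappa.
Hypothesis M_vf : is_valued_field M.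
Variables (n : nat) (y0 : Y M).
Hypothesis n_gt0 : 0 < n.

Local Notation L := (vf_language X).
Local Notation Y := (Y M).
Local Notation def0 := (@def0 _ L M).
Local Notation q := n.+1.
Local Notation pt := (pt M).
Local Notation point := (point M n).
Local Notation F := (field_K M).

Definition vf_sorts : seq vf_sort := [:: sK; sk; sG].
Lemma vf_sortsP s : List.In s vf_sorts.
Proof. by case: s; [left | right; left | right; right; left]. Qed.

Definition pairenv (s : vf_sort) (x : M sK) (z : M s) :
    forall v, M (osrt sK (fun _ : unit => s) v) :=
  @oenv vf_sort M unit (fun=> s) sK x (fun=> z).

Lemma rel_formula (r : rsym L) (s : vf_sort) (f : 'I_(len (rdom r)) -> option unit)
  (R : M sK -> M s -> Prop) (pf : forall i, osrt sK (fun=> s) (f i) = srt i) :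
  (forall x z, rint (itp M) (envr pf (pairenv x z)) <-> R x z) ->
  exists phi : formula L (osrt sK (fun _ : unit => s)),
    forall x z, sat (pairenv x z) phi <-> R x z.
Proof.
move=> HR; exists (fren pf (FRel (fun i => Var L (@srt _ (rdom r)) i))) => x z.
by rewrite -HR sat_fren.
Qed.

Lemma first_sort (s : vf_sort) (i : 'I_2) :
  osrt sK (fun _ : unit => s) (if i == ord0 then None else Some tt) = @srt _ (ctx2 sK s) i.
Proof. by rewrite /=; case: (i == ord0). Qed.

Lemma first_env (s : vf_sort) (x : M sK) (z : M s) :
  envr (first_sort s) (pairenv x z) = tup2 x z.
Proof.
apply: functional_extensionality_dep => i; rewrite /envr /tup2.
move: (first_sort s i) => /=; case: (i == ord0) => /= e;
  by rewrite (Prop_irrelevance e erefl).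
Qed.

Lemma val_formula : exists phi : formula L (osrt sK (fun _ : unit => sG)),
  forall x z, sat (pairenv x z) phi <-> Defs.val x z.
Proof.
apply: (@rel_formula (inl (inr (inr RVal))) sG _ _ (first_sort sG)) => x z.
by rewrite first_env.
Qed.

Lemma res_formula : exists phi : formula L (osrt sK (fun _ : unit => sk)),
  forall x z, sat (pairenv x z) phi <-> Defs.res x z.
Proof.
apply: (@rel_formula (inl (inr (inr RRes))) sk _ _ (first_sort sk)) => x z.
by rewrite first_env.
Qed.

Lemma def0_rel s (R : M sK -> M s -> Prop) :
  (exists phi : formula L (osrt sK (fun _ : unit => s)),
    forall x z, sat (pairenv x z) phi <-> R x z) ->
  forall V (v w : V), def0 (fun g : V -> Y => R (g v sK) (g w s)).
Proof.
move=> [phi Hphi] V v w.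
have := dfn_vars (of_void Y) phi (fun u => if u is Some _ then w else v).
apply: dfn_iff => g; rewrite -Hphi; apply: sat_ext; by case.
Qed.

Lemma def0_one V (v : V) : def0 (fun g : V -> Y => rone F = g v sK).
Proof.
pose f : Defs.fsym L := inl (inl (inl R1)).
have := @def0_fint _ L M f V (fun=> v) v.
apply: dfn_iff => g; suff E : rone F = @fint _ _ _ (itp M) f (fun i => g v (srt i)) by rewrite E.
apply: (f_equal (@fint _ _ _ (itp M) f)).
by apply: functional_extensionality_dep => -[].
Qed.

Lemma def0_op2 (op : M sK -> M sK -> M sK) V (v w z : V) :
  op = radd F \/ op = rmul F ->
  def0 (fun g : V -> Y => op (g v sK) (g w sK) = g z sK).
Proof.
have tupE (g : V -> Y) : @tup2 _ (fun=> M sK) tt tt (g v sK) (g w sK) =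
    fun i => g (if i == ord0 then v else w) sK.
  by apply: functional_extensionality_dep => i; rewrite /tup2; case: (i == ord0).
case=> ->.
  pose f : Defs.fsym L := inl (inl (inl RAdd)).
  have := @def0_fint _ L M f V (fun i => if i == ord0 then v else w) z.
  apply: dfn_iff => g.
  suff E : radd F (g v sK) (g w sK) =
      @fint _ _ _ (itp M) f (fun i => g (if i == ord0 then v else w) (srt i)) by rewrite E.
  exact: (f_equal (@fint _ _ _ (itp M) f) (tupE g)).
pose f : Defs.fsym L := inl (inl (inl RMul)).
have := @def0_fint _ L M f V (fun i => if i == ord0 then v else w) z.
apply: dfn_iff => g.
suff E : rmul F (g v sK) (g w sK) =
    @fint _ _ _ (itp M) f (fun i => g (if i == ord0 then v else w) (srt i)) by rewrite E.
exact: (f_equal (@fint _ _ _ (itp M) f) (tupE g)).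
Qed.

Lemma def0_opp V (v z : V) : def0 (fun g : V -> Y => ropp F (g v sK) = g z sK).
Proof. exact: (@def0_fint _ L M (inl (inl (inl ROpp))) V (fun=> v) z). Qed.

Section Point.

Variables (dec : GenTree.tree Lam -> pt -> Prop) (sg : 'I_q).
Hypothesis dec_all : forall phi : formula L (fun v : nat * vf_sort => v.2),
  exists c, forall u, dec c u <-> ysat u phi.
Variables (d0 : clause Lam L n sK) (g : name Lam vf_sort n * nat -> Y).
Hypothesis g_obeys : forall nu, obeys dec sK nu g.

Local Notation Kp := (Kpart sg g).

Lemma dcl_subfield : is_subfield F (fun z => dcl g sK z).
Proof.
have [rt one0 inv] := vf_K M_vf.
split.
- apply: (dcl2 y0 (Theta := fun _ _ y => rone F = y sK) (def0_one None)
    (dcl_name g (Base sg) 0 sK) (dcl_name g (Base sg) 0 sK)) => y1 y2 y _ _; by split.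
- move=> x y Dx Dy.
  apply: (dcl2 y0 (Theta := fun y1 y2 y => radd F (y1 sK) (y2 sK) = y sK) _ Dx Dy).
    by apply: def0_op2; left.
  by move=> y1 y2 y' -> ->; split.
- move=> x Dx.
  apply: (dcl2 y0 (Theta := fun y1 y2 y => ropp F (y1 sK) = y sK) _ Dx Dx).
    exact: def0_opp.
  by move=> y1 y2 y' -> _; split.
- move=> x y Dx Dy.
  apply: (dcl2 y0 (Theta := fun y1 y2 y => rmul F (y1 sK) (y2 sK) = y sK) _ Dx Dy).
    by apply: def0_op2; right.
  by move=> y1 y2 y' -> ->; split.
move=> x y Dx xy.
apply: (dcl2 y0 (Theta := fun y1 y2 y => exists w : Y, rmul F (y1 sK) (y sK) = w sK /\ rone F = w sK) _ Dx Dx).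
  apply: dfn_exY; apply: dfn_and; last exact: def0_one.
  by apply: def0_op2; right.
move=> y1 y2 y' -> _; split=> [[w [xy' w1]]|->]; last by exists (put y0 (rone F)); rewrite putE.
rewrite -w1 in xy'.
rewrite -(Rmul_1_l rt (y' sK)) -xy (Rmul_comm rt x) -(Rmul_assoc rt) xy'.
by rewrite (Rmul_comm rt) (Rmul_1_l rt).
Qed.

Lemma adjoin_dcl x :
  adjoin F (compositum F (fun i => Kp i sK)) (point_value sg g sK) x -> dcl g sK x.
Proof.
apply; first exact: dcl_subfield.
move=> y [|->]; last exact: dcl_name.
apply; first exact: dcl_subfield.
by move=> z [i [nu [j [_ <-]]]]; exact: dcl_name.
Qed.

(** For the valuation and the residue map: the value is definable, hence in K_k,
    and it is attained there because K_k is an elementary substructure. *)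
Lemma Kpart_lift k s (R : M sK -> M s -> Prop) : s <> sK ->
  (exists phi : formula L (osrt sK (fun _ : unit => s)),
    forall x z, sat (pairenv x z) phi <-> R x z) ->
  (forall x z z', R x z -> R x z' -> z = z') -> (forall z, exists x, R x z) ->
  forall x z, dcl g sK x -> R x z -> exists2 y, Kp k sK y & R y z.
Proof.
move=> st HR Rfun Rsurj x z Dx Rxz.
have Kz : Kp k s z.
  apply: (dcl_Kpart y0 sg dec_all g_obeys k st).
  apply: (dcl2 y0 (Theta := fun y1 y2 y => R (y1 sK) (y s)) _ Dx Dx).
    exact: (def0_rel HR (Some true) None).
  move=> y1 y2 y -> _; split=> [Rxy|->//]; exact: Rfun Rxy Rxz.
have [phi Hphi] := HR.
have [|y [Ky /Hphi Ryz]] := @Kpart_TV Lam _ L M y0 n dec sK sg dec_all g g_obeys k unit (fun=> s)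
  (fun=> z) sK phi (fun=> Kz).
  by have [y Ry] := Rsurj z; exists y; apply/Hphi.
by exists y.
Qed.

Lemma Kpart_immediate k : immediate (Kp k sK)
  (adjoin F (compositum F (fun i => Kp i sK)) (point_value sg g sK)).
Proof.
split=> [x Kx P _ PB|x z /adjoin_dcl Dx|x z /adjoin_dcl Dx].
- by apply: PB; left=> P' _; apply; exists k.
- apply: (Kpart_lift k (s := sG)) => //; first exact: val_formula.
    exact: vf_val_fun M_vf.
  exact: vf_val_surj M_vf.
apply: (Kpart_lift k (s := sk)) => //; first exact: res_formula.
  exact: vf_res_fun M_vf.
exact: vf_res_surj M_vf.
Qed.

End Point.

(** The parameters of [chi] are interleaved with the points of the groups, and the
    single element of sort K on which [chi] depends in the group [sg] becomes the
    first element of its point. *)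
Theorem coord_free_K : Im kappa n M ->
  (forall s, s <> sK -> forall A : {set 'I_q}, A != setT -> @fixables _ L M n s A) ->
  @coord_free _ L M n sK.
Proof.
move=> M_Im fixed sg j chi dchi chisg HR.
have dP : definable (fun x : point => chi (x sg j sK) x).
  by apply: (drel_fun y0) => //; apply: dfun_coord.
have [m [c Hmc]] := to_pformula sK y0 vf_sortsP n_gt0 sg dP.
have [i s im|phi Hphi] := Hmc (ctx1 sK) (M sK) (fun z => @tup1 _ M sK z)
  (fun z i => if i == j then put y0 z else y0).
  have [_|_] := eqVneq i j; last by right.
  have [su|su] := EM (sK = s).
    left; exists ord0, su => z; rewrite /put; case: pselect => // e.
    by rewrite (Prop_irrelevance e su).
  by right=> z; rewrite /put; case: pselect.
pose d0 : clause Lam L n sK := @Clause Lam _ L n sK _ phi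
  (fun k i => (Base (lift sg k), (nth (0, sK) (coords vf_sorts m) i).1)).
have [dec [dec_def dec_all]] := @codes _ Lam L M sK S_Lam f_Lam r_Lam.
have [//||g [g_target g_obeys g_free]] := realization M_sat nat_Lam S_Lam Lam_kappa sK dec_def fixed
  (d0 := d0) (sg := sg) (y0 := y0).
  pose H (l : 'I_q) (u : pt) : pt := if l == sg then fun=> u j else leave u c.
  have E (x : point) : target sg d0 (base_values (M := M) y0 (fun l => H l (x l))) <-> chi (x sg j sK) x.
    rewrite -(chisg _ x (fun i => if i == j then put y0 (x sg j sK) else y0)).
    have := Hphi (x sg j sK) (fun k => x (lift sg k)).
    rewrite comb_self eqxx putE.
    have -> : comb sg (fun i => if i == j then put y0 (x sg j sK) else y0) (fun k => x (lift sg k)) =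
      upd x sg (fun i => if i == j then put y0 (x sg j sK) else y0).
      apply: functional_extensionality_dep => l; rewrite /comb /upd.
      by case: unliftP => [k ->|->]; rewrite ?eqxx // eq_sym (negPf (neq_lift _ _)).
    move=> ->; rewrite /target /csat /point_value /value /base_values /= /H eqxx.
    suff -> : cval d0 (base_values (M := M) y0 (fun l => H l (x l))) =
      fun k => ctup (leave (x (lift sg k)) c) by [].
    apply: functional_extensionality_dep => k; apply: functional_extensionality_dep => i.
    by rewrite /cval /value /base_values /= /H eq_sym (negPf (neq_lift _ _)).
  by apply: (Rand_map (F := H)) HR => x; rewrite E.
have [|p [p_tp p_NIP p_all]] := M_Im (Kpart sg g) (point_value sg g sK)
  (Kpart_small nat_Lam S_Lam Lam_kappa y0 sg dec_all g_obeys).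
  by move=> k; apply: Kpart_immediate.
apply: (no_NIP_type M_sat nat_Lam S_Lam Lam_kappa y0 g_free p_tp p_NIP).
apply/p_all; last exact: g_target.
by move=> k i; exists (Base (lift sg k)), (nth (0, sK) (coords vf_sorts m) i).1; rewrite /= eqxx.
Qed.

End ValuedField.

(** * Transfer to and from the sorts *)

Section Transfer.

Variables (kappa Lam S : Type) (L : language S) (M : structure L).
Hypothesis M_sat : saturated kappa M.
Hypotheses (nat_Lam : embeds nat Lam) (S_Lam : embeds S Lam).
Hypothesis Lam_kappa : card_lt Lam kappa.
Variables (s0 : S) (y0 : Y M) (n : nat) (Ss : seq S).
Hypothesis Ss_all : forall s, List.In s Ss.
Hypothesis n_gt0 : 0 < n.

Local Notation Y := (Y M).
Local Notation q := n.+1.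
Local Notation pt := (pt M).
Local Notation point := (point M n).
Local Notation definable := (@definable S L M n).

Definition spread (c : ctx S) (u : tup M c) : pt :=
  fun j => if insub j is Some i then put y0 (u i) else y0.

Lemma spreadE (c : ctx S) (u : tup M c) (i : 'I_(len c)) : spread u i (srt i) = u i.
Proof. by rewrite /spread valK putE. Qed.

Section OneSorted.

Variables (s : S) (L' : language unit) (N : interp L' (fun _ : unit => M s)).
Hypothesis N_def : definable_structure N.

Theorem NIP_sort : theory_NIP n M -> theory_NIP n (Structure N).
Proof.
move=> M_NIP xs zs psi [a [b Hab]]; pose sg : 'I_q := ord0.
pose Q (z : point) := @psat _ L' (Structure N) n xs zs psi (fun i => z sg i s)
  (fun k i => z (lift sg k) i s).
have dQ : definable Q.
  have := Dfn_ren (fun v : 'I_(len xs) + {k & 'I_(len (zs k))} => match v return 'I_q * nat with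
    inl i => (sg, val i) | inr ki => (lift sg (tag ki), val (tagged ki)) end)
    (Dfn_transl s0 y0 N_def psi).
  by apply: Dfn_iff => g; apply: sat_ext => -[i|[k i]].
have [m [c Hmc]] := to_pformula s0 y0 Ss_all n_gt0 sg dQ.
pose xs' : ctx S := @Ctx S (len xs) (fun=> s).
have [j u jm|phi Hphi] := Hmc xs' (tup M xs') id (@spread xs').
  case E: (insub j : option 'I_(len xs)) => [i|]; last by right=> z; rewrite /spread E.
  have [su|su] := EM (s = u); last by right=> z; rewrite /spread E /put; case: pselect.
  left; exists i, su => z; rewrite /spread E /put; case: pselect => // e.
  by rewrite (Prop_irrelevance e su).
pose zs' k : ctx S := @Ctx S (len (zs k)) (fun=> s).
pose a' k i : pt := @spread (zs' k) (a k i).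
have nIP : ~ has_IP M phi by apply: M_NIP.
apply: nIP; exists (fun k i => ctup (leave (a' k i) c)), b => J i.
rewrite -(Hphi (b J) (fun k => a' k (i k))) -Hab.
apply: sat_ext => -[j|[k j]] /=; first by rewrite comb_self (@spreadE xs').
by rewrite comb_lift; exact: (@spreadE (zs' k) (a k (i k)) j).
Qed.

End OneSorted.

(** The elements at the first [m] positions of the point [sg] are fixed, one sort
    after the other. *)
Lemma fix_group (l : seq S) (sg : 'I_q) (m : nat) (P1 P0 : point -> Prop) :
  (forall s, @coord_free S L M n s) -> definable P1 -> definable P0 -> Rand P1 P0 ->
  exists a : pt,
    Rand (fun x => P1 x /\ forall s j, List.In s l -> j < m -> x sg j s = a j s)
         (fun x => P0 x /\ forall s j, List.In s l -> j < m -> x sg j s = a j s).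
Proof.
move=> Hfree; elim: l P1 P0 => [|s l IH] P1 P0 dP1 dP0 HR.
  by exists (fun=> y0); apply: Rand_weaken HR => x Px; split.
have [i _||||a0 Ha0] := @fix_many S L M y0 n s _ (iota 0 m) (fun j x => x sg j s) P1 P0.
- split; first exact: dfun_coord.
  exact: (fixable_coord M_sat nat_Lam S_Lam Lam_kappa s0 y0).
- exact: dP1.
- exact: dP0.
- exact: HR.
have dfix (P : point -> Prop) : definable P ->
    definable (fun x => P x /\ forall i, i \in iota 0 m -> x sg i s = a0 i).
  move=> dP; apply: definable_and => //.
  elim: (iota 0 m) => [|i js IHj].
    by apply: (@Dfn_iff S L M _ (fun=> True)) (Dfn_const s0 y0 _ True).
  have di : definable (fun x => x sg i s = a0 i).
    exact: (dfun_const y0 (a0 i) (dfun_coord y0 sg i s)).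
  apply: (@Dfn_iff S L M _ (fun g : 'I_q * nat -> Y => g (sg, i) s = a0 i /\
    forall k, k \in js -> g (sg, k) s = a0 k)); last exact: (definable_and y0 di IHj).
  move=> g; split=> [[gi gj] k|H].
    by rewrite inE => /orP [/eqP ->|/gj].
  by split=> [|k kj]; apply: H; rewrite inE ?eqxx ?kj ?orbT.
have [a Ha] := IH _ _ (dfix P1 dP1) (dfix P0 dP0) Ha0.
exists (fun j s' => if pselect (s = s') then put y0 (a0 j) s' else a j s').
apply: Rand_weaken Ha => x [[Px x0] xa]; split=> // s' j s'l jm;
  (case: pselect => [ss|ss] /=;
    [by subst s'; rewrite putE x0 // mem_iota | by apply: xa => //; case: s'l]).
Qed.

(** An array with IP_n gives a random predicate; once the relevant coordinates of
    one point are fixed, the predicate ignores this point. *)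
Theorem NIP_of_coord_free : (forall s, @coord_free S L M n s) -> theory_NIP n M.
Proof.
move=> Hfree xs ys phi [a [b Hab]]; pose sg : 'I_q := ord0.
pose P (z : point) := psat phi (fun i => z sg i (srt i)) (fun k i => z (lift sg k) i (srt i)).
have dP : definable P.
  have := Dfn_sat y0 phi (fun v : 'I_(len xs) + {k & 'I_(len (ys k))} =>
    match v return 'I_q * nat with
    inl i => (sg, val i) | inr ki => (lift sg (tag ki), val (tagged ki)) end).
  by apply: Dfn_iff => g; apply: sat_ext => -[i|[k i]].
have HR : Rand P (fun x => ~ P x).
  move=> W R.
  pose J (w : W) (i : {ffun 'I_n -> nat}) := exists2 v : {ffun 'I_q -> W}, R v &
    v sg = w /\ forall k, i k = enum_rank (v (lift sg k)).
  exists (fun l w => if unlift sg l is Some k then spread (a k (enum_rank w))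
    else spread (b (J w))) => v.
  have PE : P (at_edge (fun l w => if unlift sg l is Some k then spread (a k (enum_rank w))
      else spread (b (J w))) v) <-> R v.
    have -> : R v <-> J (v sg) [ffun k => (enum_rank (v (lift sg k)) : nat)].
      split=> [Rv|[v' Rv' [v'sg v'l]]]; first by exists v => //; split=> // k; rewrite ffunE.
      suff -> : v = v' by [].
      apply/ffunP => l; case: (unliftP sg l) => [k ->|->//].
      by have := v'l k; rewrite ffunE => /ord_inj /enum_rank_inj.
    rewrite -Hab; apply: sat_ext => -[j|[k j]] /=.
      by rewrite /at_edge unlift_none spreadE.
    by rewrite /at_edge liftK spreadE ffunE.
  by case: (R v) PE => /= [[_ H]|[H _]]; [apply: H | move=> /H].
have [m Hm] := finite_support y0 dP.
have [c Hc] := fix_group Ss sg m Hfree dP (definable_not dP) HR.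
apply: (@Rand_indep S L M n (fun x => P (upd x sg c)) sg).
  move=> x u; suff -> : upd (upd x sg u) sg c = upd x sg c by [].
  by apply: functional_extensionality_dep => l; rewrite /upd; case: eqP.
have key x : (forall s j, List.In s Ss -> j < m -> x sg j s = c j s) -> P (upd x sg c) <-> P x.
  move=> xc; apply: Hm => l j jm; rewrite /upd; have [->|//] := eqVneq l sg.
  by apply: functional_extensionality_dep => s; rewrite xc.
by apply: Rand_weaken Hc => x [Px /key]; tauto.
Qed.

End Transfer.

Theorem corollary3p8 (n : nat) (X : language vf_sort)
    (T : theory (vf_language X)) (kappa : Type)
    (M : structure (vf_language X)) (Xk XG : language unit)
    (k : interp (lsum ring_language Xk) (fun _ : unit => M sk))
    (G : interp (lsum ogroup_language XG) (fun _ : unit => M sG)) :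
  (1 <= n)%N ->
  complete T ->
  (forall N : structure (vf_language X), model T N -> is_valued_field N) ->
  monster kappa T M ->
  expands_ring k (residue_field M) -> definable_structure k ->
  expands_ogroup G (value_group M) -> definable_structure G ->
  SE kappa n k G ->
  Im kappa n M ->
  (theory_NIP n M <->
   theory_NIP n (Structure k) /\ theory_NIP n (Structure G)).
Proof.
move=> n_gt0 _ T_vf [MT Lam_kappa M_sat _] _ k_def _ G_def [k_SE G_SE] M_Im.
have M_vf := T_vf M MT.
pose L := vf_language X; pose Lam := (vf_sort + Defs.fsym L + rsym L + nat)%type.
have S_Lam : embeds vf_sort Lam by exists (fun s => inl (inl (inl s))) => s s' [].
have f_Lam : embeds (Defs.fsym L) Lam by exists (fun f => inl (inl (inr f))) => f f' [].
have r_Lam : embeds (rsym L) Lam by exists (fun r => inl (inr r)) => r r' [].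
have nat_Lam : embeds nat Lam by exists inr => i j [].
pose y0 : Y M := fun s => match s return M s with
  | sK => rzero (field_K M) | sk => rzero (residue_field M)
  | sG => gzero (value_group M) end.
split=> [M_NIP|[k_NIP G_NIP]].
  by split; apply: (NIP_sort sK y0 vf_sortsP n_gt0).
have kf := coord_free_embedded M_sat nat_Lam S_Lam Lam_kappa sK y0 k_def vf_sortsP n_gt0 k_SE k_NIP.
have Gf := coord_free_embedded M_sat nat_Lam S_Lam Lam_kappa sK y0 G_def vf_sortsP n_gt0 G_SE G_NIP.
have Kf : @coord_free _ L M n sK.
  apply: (coord_free_K M_sat nat_Lam S_Lam f_Lam r_Lam Lam_kappa M_vf y0 n_gt0 M_Im).
  case=> // _ A AT.
    exact: (fixables_embedded M_sat nat_Lam S_Lam Lam_kappa sK y0 k_def vf_sortsP n_gt0 k_SE k_NIP).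
  exact: (fixables_embedded M_sat nat_Lam S_Lam Lam_kappa sK y0 G_def vf_sortsP n_gt0 G_SE G_NIP).
by apply: (NIP_of_coord_free M_sat nat_Lam S_Lam Lam_kappa sK y0 vf_sortsP); case.
Qed.
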